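(* Let $T=(T_g)_{g\in G}$ be the probability preserving action of $G=\mathbb{Z}\times(\mathbb{R}\rtimes\mathbb{Z}_2)$ on $(X,\mathfrak{B},\mu)$ constructed in the context. Then the transformation $T_{(1,0,0)}$ is 2-fold simple and $C(T_{(1,0,0)})=\{T_g : g\in G\}$.
   Context: **Joinings.** For an ergodic invertible measure preserving transformation $S$ of a standard probability space $(X,\mathfrak{B},\mu)$: $C(S)$ is the centralizer, i.e. the group of $\mu$-preserving invertible transformations commuting with $S$ (mod null sets). A 2-fold self-joining of $S$ is an $S\times S$-invariant measure on $X\times X$ projecting to $\mu$ on both coordinates; $J_2^e(S)$ is the set of ergodic ones. For $R\in C(S)$, $\mu_R(A\times B):=\mu(A\cap R^{-1}B)$. $S$ is 2-fold simple if $J_2^e(S)\subset\{\mu_R : R\in C(S)\}\cup\{\mu\times\mu\}$. **Group and notation.** $\mathbb{Z}_2=\{0,1\}$ and $G=\mathbb{Z}\times(\mathbb{R}\rtimes\mathbb{Z}_2)$ has multiplication $(x,a,n)(y,b,m)=(x+y,\,a+(-1)^n b,\,n+m)$. $\lambda$ is a Haar measure on $G$ (counting $\times$ Lebesgue $\times$ counting, up to a constant). $G^0=\mathbb{Z}\times\mathbb{R}\times\{0\}$, $G^1=G\setminus G^0$, and $A^i=A\cap G^i$ for $A\subset G$. Products of subsets of $G$ are algebraic products. $(-a,a]_{\mathbb{Z}}$ and $(-a,a]_{\mathbb{R}}$ are intervals in $\mathbb{Z}$ and $\mathbb{R}$. For a finite set $D$, $\kappa_D$ is the equidistributed probability on $D$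 (viewed also as a measure on any set containing $D$). For a finite signed measure $\nu$ on a finite set $D$, $\|\nu\|_1=\sum_{d\in D}|\nu(d)|$. For a map $s$ from a finite set $Y$, $\mathrm{dist}_{y\in Y}s(y)=\frac1{|Y|}\sum_{y\in Y}\delta_{s(y)}$. **Construction.** Let $(r_n)_{n\ge0}$ be an increasing sequence of positive integers with $n^4/r_n\to0$. Put $\widetilde a_0=1$ and, for $n\ge1$, $a_n=(2r_{n-1}+1)\widetilde a_{n-1}$, $b_n=(2n-1)\widetilde a_{n-1}$, $\widetilde a_n=a_n+b_n+n$. Let $I_n=\{-n,\dots,n\}^2$, $H_n=\{-r_n,\dots,r_n\}^2$, $F_n=(-a_n,a_n]_{\mathbb{Z}}\times(-a_n,a_n]_{\mathbb{R}}\times\mathbb{Z}_2$, $S_n=(-b_n,b_n]_{\mathbb{Z}}\times(-b_n,b_n]_{\mathbb{R}}\times\mathbb{Z}_2$, $\widetilde F_n=(-\widetilde a_n,\widetilde a_n]_{\mathbb{Z}}\times(-\widetilde a_n,\widetilde a_n]_{\mathbb{R}}\times\mathbb{Z}_2$, and let $\phi_n:\mathbb{Z}^2\to G$ be the homomorphism $\phi_n(i,j)=(2i\widetilde a_n,2j\widetilde a_n,0)$. The following choices are made recursively in $n\ge1$ (the condition on $r_n$ depends on earlier choices): - $\xi_n$ is a finite Borel partition of $F_n$ such that (i) each atom has diameter $<1/n$ (standard product metric on $\mathbb{Z}\times\mathbb{R}\times\mathbb{Z}_2$); (ii) for $n\ge2$, $Ac$ is $\xi_n$-measurable (a union of atoms)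 for each atom $A\in\xi_{n-1}$ and $c\in C_n$ ($C_n$ is defined below); (iii) $A^{-1}\in\xi_n$ whenever $A\in\xi_n$ and $A^{-1}\subset F_n$. - $D_n\subset S_n$ is a finite set with $|D_n^0|=|D_n^1|$ such that, with $f_{A,B}(x,y)=\lambda(Ax\cap By)/\lambda(F_n)$, $$\left|\int_{S_n\times S_n}f_{Ag,Bh}\,d\kappa_{D_n}d\kappa_{D_n}-\frac1{\lambda(S_n)^2}\int_{S_n\times S_n}f_{Ag,Bh}\,d\lambda\,d\lambda\right|<\frac1n$$ for all $\xi_n$-measurable $A,B\subset F_n$ and all $g,h\in F_n$ with $AgS_n,BhS_n\subset F_n$. - $r_n$ is so large that there exists, and we fix, a map $s_n:H_n\to D_n$ such that for every integer $N>r_n/n^2$ and all $h\ne h'$ in $H_n\cap(H_n-(N-1,0))$, $$\left\|\mathrm{dist}_{0\le t<N}\big(s_n(h+(t,0)),s_n(h'+(t,0))\big)-\kappa_{D_n}\times\kappa_{D_n}\right\|_1<\frac1n .$$ - $c_{n+1}:H_n\to G$, $c_{n+1}(h)=s_n(h)\phi_n(h)$, and $C_{n+1}=c_{n+1}(H_n)$. Then the sets $F_nc$, $c\in C_{n+1}$, are pairwise disjoint subsets of $F_{n+1}$. **The $(C,F)$-action.** For $n\ge1$ let $X_n=F_n\times\prod_{k>n}C_k$ with the product of the measure $(|C_2|\cdots|C_n|)^{-1}\lambda\restriction F_n$ and the equidistributed probabilities on the $C_k$. Embed $X_n$ in $X_{n+1}$ by $(f_n,c_{n+1},c_{n+2},\dots)\mapsto(f_nc_{n+1},c_{n+2},\dots)$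 (this preserves measure), and let $(X,\mathfrak{B},\mu)$ be the inductive limit $X=\bigcup_nX_n$; the resulting measure is finite and $\lambda$ is normalized so that $\mu(X)=1$. For $g\in G$ one has $gF_nC_{n+1}\subset F_{n+1}$ for all large $n$; for such $n$ and $x=(f_n,c_{n+1},c_{n+2},\dots)\in X_n$ put $T_gx=(gf_nc_{n+1},c_{n+2},\dots)\in X_{n+1}$. This defines a $\mu$-preserving action $T=(T_g)_{g\in G}$ of $G$ on $X$. *)

(* Defs.v *)
From HB Require Import structures.
From mathcomp Require Import all_boot all_order all_algebra finmap.
From mathcomp Require Import all_classical all_reals all_analysis.
Set Implicit Arguments.
Unset Strict Implicit.
Unset Printing Implicit Defensive.
Import Order.TTheory GRing.Theory Num.Theory.
Import numFieldNormedType.Exports.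
Local Open Scope classical_set_scope.
Local Open Scope ring_scope.

Section Joinings.
Context {R : realType} {d : measure_display} {X : measurableType d}.

Definition measure_preserving (mu : probability X R) (S : X -> X) : Prop :=
  measurable_fun setT S /\
  forall A, measurable A -> mu (S @^-1` A) = mu A.

Definition ergodic (mu : probability X R) (S : X -> X) : Prop :=
  forall A, measurable A -> S @^-1` A = A -> mu A = 0%E \/ mu A = 1%E.

(* Invertibility is understood modulo null sets. *)
Definition invertible_mpt (mu : probability X R) (S : X -> X) : Prop :=
  measure_preserving mu S /\
  exists S' : X -> X, [/\ measurable_fun setT S',
    {ae mu, forall x, S' (S x) = x} & {ae mu, forall x, S (S' x) = x}].

(* Elements are representatives; two of them define the same element of the
   centralizer group when they agree almost everywhere. *)
Definition centralizer (mu : probability X R) (S : X -> X) : set (X -> X) :=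
  [set Q | invertible_mpt mu Q /\ {ae mu, forall x, Q (S x) = S (Q x)}].

End Joinings.

Section Simplicity.
Context {R : realType} {d : measure_display} {X : measurableType d}.
Variables (mu : probability X R) (S : X -> X).

Definition square_map (p : X * X) : X * X := (S p.1, S p.2).

Definition self_joining (nu : probability (X * X)%type R) : Prop :=
  [/\ forall E, measurable E -> nu (square_map @^-1` E) = nu E,
      forall A, measurable A -> nu (A `*` setT) = mu A &
      forall A, measurable A -> nu (setT `*` A) = mu A].

Definition ergodic_self_joining (nu : probability (X * X)%type R) : Prop :=
  self_joining nu /\ ergodic nu square_map.

Definition graph_joining (Q : X -> X) (nu : probability (X * X)%type R) : Prop :=
  forall A B, measurable A -> measurable B ->
    nu (A `*` B) = mu (A `&` Q @^-1` B).

Definition product_joining (nu : probability (X * X)%type R) : Prop :=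
  forall E, measurable E -> nu E = (mu \x mu)%E E.

(* 2-fold simplicity is a property of ergodic invertible transformations. *)
Definition two_fold_simple : Prop :=
  [/\ invertible_mpt mu S, ergodic mu S &
      forall nu : probability (X * X)%type R, ergodic_self_joining nu ->
        (exists2 Q, centralizer mu S Q & graph_joining Q nu) \/
        product_joining nu].

End Simplicity.

HB.instance Definition _ := isPointed.Build int 0.
HB.instance Definition _ := @isMeasurable.Build default_measure_display
  int discrete_measurable discrete_measurable0
  discrete_measurableC discrete_measurableU.

(* [((x, a), n)] stands for (x, a, n); Z_2 is [bool] with [addb]. *)
Definition zrz2 (R : realType) : Type := ((int * measurableTypeR R) * bool)%type.

HB.instance Definition _ (R : realType) := Choice.on (zrz2 R).
HB.instance Definition _ (R : realType) := Measurable.on (zrz2 R).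

Section GroupLaw.
Variable R : realType.
Implicit Types g h k : zrz2 R.

Definition zrz2_mul g h : zrz2 R :=
  ((g.1.1 + h.1.1, g.1.2 + (-1) ^+ g.2 * h.1.2 : R), g.2 (+) h.2).

Definition zrz2_one : zrz2 R := ((0, 0 : R), false).

Definition zrz2_inv g : zrz2 R :=
  ((- g.1.1, - ((-1) ^+ g.2 * g.1.2) : R), g.2).

Lemma zrz2_mulA : associative zrz2_mul.
Proof.
move=> [[x a] n] [[y b] m] [[z c] l]; rewrite /zrz2_mul /=.
by rewrite !addrA addbA mulrDr !addrA mulrA signr_addb.
Qed.

Lemma zrz2_mul1g : left_id zrz2_one zrz2_mul.
Proof. by move=> [[x a] n]; rewrite /zrz2_mul /= !add0r expr0 mul1r. Qed.

Lemma zrz2_mulg1 : right_id zrz2_one zrz2_mul.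
Proof. by move=> [[x a] n]; rewrite /zrz2_mul /= mulr0 !addr0 addbF. Qed.

Lemma zrz2_mulVg : left_inverse zrz2_one zrz2_inv zrz2_mul.
Proof. by move=> [[x a] n]; rewrite /zrz2_mul /= !addNr addbb. Qed.

Lemma zrz2_mulgV : right_inverse zrz2_one zrz2_inv zrz2_mul.
Proof.
move=> [[x a] n]; rewrite /zrz2_mul /= subrr addbb mulrN mulrA -signr_addb.
by rewrite addbb expr0 mul1r subrr.
Qed.

HB.instance Definition _ := isGroup.Build (zrz2 R)
  zrz2_mulA zrz2_mul1g zrz2_mulg1 zrz2_mulVg zrz2_mulgV.

End GroupLaw.

Definition counting_int (R : realType) : set int -> \bar R := counting.
Definition counting_bool (R : realType) : set bool -> \bar R := counting.

HB.instance Definition _ (R : realType) := Measure.on (@counting_int R).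
HB.instance Definition _ (R : realType) := Measure.on (@counting_bool R).

Lemma sigma_finite_counting_int (R : realType) :
  sigma_finite setT (@counting_int R).
Proof.
exists (fun n => [set x : int | (`|x| <= n)%N]).
  by apply/seteqP; split => // x _; exists `|x|%N => /=.
move=> n; split => //; rewrite /counting_int /counting asboolT ?ltry//.
apply: (@sub_finite_set _ _ ((Posz @` `I_n.+1) `|` (Negz @` `I_n.+1))).
  by case=> k /= kn; [left|right]; exists k => //=; rewrite ltnS // ltnW.
by rewrite finite_setU; split; exact: finite_image.
Qed.

Lemma sigma_finite_counting_bool (R : realType) :
  sigma_finite setT (@counting_bool R).
Proof.
exists (fun=> setT); first by apply/seteqP; split => // x _; exists 0%N.
by move=> n; split => //; rewrite /counting_bool /counting asboolT ?ltry//; exact: finite_finset.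
Qed.

HB.instance Definition _ (R : realType) :=
  @Measure_isSigmaFinite.Build _ _ _ (@counting_int R) (sigma_finite_counting_int R).
HB.instance Definition _ (R : realType) :=
  @Measure_isSigmaFinite.Build _ _ _ (@counting_bool R) (sigma_finite_counting_bool R).

(* The library's instance for [m1 \x m2] is shadowed by its instance for
   subprobabilities, so sigma-finiteness of [haar] is established by hand. *)
Lemma sigma_finite_product (R : realType) (d1 d2 : measure_display)
    (T1 : measurableType d1) (T2 : measurableType d2)
    (m1 : {sigma_finite_measure set T1 -> \bar R})
    (m2 : {sigma_finite_measure set T2 -> \bar R}) :
  sigma_finite setT (m1 \x m2)%E.
Proof.
have /sigma_finiteP[F [TF ndF Foo]] := sigma_finiteT m1.
have /sigma_finiteP[G [TG ndG Goo]] := sigma_finiteT m2.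
exists (fun n => F n `*` G n).
  rewrite -setXTT TF TG predeqE => -[x y]; split.
    move=> [/= [n _ Fnx] [k _ Gky]]; exists (maxn n k) => //; split.
    - by move: x Fnx; exact/subsetPset/ndF/leq_maxl.
    - by move: y Gky; exact/subsetPset/ndG/leq_maxr.
  by move=> [n _ []/= ? ?]; split; exists n.
move=> k; have [? ?] := Foo k; have [? ?] := Goo k.
split; first exact: measurableX.
by rewrite product_measure1E// lte_mul_pinfty// ge0_fin_numE.
Qed.

Definition haar_ZR (R : realType) : set (int * measurableTypeR R) -> \bar R :=
  (@counting_int R \x @lebesgue_measure R)%E.
HB.instance Definition _ (R : realType) := Measure.on (@haar_ZR R).
HB.instance Definition _ (R : realType) :=
  @Measure_isSigmaFinite.Build _ _ _ (@haar_ZR R)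
    (sigma_finite_product (@counting_int R) (@lebesgue_measure R)).

(* Unnormalized; the constant making the total mass of X equal to 1 appears in
   [cf_measure]. *)
Definition haar (R : realType) : set (zrz2 R) -> \bar R :=
  (@haar_ZR R \x @counting_bool R)%E.
HB.instance Definition _ (R : realType) := Measure.on (@haar R).
HB.instance Definition _ (R : realType) :=
  @Measure_isSigmaFinite.Build _ _ _ (@haar R)
    (sigma_finite_product (@haar_ZR R) (@counting_bool R)).

Section Sizes.
Variable r : nat -> nat.

Fixpoint atilde (n : nat) : nat :=
  if n is m.+1 then
    ((2 * r m + 1) * atilde m + (2 * n).-1 * atilde m + n)%N
  else 1%N.

(* [asize] and [bsize] are used only for n >= 1. *)
Definition asize (n : nat) : nat := ((2 * r n.-1 + 1) * atilde n.-1)%N.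
Definition bsize (n : nat) : nat := ((2 * n).-1 * atilde n.-1)%N.

Lemma atildeE n : (0 < n)%N -> atilde n = (asize n + bsize n + n)%N.
Proof. by case: n. Qed.

Definition Hset (n : nat) : set (int * int) :=
  [set h | (`|h.1| <= r n)%N /\ (`|h.2| <= r n)%N].

End Sizes.

Section Construction.
Variable R : realType.
Local Notation G := (zrz2 R).

Definition box (a : nat) : set G :=
  [set g : G | - a%:Z < g.1.1 <= a%:Z /\ - (a%:R : R) < g.1.2 <= a%:R].

Definition Fset (r : nat -> nat) (n : nat) : set G := box (asize r n).
Definition Sset (r : nat -> nat) (n : nat) : set G := box (bsize r n).

Definition phi (r : nat -> nat) (n : nat) (h : int * int) : G :=
  ((2 * h.1 * (atilde r n)%:Z, (2 * h.2 * (atilde r n)%:Z)%:~R : R), false).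

(* [cmap r s n] is c_{n+1}, and [Cset r s n] is C_n, meaningful for n >= 2. *)
Definition cmap (r : nat -> nat) (s : nat -> int * int -> G) (n : nat)
    (h : int * int) : G := (s n h * phi r n h)%g.

Definition Cset (r : nat -> nat) (s : nat -> int * int -> G) (n : nat) : set G :=
  cmap r s n.-1 @` Hset r n.-1.

Definition rtrans (A : set G) (c : G) : set G := [set (x * c)%g | x in A].
Definition mulset (A B : set G) : set G := [set (x * y)%g | x in A & y in B].
Definition invset (A : set G) : set G := [set (x^-1)%g | x in A].

(* For diameters less than 1 it is immaterial which of the usual product
   metrics is taken. *)
Definition zrz2_dist (g h : G) : R :=
  Num.max (Num.max (`|g.1.1 - h.1.1|%:~R) `|g.1.2 - h.1.2 : R|)
          (g.2 != h.2)%:R.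

Definition diameter (A : set G) : \bar R :=
  ereal_sup [set (zrz2_dist g h)%:E | g in A & h in A].

Definition finite_borel_partition (xi : set (set G)) (A : set G) : Prop :=
  [/\ finite_set xi, partition xi id A & forall B, xi B -> measurable B].

Definition union_of_atoms (xi : set (set G)) (A : set G) : Prop :=
  exists2 P : set (set G), P `<=` xi & A = \bigcup_(B in P) B.

(* Point masses of the equidistributed probability on D. *)
Definition kappa (T : choiceType) (D : {fset T}) (x : T) : R :=
  (x \in D)%:R / #|` D|%:R.

Definition norm1 (T : choiceType) (D : {fset T}) (nu : T -> R) : R :=
  \sum_(x <- D) `|nu x|.

(* Point masses of dist_{0 <= t < N} u(t). *)
Definition dist (T : eqType) (N : nat) (u : nat -> T) (x : T) : R :=
  (\sum_(0 <= t < N) (u t == x))%N%:R / N%:R.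

(* Invariant under rescaling of the Haar measure. *)
Definition overlap (r : nat -> nat) (n : nat) (A B : set G) (x y : G) : R :=
  fine (haar (rtrans A x `&` rtrans B y)) / fine (haar (Fset r n)).

Definition partition_condition (r : nat -> nat) (s : nat -> int * int -> G)
    (xi : nat -> set (set G)) (n : nat) : Prop :=
  [/\ finite_borel_partition (xi n) (Fset r n),
      forall A, xi n A -> (diameter A < (n%:R^-1)%:E)%E,
      (2 <= n)%N -> forall A c, xi n.-1 A -> Cset r s n c ->
        union_of_atoms (xi n) (rtrans A c) &
      forall A, xi n A -> invset A `<=` Fset r n -> xi n (invset A)].

Definition sample_condition (r : nat -> nat) (xi : nat -> set (set G))
    (n : nat) (D : {fset G}) : Prop :=
  [/\ forall x, x \in D -> Sset r n x,
      #|` [fset x in D | ~~ x.2]%fset| = #|` [fset x in D | x.2]%fset| &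
      forall A B g h,
        union_of_atoms (xi n) A -> union_of_atoms (xi n) B ->
        Fset r n g -> Fset r n h ->
        mulset (rtrans A g) (Sset r n) `<=` Fset r n ->
        mulset (rtrans B h) (Sset r n) `<=` Fset r n ->
        let f := overlap r n (rtrans A g) (rtrans B h) in
        `| \sum_(x <- D) \sum_(y <- D) f x y * (kappa D x * kappa D y)
           - (fine (haar (Sset r n)) ^+ 2)^-1 *
             \int[(@haar R \x @haar R)%E]_(p in Sset r n `*` Sset r n) f p.1 p.2 |
          < n%:R^-1].

Definition mixing_condition (r : nat -> nat) (n : nat) (D : {fset G})
    (s : int * int -> G) : Prop :=
  (forall h, Hset r n h -> s h \in D) /\
  forall (N : nat) (h h' : int * int),
    (r n)%:R / (n ^ 2)%N%:R < N%:R :> R ->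
    Hset r n h -> Hset r n (h.1 + (N%:Z - 1), h.2) ->
    Hset r n h' -> Hset r n (h'.1 + (N%:Z - 1), h'.2) ->
    h <> h' ->
    norm1 (D `*` D)%fset (fun d : G * G =>
      dist N (fun t => (s (h.1 + t%:Z, h.2), s (h'.1 + t%:Z, h'.2))) d
      - kappa D d.1 * kappa D d.2) < n%:R^-1.

Record cf_choices (r : nat -> nat) (xi : nat -> set (set G))
    (D : nat -> {fset G}) (s : nat -> int * int -> G) : Prop := {
  cf_r_gt0 : forall n, (0 < r n)%N;
  cf_r_incr : forall n, (r n < r n.+1)%N;
  cf_r_growth : (n%:R ^+ 4 / (r n)%:R : R) @[n --> \oo] --> (0 : R);
  cf_xi : forall n, (1 <= n)%N -> partition_condition r s xi n;
  cf_D : forall n, (1 <= n)%N -> sample_condition r xi n (D n);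
  cf_s : forall n, (1 <= n)%N -> mixing_condition r n (D n) (s n)
}.

(* A point (f_n, c_{n+1}, c_{n+2}, ...) of X_n is encoded as (f_n, c) with
   c_{n+1+i} = c i. *)
Definition Xset (r : nat -> nat) (s : nat -> int * int -> G) (n : nat) :
    set (G * (nat -> G)) :=
  [set p | Fset r n p.1 /\ forall i, Cset r s (n.+1 + i)%N (p.2 i)].

Definition Xembed (p : G * (nat -> G)) : G * (nat -> G) :=
  ((p.1 * p.2 0%N)%g, fun i => p.2 i.+1).

(* The box A x {c_0} x ... x {c_{k-1}} x C_{n+1+k} x C_{n+2+k} x ... in X_n. *)
Definition Xbox (r : nat -> nat) (s : nat -> int * int -> G) (n : nat)
    (A : set G) (k : nat) (c : nat -> G) : set (G * (nat -> G)) :=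
  [set p | [/\ Xset r s n p, A p.1 & forall i, (i < k)%N -> p.2 i = c i]].

(* Boxes generate the product sigma-algebra of X_n because the C_k are finite. *)
Definition Xmeasurable (r : nat -> nat) (s : nat -> int * int -> G) (n : nat) :
    set (set (G * (nat -> G))) :=
  <<s Xset r s n,
    [set B | exists A k c, measurable A /\ B = Xbox r s n A k c] >>.

(* (X, mu), with the maps iota n : X_n -> X, is an inductive limit of the spaces
   X_n along the embeddings X_n -> X_{n+1}. *)
Record cf_space (r : nat -> nat) (s : nat -> int * int -> G)
    (d : measure_display) (X : measurableType d) (mu : probability X R)
    (iota : nat -> G * (nat -> G) -> X) : Prop := {
  cf_inj : forall n, (1 <= n)%N -> set_inj (Xset r s n) (iota n);
  cf_compat : forall n p, (1 <= n)%N -> Xset r s n p ->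
    iota n p = iota n.+1 (Xembed p);
  cf_union : forall x, exists n p, [/\ (1 <= n)%N, Xset r s n p & iota n p = x];
  cf_measurable : forall B : set X, measurable B <->
    forall n, (1 <= n)%N -> Xmeasurable r s n (Xset r s n `&` iota n @^-1` B);
  (* On X_n, mu is the product of (|C_2| ... |C_n|)^-1 lambda and of the
     equidistributed probabilities, where lambda = z * haar. *)
  cf_measure : exists2 z : R, 0 < z &
    forall n A k c, (1 <= n)%N -> measurable A -> A `<=` Fset r n ->
      (forall i, (i < k)%N -> Cset r s (n.+1 + i)%N (c i)) ->
      mu (iota n @` Xbox r s n A k c) =
        (z%:E * haar A *
         ((\prod_(2 <= j < n.+1) #|` fset_set (Cset r s j)|%:R)^-1 *
          \prod_(i < k) (#|` fset_set (Cset r s (n.+1 + i)%N)|%:R)^-1)%:E)%E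
}.

Definition cf_action (r : nat -> nat) (s : nat -> int * int -> G) (X : Type)
    (iota : nat -> G * (nat -> G) -> X) (T : G -> X -> X) : Prop :=
  forall g n, (1 <= n)%N ->
    (forall f c, Fset r n f -> Cset r s n.+1 c -> Fset r n.+1 (g * f * c)%g) ->
    forall p, Xset r s n p ->
      T g (iota n p) = iota n.+1 ((g * p.1 * p.2 0%N)%g, fun i => p.2 i.+1).

End Construction.

(* Main.v *)
(* Write S for T_(1,0,0). A point at level n + 1 that moves under S crosses about
   r_n / n^2 consecutive tiles of a row (the tiles are the translates of F~_n by
   phi_n(h)). The copy of F_n in the tile of index h is shifted by s_n(h), so by
   the mixing condition the point reads nearly equidistributed samples of D_n; two
   apart points, that is, points in different rows or whose Z-coordinates differ
   by almost the width of a tile or more, read nearly independent samples.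

   The sampling condition on D_n, applied to hulls of sets by atoms of xi_n, gives
   a variance estimate: outside of a bad set of measure O(1/n), the frequency of
   visits to a cylinder along a window is close to its measure. With the
   independence of samples, an apart pair whose first point is not bad visits a
   product of cylinders with nearly the product frequency. The same estimate for a
   single point yields the ergodicity of S.

   Let nu be an ergodic self-joining which is not the product. By Birkhoff's
   theorem, a pair which is apart at a large level n has a bad first point. If it
   is moreover not apart at level n - 1, it is in this situation during a
   proportion only O(1/sqrt n) of a window, because two independent samples of D_n
   seldom bring the points close to each other. Such pairs have measure
   O(n^(-3/2)), so by Borel-Cantelli almost every pair is either eventually not
   apart or apart at all large levels; in the second case its first point is bad
   at all large levels, which has probability 0. Points which are not apart at any
   large level lie in the same tiles, hence in one orbit of G, and by ergodicity
   the element of G relating them is constant: nu is the graph joining of some T_g.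
   An element Q of the centralizer is identified by applying this to the joining
   carried by the graph of Q, which is ergodic and not the product. *)

Require Import Defs.
From mathcomp Require Import all_boot all_order all_algebra finmap.
From mathcomp Require Import all_classical all_reals all_analysis.
From mathcomp Require Import measurable_realfun lebesgue_integral.
From mathcomp Require Import zify ring lra.
Set Implicit Arguments.
Unset Strict Implicit.
Unset Printing Implicit Defensive.
Import Order.TTheory GRing.Theory Num.Theory.
Import numFieldNormedType.Exports.
Local Open Scope classical_set_scope.
Local Open Scope ring_scope.

(** * Birkhoff's theorem *)

(** The obstacle is that the sampling error at level [n] is [1 / n], which yields bad sets of
    measure [O(1/n)]: not summable, so Borel-Cantelli does not apply to them. The missing factor
    comes from [spread]. Stripes of density [1 / l] have an overlap of density [1 / l ^ 2] under
    independent translations, and the sampling condition detects this as long as [l ^ 2 <= n]; hence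
    the rate [1 / sqrt n]. The variance estimate must in turn have leading coefficient 1, since its
    main term has to cancel the square of the density. This requires cheap hulls, which is why
    cylinders over intervals are used: eroding an interval costs at most twice the erosion, and
    intervals determine measures. It also requires a balance between the two halves of [G]: a
    neighbourhood of a point is described by a row, a column and a parity, and the factor 2 due to
    the parity is compensated because [A C_(n+1)] is split almost equally between the halves, by the
    mixing condition and [|D^0| = |D^1|]. *)

Section Visits.
Context {R : realType} {d : measure_display} {X : measurableType d}.
Variables (P : probability X R) (S : X -> X).
Hypothesis pS : measure_preserving P S.

Definition visits (E : set X) (L : nat) (x : X) : R :=
  \sum_(t < L) \1_E (iter t S x).

Lemma visits0 E x : visits E 0 x = 0.
Proof. by rewrite /visits big_ord0. Qed.

Lemma visitsS E L x : visits E L.+1 x = \1_E x + visits E L (S x).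
Proof.
rewrite /visits big_ord_recl; congr (_ + _).
by apply: eq_bigr => i _; rewrite -iterSr.
Qed.

Lemma visits_cat E m n x :
  visits E (m + n) x = visits E m x + visits E n (iter m S x).
Proof.
elim: m x => [|m IH] x; first by rewrite visits0 add0r.
by rewrite addSn !visitsS IH addrA -iterSr.
Qed.

Lemma visits_ge0 E L x : 0 <= visits E L x.
Proof. by apply: sumr_ge0 => i _; rewrite indicE. Qed.

Lemma visits_le E L x : visits E L x <= L%:R.
Proof.
rewrite /visits -[X in _ <= X%:R]card_ord -sumr_const.
by apply: ler_sum => i _; rewrite indicE lern1 leq_b1.
Qed.

Lemma visitsC E L x : visits (~` E) L x = L%:R - visits E L x.
Proof.
apply/eqP; rewrite eq_sym subr_eq addrC /visits -big_split/=.
rewrite (eq_bigr (fun=> 1)) ?sumr_const ?card_ord// => i _.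
by rewrite !indicE in_setC; case: (_ \in _); rewrite ?addr0 ?add0r.
Qed.

Lemma visits_subset E F L x : E `<=` F -> visits E L x <= visits F L x.
Proof.
move=> EF; apply: ler_sum => i _; rewrite !indicE ler_nat.
case: (boolP (_ \in E)) => //; rewrite inE => /EF.
by rewrite -in_setE => ->.
Qed.

Lemma measurable_iter t : measurable_fun setT (iter t S).
Proof.
elim: t => [|t IH]; first exact: measurable_id.
exact: (measurableT_comp pS.1 IH).
Qed.

Lemma measure_preserving_iter t : measure_preserving P (iter t S).
Proof.
split; first exact: measurable_iter.
elim: t => [|t IH] A mA //.
rewrite -(IH _ mA) -(pS.2 (iter t S @^-1` A)).
  by congr (P _); apply/seteqP; split => x /=; rewrite -iterSr.
by rewrite -[X in measurable X]setTI; exact: measurable_iter.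
Qed.

Lemma measurable_visits E L : measurable E -> measurable_fun setT (visits E L).
Proof.
move=> mE; apply: measurable_sum => i.
exact: (measurableT_comp (measurable_indic mE) (measurable_iter i)).
Qed.

Lemma integral_visits E L : measurable E ->
  (\int[P]_x (visits E L x)%:E = L%:R%:E * P E)%E.
Proof.
move=> mE; rewrite /visits; under eq_integral do rewrite -sumEFin.
rewrite ge0_integral_sum//; last first.
  move=> i; apply/measurable_EFinP.
  exact: (measurableT_comp (measurable_indic mE) (measurable_iter i)).
rewrite (eq_bigr (fun=> P E)); last first.
  move=> i _; rewrite -((measure_preserving_iter i).2 _ mE).
  rewrite -[X in _ = P X]setIT -integral_indic//; last first.
    by rewrite -[X in measurable X]setTI; exact: measurable_iter.
have PE : P E = (fine (P E))%:E by rewrite fineK ?fin_num_measure.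
by rewrite PE sumEFin sumr_const card_ord -EFinM mulr_natl.
Qed.

(** Integration turns a bound on the visits during one window into a bound on a measure. With [F] a
    bad set and [E] the pairs that separate, the smallness of the frequency and that of [F]
    multiply. *)
Lemma visits_measure_le E F (L : nat) (c : R) : 0 <= c ->
  measurable E -> measurable F ->
  (forall x, visits E L x <= c * \1_F x) ->
  (L%:R%:E * P E <= c%:E * P F)%E.
Proof.
move=> c0 mE mF H; rewrite -integral_visits//.
rewrite -[X in P X]setIT -integral_indic//.
rewrite -ge0_integralZl//; last first.
  exact/measurable_EFinP/measurable_indic.
apply: ge0_le_integral => //.
- by move=> x _; rewrite lee_fin visits_ge0.
- exact/measurable_EFinP/measurable_visits.
- apply: measurable_funeM; exact/measurable_EFinP/measurable_indic.
- by move=> x _; rewrite -EFinM lee_fin.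
Qed.

End Visits.

Section Birkhoff.
Context {R : realType} {d : measure_display} {X : measurableType d}.
Variables (P : probability X R) (S : X -> X).
Hypothesis pS : measure_preserving P S.
Hypothesis eS : ergodic P S.
Local Notation visits := (visits (R := R) S).

(** Unboundedness of [visits E L x - c * L] replaces a limsup of frequencies above [c]: the count
    changes by at most 1 when [x] is replaced by [S x], so this set is strictly invariant, as
    [ergodic] demands. *)
Definition exceeds (E : set X) (c : R) : set X :=
  [set x | forall M : nat, exists L : nat, c * L%:R + M%:R < visits E L x].

Lemma visits_shift E L x : `|visits E L (S x) - visits E L x| <= 1.
Proof.
have h0 : visits E L (S x) = visits E L x + \1_E (iter L S x) - \1_E x.
  have := visitsS (R := R) S E L x.
  by rewrite -addn1 visits_cat visitsS visits0 addr0 => ->; rewrite addrAC subrr add0r.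
have i01 (y : X) : 0 <= (\1_E y : R) <= 1.
  by rewrite indicE ler0n lern1 leq_b1.
rewrite h0.
have := i01 x; have := i01 (iter L S x).
move=> /andP[h1 h2] /andP[h3 h4]; rewrite ler_norml; apply/andP; split; lra.
Qed.

Lemma exceeds_invariant E c : S @^-1` exceeds E c = exceeds E c.
Proof.
apply/seteqP; split => x /= H M; have [L HL] := H M.+1; exists L;
  have := visits_shift E L x; rewrite ler_norml => /andP[h1 h2];
  move: HL; rewrite -(addn1 M) natrD => HL; lra.
Qed.

Lemma measurable_visits_gt E L c : measurable E ->
  measurable [set x | c < visits E L x].
Proof.
move=> mE; rewrite -[X in measurable X]setTI.
rewrite (_ : [set x | _] = visits E L @^-1` `]c, +oo[); last first.
  by apply/seteqP; split => x /=; rewrite in_itv/= andbT.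
by apply: (measurable_visits pS) => //; exact: measurable_itv.
Qed.

Lemma measurable_exceeds E c : measurable E -> measurable (exceeds E c).
Proof.
move=> mE; rewrite (_ : exceeds E c =
  \bigcap_M \bigcup_L [set x | c * L%:R + M%:R < visits E L x]); last first.
  apply/seteqP; split => x /= H M.
    by move=> _; have [L HL] := H M; exists L.
  by have [L _ HL] := H M I; exists L.
apply: bigcap_measurable => // M _; apply: bigcup_measurable => L _.
exact: measurable_visits_gt.
Qed.

(* Greedy covering: every orbit segment is cut into single points of [B] and
   blocks of length at most [M] on which the frequency of [E] exceeds [c]. *)
Lemma visits_cover E (c : R) (M : nat) : 0 <= c <= 1 ->
  let B := [set x | forall n, (n <= M)%N -> visits E n x <= c * n%:R] in
  forall L x, c * (L%:R - M%:R) <= visits (E `|` B) L x.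
Proof.
move=> /andP[c0 c1] B L; elim/ltn_ind: L => L IH x.
case: (leqP L M) => [LM|ML].
  apply: (le_trans _ (visits_ge0 _ _ _ _)).
  by rewrite mulr_ge0_le0// subr_le0 ler_nat.
have [Bx|nBx] := pselect (B x).
  case: L IH ML => [|L] IH ML; first by rewrite ltn0 in ML.
  rewrite visitsS indicE mem_set ?mulr1n; last by right.
  have := IH L (ltnSn L) (S x).
  rewrite -(addn1 L) natrD => h; lra.
have [n nM En] : exists2 n, (n <= M)%N & c * n%:R < visits E n x.
  apply: contrapT => h; apply: nBx => n nM; rewrite leNgt; apply/negP => hn.
  by apply: h; exists n.
have n0 : (0 < n)%N by case: n En {nM} => //; rewrite visits0 mulr0 ltxx.
have nL : (n <= L)%N by rewrite (leq_trans nM)// ltnW.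
rewrite -(subnKC nL) visits_cat natrD.
have h1 := IH (L - n)%N ltac:(lia) (iter n S x).
have h2 : visits E n x <= visits (E `|` B) n x.
  by apply: visits_subset => y; left.
lra.
Qed.

(** Otherwise the set has full measure by ergodicity, and the sets [B M] of points without a block
    of length at most [M] of excessive frequency decrease to a null set. Adding a small [B M] to [E]
    keeps the measure [p] of the union below [c], whereas the greedy covering, integrated, gives
    [c * (L - M) <= L * p] for all [L]. *)
Lemma exceeds_null E (c : R) : measurable E -> fine (P E) < c ->
  P (exceeds E c) = 0%E.
Proof.
move=> mE PEc; have mB := measurable_exceeds c mE.
case: (eS mB (exceeds_invariant E c)) => // PB1.
have PEfin : (P E = (fine (P E))%:E)%E by rewrite fineK ?fin_num_measure.
have PE0 : 0 <= fine (P E) by rewrite fine_ge0.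
(* For [c > 1] the set is empty, as there are at most [L] visits; the covering lemma is for
   [c <= 1]. *)
have c1 : c <= 1.
  rewrite leNgt; apply/negP => c1.
  have : exceeds E c = set0.
    apply/seteqP; split => x //= /(_ 0%N)[L].
    rewrite addr0 ltNge (le_trans (visits_le _ _ _ _))//.
    by rewrite ler_peMl// ltW.
  by move=> B0; rewrite B0 measure0 in PB1; case: PB1 => /eqP; rewrite eq_sym oner_eq0.
pose B (M : nat) := [set x | forall n, (n <= M)%N -> visits E n x <= c * n%:R].
have mBM M : measurable (B M).
  rewrite (_ : B M = \bigcap_(n in `I_M.+1) ~` [set x | c * n%:R < visits E n x]).
    apply: bigcap_measurable; first by exists 0%N => /=.
    by move=> n _; apply/measurableC/measurable_visits_gt.
  apply/seteqP; split => x /= H n nM.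
    by apply/negP; rewrite -leNgt; exact: H.
  by rewrite leNgt; apply/negP; exact: H.
have B0 : P (\bigcap_M B M) = 0%E.
  apply/eqP; rewrite eq_le measure_ge0 andbT.
  rewrite (@le_trans _ _ (P (~` exceeds E c)))//; last first.
    by rewrite probability_setC// PB1 subee.
  apply: le_measure; rewrite ?inE//.
  - by apply: bigcap_measurable => // M _.
  - exact: measurableC.
  move=> x /= Bx Ex; have [L] := Ex 0%N.
  by rewrite addr0 ltNge (Bx L I L).
have Bcvg : P (B M) @[M --> \oo] --> (0 : \bar R)%E.
  rewrite -B0; apply: nonincreasing_cvg_mu => //.
  - by rewrite (le_lt_trans (probability_le1 _ _))// ltry.
  - exact: bigcap_measurable.
  - move=> m n mn; apply/subsetPset => x Bx k km; apply: Bx.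
    exact: leq_trans mn.
pose e := (c - fine (P E)) / 2.
have e0 : 0 < e by rewrite /e; lra.
have [M PBM] : exists M, (P (B M) < e%:E)%E.
  move/fine_cvgP : Bcvg => [Bfin /cvgrPdist_lt /(_ _ e0)] [K _ HK].
  exists K; have := HK K (leqnn K) => /=; rewrite sub0r normrN.
  rewrite ger0_norm ?fine_ge0//.
  have -> : P (B K) = (fine (P (B K)))%:E by rewrite fineK// fin_num_measure.
  by rewrite lte_fin.
have c0 : 0 <= c by rewrite (le_trans PE0)// ltW.
have mEB : measurable (E `|` B M) by exact: measurableU.
have PEBfin : (P (E `|` B M) = (fine (P (E `|` B M)))%:E)%E.
  by rewrite fineK ?fin_num_measure.
have PEB : fine (P (E `|` B M)) < fine (P E) + e.
  rewrite -lte_fin -PEBfin EFinD -PEfin.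
  rewrite (le_lt_trans (measureU2 P mE (mBM M)))//.
  by rewrite lteD2lE// fin_num_measure.
have H (L : nat) : c * (L%:R - M%:R) <= L%:R * fine (P (E `|` B M)).
  have [LM|ML] := leqP L M.
    rewrite (@le_trans _ _ 0)//.
      by rewrite mulr_ge0_le0// subr_le0 ler_nat.
    by rewrite mulr_ge0// fine_ge0.
  rewrite -lee_fin [leRHS]EFinM -PEBfin -(integral_visits pS)//.
  rewrite -[leLHS](_ : \int[P]_x (c * (L%:R - M%:R))%:E = _)%E; last first.
    by rewrite integral_cst//= probability_setT mule1.
  apply: ge0_le_integral => //.
  - by move=> x _; rewrite lee_fin mulr_ge0// subr_ge0 ler_nat ltnW.
  - exact/measurable_EFinP/(measurable_visits pS).
  - move=> x _; rewrite lee_fin; apply: (@visits_cover E c M _ L x).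
    by rewrite c0 c1.
pose p := fine (P (E `|` B M)).
have cp : 0 < c - p by rewrite /p; move: PEB; rewrite /e; lra.
(* Chosen so that [c * (L - M) > L * p], against [H]. *)
pose L := (Num.truncn (c * M%:R / (c - p))).+1.
have HL : c * M%:R / (c - p) < L%:R by exact: truncnS_gt.
have := H L; rewrite -/p; move: HL; rewrite ltr_pdivrMr// => h1 h2.
exfalso; lra.
Qed.

Theorem birkhoff E : measurable E ->
  {ae P, forall x, forall e : R, 0 < e -> exists K : nat,
    forall L, (K <= L)%N -> `|visits E L x - fine (P E) * L%:R| <= e * L%:R}.
Proof.
move=> mE.
(* The lower bound on the visits to [E] is the upper bound for its complement; the countably many
   margins [1 / (k + 1)] suffice. *)
pose N (k : nat) := exceeds E (fine (P E) + k.+1%:R^-1) `|`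
                    exceeds (~` E) (fine (P (~` E)) + k.+1%:R^-1).
have mN k : measurable (N k).
  by apply: measurableU; apply: measurable_exceeds => //; exact: measurableC.
have N0 k : P (N k) = 0%E.
  apply: null_set_setU.
  - exact: measurable_exceeds.
  - by apply: measurable_exceeds; exact: measurableC.
  - by apply: exceeds_null => //; rewrite ltrDl invr_gt0.
  - by apply: exceeds_null; [exact: measurableC|rewrite ltrDl invr_gt0].
have PEfin : (P E = (fine (P E))%:E)%E by rewrite fineK ?fin_num_measure.
have PCE : fine (P (~` E)) = 1 - fine (P E).
  by rewrite probability_setC// PEfin.
apply: (@negligibleS _ _ _ _ (\bigcup_k N k)); last first.
  apply: negligible_bigcup => k; exists (N k); split => //; exact: N0.
move=> x /= Hx; apply: contrapT => nNx; apply: Hx => e e0.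
pose k := Num.truncn (2 / e).
have ke : k.+1%:R^-1 < e / 2.
  rewrite -[ltRHS]invrK ltf_pV2 ?posrE ?invr_gt0 ?divr_gt0//.
  by rewrite invf_div; exact: truncnS_gt.
have {}nNx : ~ N k x by move=> h; apply: nNx; exists k.
have [h1 h2] : ~ exceeds E (fine (P E) + k.+1%:R^-1) x /\
               ~ exceeds (~` E) (fine (P (~` E)) + k.+1%:R^-1) x.
  by split => h; apply: nNx; [left|right].
have [M1 HM1] : exists M1 : nat, forall L : nat,
    visits E L x <= (fine (P E) + k.+1%:R^-1) * L%:R + M1%:R.
  apply: contrapT => h; apply: h1 => M; apply: contrapT => h1; apply: h.
  exists M => L; rewrite leNgt; apply/negP => hL; apply: h1; by exists L.
have [M2 HM2] : exists M2 : nat, forall L : nat,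
    visits (~` E) L x <= (fine (P (~` E)) + k.+1%:R^-1) * L%:R + M2%:R.
  apply: contrapT => h; apply: h2 => M; apply: contrapT => h2; apply: h.
  exists M => L; rewrite leNgt; apply/negP => hL; apply: h2; by exists L.
pose K := (Num.truncn ((M1 + M2)%:R / (e / 2))).+1.
exists K => L KL.
have HK : (M1 + M2)%:R <= e / 2 * L%:R.
  rewrite mulrC -ler_pdivrMr ?divr_gt0// (le_trans (ltW (truncnS_gt _)))//.
  by rewrite ler_nat.
have L0 : 0 <= L%:R :> R by [].
have M10 : 0 <= M1%:R :> R by [].
have M20 : 0 <= M2%:R :> R by [].
move: (HM1 L) (HM2 L) HK; rewrite visitsC PCE natrD => g1 g2 g3.
have g4 : k.+1%:R^-1 * L%:R <= e / 2 * L%:R by rewrite ler_wpM2r// ltW.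
move: (k.+1%:R^-1) (L%:R : R) g1 g2 g3 g4 => q l g1 g2 g3 g4.
rewrite ler_norml; apply/andP; split; lra.
Qed.

End Birkhoff.

(** * Haar measure on G *)

Section Pushforward.
Context {R : realType} {d1 d2 : measure_display}.
Context {X : measurableType d1} {Y : measurableType d2}.

Definition push_measure (m : {measure set X -> \bar R}) (f : X -> Y)
    (mf : measurable_fun setT f) : {measure set Y -> \bar R} :=
  measure_function_pushforward__canonical__measure_function_Measure m mf.

Lemma push_measureE m f (mf : measurable_fun setT f) A :
  push_measure m mf A = m (f @^-1` A).
Proof. by []. Qed.

Lemma measurable_preimageT (f : X -> Y) (A : set Y) :
  measurable_fun setT f -> measurable A -> measurable (f @^-1` A).
Proof. by move=> mf mA; rewrite -[X in measurable X]setTI; exact: mf. Qed.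

End Pushforward.

Section CountingInvariance.
Context {R : realType}.

Lemma counting_image (T U : choiceType) (f : T -> U) (A : set T) :
  injective f -> counting (f @` A) = counting A :> \bar R.
Proof.
move=> fI; rewrite /counting.
have [Af|Af] := pselect (finite_set A).
  rewrite !asboolT//; last exact: finite_image.
  by rewrite fset_set_image// card_imfset.
rewrite !asboolF// => h; apply: Af.
apply: (sub_finite_set _ (finite_preimage (in2W fI) h)) => x Ax.
by exists x.
Qed.

Lemma counting_preimage_can (T : choiceType) (f g : T -> T) (A : set T) :
  cancel f g -> cancel g f -> counting (f @^-1` A) = counting A :> \bar R.
Proof.
move=> fK gK; rewrite -(@counting_image _ _ g A (can_inj gK)).
congr counting; apply/seteqP; split => x /=.
  by move=> Afx; exists (f x).
by move=> [y Ay <-]; rewrite gK.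
Qed.

End CountingInvariance.

Section LebesgueInvariance.
Context {R : realType}.
Local Notation leb := (@lebesgue_measure R).

Lemma measurable_affine (b : bool) (c : R) :
  measurable_fun setT (fun a : measurableTypeR R => (-1) ^+ b * a + c : measurableTypeR R).
Proof.
apply: measurable_funD => //; apply: measurable_funM => //.
Qed.

Lemma lebesgue_affine (b : bool) (c : R) (A : set (measurableTypeR R)) :
  measurable A ->
  leb ((fun a : measurableTypeR R => (-1) ^+ b * a + c : measurableTypeR R) @^-1` A) = leb A.
Proof.
move=> mA; apply/esym.
apply: (@lebesgue_measure_unique R (push_measure leb (measurable_affine b c))) => //.
move=> _ [[p q] /= _ <-]; rewrite (push_measureE leb (measurable_affine b c)).
have E (x y x' y' : R) : y - x = y' - x' ->
    (if (x%:E < y%:E)%E then y%:E - x%:E else 0)%E =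
    (if (x'%:E < y'%:E)%E then y'%:E - x'%:E else 0)%E.
  move=> h; rewrite !lte_fin -subr_gt0 h subr_gt0; case: ifP => // _.
  by rewrite -!EFinB h.
case: b => /=.
  rewrite expr1 (_ : _ @^-1` _ = `[c - q, c - p[%classic); last first.
    apply/seteqP; split => x /=; rewrite !in_itv/= mulN1r; lra.
  by rewrite !lebesgue_measure_itv/=; apply: E; lra.
rewrite expr0 (_ : _ @^-1` _ = `]p - c, q - c]%classic); last first.
  apply/seteqP; split => x /=; rewrite !in_itv/= mul1r; lra.
by rewrite !lebesgue_measure_itv/=; apply: E; lra.
Qed.

End LebesgueInvariance.

Lemma haar_ZRX (R : realType) (U : set int) (V : set (measurableTypeR R)) :
  measurable V -> haar_ZR (U `*` V) = (counting_int R U * lebesgue_measure V)%E.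
Proof.
move=> mV.
exact: (@product_measure1E _ _ _ _ R (@counting_int R) (@lebesgue_measure R)).
Qed.

Lemma haarX (R : realType) (U : set (int * measurableTypeR R)) (V : set bool) :
  measurable U -> haar (U `*` V) = (haar_ZR U * counting_bool R V)%E.
Proof. by move=> mU; exact: product_measure1E. Qed.

Section Fibers.
Context {R : realType}.
Local Notation G := (zrz2 R).
Local Notation MR := (measurableTypeR R).

Definition fiber (A : set G) (x : int) (n : bool) : set MR :=
  [set a | A ((x, a), n)].

Lemma measurable_fiber (A : set G) x n : measurable A -> measurable (fiber A x n).
Proof.
move=> mA; have h : measurable_fun setT (fun a : MR => (((x, a), n) : G)).
  by apply: measurable_fun_pair => //; apply: measurable_fun_pair.
exact: (measurable_preimageT h mA).
Qed.

Lemma measurable_zrz2P (A : set G) :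
  (forall x n, measurable (fiber A x n)) -> measurable A.
Proof.
move=> mA; rewrite (_ : A = \bigcup_(p : int * bool)
    (([set p.1] `*` fiber A p.1 p.2) `*` [set p.2])).
  apply: countable_bigcupT_measurable => [|p].
    exact: countableP.
  by apply: measurableX => //; apply: measurableX.
apply/seteqP; split => [[[x a] n] Axan|[[x a] n]].
  by exists (x, n).
by move=> [[y m] _] /= [[-> h] ->].
Qed.

Lemma measurable_fun_zrz2 d (Y : measurableType d) (f : G -> Y) :
  (forall x n, measurable_fun setT (fun a : MR => f ((x, a), n))) ->
  measurable_fun setT f.
Proof.
move=> mf _ B mB; rewrite setTI; apply: measurable_zrz2P => x n.
exact: (measurable_preimageT (mf x n) mB).
Qed.

Lemma measurable_zrz2_prodP (A : set (G * G)) :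
  (forall x n y m, measurable
    [set ab : MR * MR | A (((x, ab.1), n), ((y, ab.2), m))]) -> measurable A.
Proof.
move=> mA; rewrite (_ : A = \bigcup_(p : (int * bool) * (int * bool))
    ((fun q : G * G => (q.1.1.2 : MR, q.2.1.2 : MR)) @^-1`
       [set ab : MR * MR | A (((p.1.1, ab.1), p.1.2), ((p.2.1, ab.2), p.2.2))] `&`
     (([set p.1.1] `*` setT) `*` [set p.1.2]) `*`
     (([set p.2.1] `*` setT) `*` [set p.2.2]))).
  apply: countable_bigcupT_measurable => [|p]; first exact: countableP.
  apply: measurableI.
    apply: (measurable_preimageT _ (mA _ _ _ _)).
    apply: measurable_fun_pair.
      apply: (measurableT_comp (f := snd)) => //.
      by apply: (measurableT_comp (f := fst)) => //; exact: (measurableT_comp (f := fst)).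
    apply: (measurableT_comp (f := snd)) => //.
    by apply: (measurableT_comp (f := fst)) => //; exact: (measurableT_comp (f := snd)).
  by apply: measurableX; apply: measurableX => //; apply: measurableX.
apply/seteqP; split => [[[[x a] n] [[y b] m]] h|[[[x a] n] [[y b] m]]].
  by exists ((x, n), (y, m)).
by move=> [[[x' n'] [y' m']] _] /= [h [[[-> _] ->] [[-> _] ->]]].
Qed.

(* All the translations and inversions of the group have this shape, with data
   depending only on the [Z_2]-coordinate. *)
Definition fiberwise_affine (e : bool -> bool) (c : bool -> int)
    (e' : bool -> bool) (c' : bool -> R) (m : bool) (g : G) : G :=
  (((-1) ^+ e g.2 * g.1.1 + c g.2, (-1) ^+ e' g.2 * g.1.2 + c' g.2 : R), g.2 (+) m).

Lemma measurable_fiberwise_affine e c e' c' m :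
  measurable_fun setT (fiberwise_affine e c e' c' m).
Proof.
apply: measurable_fun_zrz2 => x n; rewrite /fiberwise_affine /=.
apply: measurable_fun_pair => //; apply: measurable_fun_pair => //.
exact: measurable_affine.
Qed.

(** Left and right translations and [g -> w * g^-1] are instances, so this contains the
    unimodularity of [G]. For each value of the [Z_2]-coordinate the map is a product of measure
    preserving maps, and uniqueness of product measures reduces the claim to rectangles. *)
Lemma haar_fiberwise_affine e c e' c' m (A : set G) : measurable A ->
  haar (fiberwise_affine e c e' c' m @^-1` A) = haar A.
Proof.
move=> mA; rewrite -(push_measureE (@haar R) (measurable_fiberwise_affine e c e' c' m)).
apply/esym; apply: product_measure_unique => // {A mA} A B mA mB.
rewrite (push_measureE (@haar R) (measurable_fiberwise_affine e c e' c' m)).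
pose A_ n := (fun p : int * MR => ((-1) ^+ e n * p.1 + c n,
   (-1) ^+ e' n * p.2 + c' n : MR)) @^-1` A.
have mA_ n : measurable_fun setT (fun p : int * MR => ((-1) ^+ e n * p.1 + c n,
   (-1) ^+ e' n * p.2 + c' n : MR)).
  apply: measurable_fun_pair.
    exact: (measurableT_comp (f := fun x : int => ((-1) ^+ e n * x + c n : int))).
  exact: (measurableT_comp (measurable_affine (e' n) (c' n))).
have hA n : haar_ZR (A_ n) = haar_ZR A.
  rewrite -(push_measureE (@haar_ZR R) (mA_ n)).
  apply/esym; apply: product_measure_unique => // U V mU mV.
  rewrite (push_measureE (@haar_ZR R) (mA_ n)).
  pose U' := (fun x : int => ((-1) ^+ e n * x + c n : int)) @^-1` U.
  pose V' := (fun a : MR => (-1) ^+ e' n * a + c' n : MR) @^-1` V.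
  transitivity (counting_int R U' * lebesgue_measure V')%E.
    by apply: haar_ZRX; exact: (measurable_preimageT (measurable_affine _ _)).
  rewrite /V' lebesgue_affine//; congr (_ * _)%E.
  apply: (@counting_preimage_can _ _ _ (fun x => (-1) ^+ e n * (x - c n))).
    by move=> x; rewrite addrK mulrA -signr_addb addbb mul1r.
  by move=> x; rewrite mulrA -signr_addb addbb mul1r subrK.
rewrite (_ : _ @^-1` _ = (A_ true `*` [set n | n = true /\ B (n (+) m)]) `|`
   (A_ false `*` [set n | n = false /\ B (n (+) m)])); last first.
  apply/seteqP; split => [[[x a] [|]] /= [h1 h2]|[[x a] n] /=].
  - by left; split.
  - by right; split.
  by move=> [] [h1 [h2 h3]]; rewrite /fiberwise_affine /=; split; move: h1 h3; rewrite h2.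
have mA_n n : measurable (A_ n) by exact: (measurable_preimageT (mA_ n)).
rewrite measureU//; last 3 first.
- exact: measurableX.
- exact: measurableX.
- apply/seteqP; split => // -[p n] /= [] [_ [-> _]] [_ [//]].
have hX n (V : set bool) : haar (A_ n `*` V) = (haar_ZR A * counting_bool R V)%E.
  by rewrite -(hA n); exact: (haarX _ (mA_n n)).
pose B' k := [set n : bool | n = k /\ B (n (+) m)].
transitivity (haar_ZR A * counting_bool R (B' true) +
              haar_ZR A * counting_bool R (B' false))%E.
  by congr (_ + _)%E; exact: hX.
rewrite -ge0_muleDr//; congr (_ * _)%E.
rewrite -measureU//; last first.
  by apply/seteqP; split => // n [[/= -> _] [//]].
transitivity (counting ((fun n => n (+) m) @^-1` B) : \bar R).
  congr counting; apply/seteqP; split => [n [|] []//|[|]] /=.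
    by move=> ?; left.
  by move=> ?; right.
by apply: (@counting_preimage_can _ _ _ (fun n => n (+) m)) => x;
  rewrite -addbA addbb addbF.
Qed.

End Fibers.

Section Translations.
Context {R : realType}.
Local Notation G := (zrz2 R).
Local Notation MR := (measurableTypeR R).
Implicit Types (A K : set G) (c g w x y : G).

Lemma rtransP A c g : rtrans A c g <-> A (g * c^-1)%g.
Proof.
split; first by move=> [a Aa <-]; rewrite mulgK.
by move=> Agc; exists (g * c^-1)%g => //; rewrite mulgVK.
Qed.

Lemma rtransE A c : rtrans A c = (fun g => (g * c^-1)%g) @^-1` A.
Proof. by apply/seteqP; split => g /= /rtransP. Qed.

Lemma rtrans1 A : rtrans A 1%g = A.
Proof. by apply/seteqP; split => g /=; rewrite rtransP invg1 mulg1. Qed.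

Lemma mulr_fiberwise c :
  (fun g => (g * c)%g) = fiberwise_affine (fun=> false) (fun=> c.1.1)
    (fun=> false) (fun n => (-1) ^+ n * c.1.2) c.2.
Proof.
by apply/funext => g; rewrite /fiberwise_affine /= !mul1r.
Qed.

Lemma mull_fiberwise c :
  (fun g => (c * g)%g) = fiberwise_affine (fun=> false) (fun=> c.1.1)
    (fun=> c.2) (fun n => c.1.2) c.2.
Proof.
apply/funext => g; rewrite /fiberwise_affine /= mul1r addbC.
by rewrite [X in ((X, _), _)]addrC [X in ((_, X), _)]addrC.
Qed.

Lemma divgE w g : (w * g^-1)%g =
  ((w.1.1 - g.1.1, (-1) ^+ (~~ (w.2 (+) g.2)) * g.1.2 + w.1.2 : R), w.2 (+) g.2) :> G.
Proof.
transitivity (zrz2_mul w (zrz2_inv g)); first by [].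
rewrite /zrz2_mul /zrz2_inv /=.
by rewrite [X in ((_, X), _)]addrC mulrN mulrA -signr_addb signrN mulNr.
Qed.

Lemma mulV_fiberwise w :
  (fun x => (w * x^-1)%g) = fiberwise_affine (fun=> true) (fun=> w.1.1)
    (fun n => ~~ (w.2 (+) n)) (fun n => w.1.2) w.2.
Proof.
apply/funext => g; rewrite divgE /fiberwise_affine [w.2 (+) g.2]addbC.
by rewrite expr1 mulN1r [X in ((X, _), _)]addrC.
Qed.

Lemma measurable_mulr c : measurable_fun setT (fun g => (g * c)%g).
Proof. by rewrite mulr_fiberwise; exact: measurable_fiberwise_affine. Qed.

Lemma measurable_mull c : measurable_fun setT (fun g => (c * g)%g).
Proof. by rewrite mull_fiberwise; exact: measurable_fiberwise_affine. Qed.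

Lemma measurable_rtrans A c : measurable A -> measurable (rtrans A c).
Proof. by move=> mA; rewrite rtransE; exact: (measurable_preimageT (measurable_mulr _)). Qed.

Lemma haar_rtrans A c : measurable A -> haar (rtrans A c) = haar A.
Proof.
by move=> mA; rewrite rtransE mulr_fiberwise haar_fiberwise_affine.
Qed.

Lemma haar_mull A c : measurable A -> haar ((fun g => (c * g)%g) @^-1` A) = haar A.
Proof. by move=> mA; rewrite mull_fiberwise haar_fiberwise_affine. Qed.

Lemma haar_mulV A w : measurable A -> haar ((fun g => (w * g^-1)%g) @^-1` A) = haar A.
Proof. by move=> mA; rewrite mulV_fiberwise haar_fiberwise_affine. Qed.

Lemma measurable_divg : measurable_fun setT (fun p : G * G => (p.2 * p.1^-1)%g).
Proof.
move=> _ B mB; rewrite setTI; apply: measurable_zrz2_prodP => x n y m /=.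
pose f := fun ab : MR * MR => (-1) ^+ (~~ (m (+) n)) * ab.1 + ab.2 : MR.
have mf : measurable_fun setT f.
  apply: measurable_funD => //; apply: measurable_funM => //.
rewrite (_ : [set ab | _] = f @^-1` fiber B (y - x) (m (+) n)).
  exact: (measurable_preimageT mf (measurable_fiber _ _ mB)).
by apply/seteqP; split => ab; rewrite /f /fiber /= divgE.
Qed.

Lemma measurable_divg_set A : measurable A ->
  measurable [set p : G * G | A (p.2 * p.1^-1)%g].
Proof. exact: (measurable_preimageT measurable_divg). Qed.

Lemma measurable_overlap (K1 K2 : set G) : measurable K1 -> measurable K2 ->
  measurable_fun setT (fun p : G * G => haar (rtrans K1 p.1 `&` rtrans K2 p.2)).
Proof.
move=> mK1 mK2.
pose f (p : G * G) : \bar R := haar (rtrans K1 p.1 `&` rtrans K2 p.2).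
have mE : measurable [set q : (G * G) * G |
    K1 (q.2 * q.1.1^-1)%g /\ K2 (q.2 * q.1.2^-1)%g].
  apply: measurableI.
    apply: (measurable_preimageT (f := fun q : (G * G) * G => (q.1.1, q.2)) _
      (measurable_divg_set mK1)).
    apply: measurable_fun_pair => //.
    by apply: (measurableT_comp (f := fst)) => //; exact: measurable_fst.
  apply: (measurable_preimageT (f := fun q : (G * G) * G => (q.1.2, q.2)) _
      (measurable_divg_set mK2)).
  apply: measurable_fun_pair => //.
  by apply: (measurableT_comp (f := snd)) => //; exact: measurable_fst.
have fE : f = (@haar R) \o xsection [set q : (G * G) * G |
    K1 (q.2 * q.1.1^-1)%g /\ K2 (q.2 * q.1.2^-1)%g].
  apply/funext => p; rewrite /f /=; congr haar; apply/seteqP; split => w.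
    by move=> [/rtransP h1 /rtransP h2]; apply/xsectionP.
  by move=> /xsectionP [h1 h2]; split; apply/rtransP.
rewrite -/f fE; exact: (measurable_fun_xsection (@haar R) mE).
Qed.

(** By Tonelli, for fixed [x] the integral of the overlap over [y] in [S] is the integral over [w]
    in [K1 x] of the measure of the [y] in [S] with [w * y^-1] in [K2], which is at most [e]
    uniformly in [w]. *)
Lemma overlap_integral_le (S K1 K2 : set G) (s k e : R) :
  measurable S -> measurable K1 -> measurable K2 ->
  haar S = s%:E -> haar K1 = k%:E ->
  (forall w, (haar (S `&` [set y | K2 (w * y^-1)%g]) <= e%:E)%E) ->
  (\int[(@haar R \x @haar R)%E]_(p in S `*` S)
      haar (rtrans K1 p.1 `&` rtrans K2 p.2) <= (e * k * s)%:E)%E.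
Proof.
move=> mS mK1 mK2 Ss Kk He.
pose f (p : G * G) : \bar R := haar (rtrans K1 p.1 `&` rtrans K2 p.2).
have mf : measurable_fun setT f by exact: measurable_overlap.
have mSS : measurable (S `*` S) by exact: measurableX.
rewrite integral_mkcond -/f.
have f0 p : (0 <= f p)%E by exact: measure_ge0.
have mfS : measurable_fun setT (f \_ (S `*` S)).
  by apply/(measurable_restrictT f mSS); exact: measurable_funTS.
rewrite (fubini_tonelli1 (m1 := @haar R) (m2 := @haar R) (f \_ (S `*` S)) mfS); last first.
  by move=> p; apply: erestrict_ge0 => q _; exact: f0.
have inner x : (fubini_F (@haar R) (f \_ (S `*` S)) x <= (e * k)%:E * (\1_S x)%:E)%E.
  rewrite /fubini_F; have [Sx|Sx] := pselect (S x); last first.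
    rewrite integral0_eq; last first.
      by move=> y _; rewrite patchE ifF//; apply/negbTE/negP; rewrite inE => -[].
    by rewrite indicE memNset// mule0.
  rewrite indicE mem_set// mule1.
  pose D := [set q : G * G | [/\ S q.1, K1 (q.2 * x^-1)%g & K2 (q.2 * q.1^-1)%g]].
  have mD : measurable D.
    rewrite (_ : D = (fst @^-1` S `&` (fun q : G * G => (q.2 * x^-1)%g) @^-1` K1)
       `&` [set q : G * G | K2 (q.2 * q.1^-1)%g]).
      apply: measurableI; last exact: measurable_divg_set.
      apply: measurableI; first exact: (measurable_preimageT measurable_fst).
      apply: (measurable_preimageT _ mK1).
      apply: (measurableT_comp (measurable_mulr _)); exact: measurable_snd.
    by apply/seteqP; split => q /=; [move=> []|move=> [[]]].
  have -> : (\int[@haar R]_y (f \_ (S `*` S)) (x, y) =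
      \int[@haar R]_y \int[@haar R]_w (\1_D (y, w))%:E)%E.
    apply: eq_integral => y _; rewrite patchE.
    rewrite (_ : (fun w => _) = (fun w => (\1_(xsection D y) w)%:E)); last first.
      by apply/funext => w; rewrite !indicE mem_xsection.
    rewrite integral_indic//; last exact: measurable_xsection.
    rewrite setIT; case: ifPn; rewrite ?inE.
      move=> [_ /= Sy]; congr haar; apply/seteqP; split => w.
        by move=> [/rtransP h1 /rtransP h2]; apply/xsectionP; split.
      by move=> /xsectionP[_ h1 h2]; split; apply/rtransP.
    move=> nS; rewrite (_ : xsection D y = set0) ?measure0//.
    apply/seteqP; split => w // /xsectionP[Sy _ _].
    by apply: (negP nS); rewrite inE.
  rewrite (fubini_tonelli (m1 := @haar R) (m2 := @haar R) (fun q => (\1_D q)%:E))//; last first.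
    exact/measurable_EFinP/measurable_indic.
  apply: (@le_trans _ _ (\int[@haar R]_w (e%:E * (\1_(rtrans K1 x) w)%:E))%E).
    apply: ge0_le_integral => //.
    - by move=> w _; exact: integral_ge0.
    - have := @measurable_fun_fubini_tonelli_G _ _ _ _ _ (@haar R) (fun q => (\1_D q)%:E).
      apply => //; exact/measurable_EFinP/measurable_indic.
    - apply: measurable_funeM; apply/measurable_EFinP/measurable_indic.
      exact: measurable_rtrans.
    - move=> w _.
      rewrite (_ : (fun y => _) = (fun y => (\1_(ysection D w) y)%:E)); last first.
        by apply/funext => y; rewrite !indicE mem_ysection.
      rewrite integral_indic//; last exact: measurable_ysection.
      rewrite setIT; have [K1w|K1w] := pselect (rtrans K1 x w).
        rewrite indicE mem_set// mule1.
        rewrite (_ : ysection D w = S `&` [set y | K2 (w * y^-1)%g]); first exact: He.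
        apply/seteqP; split => y.
          by move=> /ysectionP[].
        by move=> [h1 h2]; apply/ysectionP; split => //; exact/rtransP.
      rewrite (_ : ysection D w = set0) ?measure0 ?indicE ?memNset ?mule0//.
      by apply/seteqP; split => y // /ysectionP[_ /rtransP].
  have e0 : 0 <= e by rewrite -lee_fin (le_trans _ (He 1%g)).
  rewrite ge0_integralZl//; last first.
    by apply/measurable_EFinP; apply: measurable_indic; exact: measurable_rtrans.
  rewrite integral_indic//; last exact: measurable_rtrans.
  have E : haar (rtrans K1 x) = k%:E by rewrite haar_rtrans.
  by rewrite setIT [X in (_ * X)%E]E EFinM.
have e0 : 0 <= e by rewrite -lee_fin (le_trans _ (He 1%g)).
have k0 : 0 <= k by rewrite -lee_fin -Kk.
apply: (@le_trans _ _ (\int[@haar R]_x ((e * k)%:E * (\1_S x)%:E))%E).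
  apply: ge0_le_integral => //.
  - by move=> x _; apply: integral_ge0 => y _; apply: erestrict_ge0 => q _; exact: f0.
  - have := @measurable_fun_fubini_tonelli_F _ _ _ _ _ (@haar R) (f \_ (S `*` S)).
    apply => //; by move=> p; apply: erestrict_ge0 => q _; exact: f0.
  - by apply: measurable_funeM; exact/measurable_EFinP/measurable_indic.
rewrite ge0_integralZl//; last 2 first.
- by apply/measurable_EFinP; exact: measurable_indic.
- by rewrite lee_fin mulr_ge0.
by rewrite integral_indic// setIT [X in (_ * X)%E]Ss -EFinM.
Qed.

End Translations.

(** * Tiles and the sampling condition *)

Section Tiles.
Variables (R : realType) (r : nat -> nat).
Local Notation G := (zrz2 R).
Local Notation at_ := (atilde r).
Implicit Types (f g : G) (n : nat).

Lemma mulgE f g : (f * g)%g =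
  ((f.1.1 + g.1.1, f.1.2 + (-1) ^+ f.2 * g.1.2 : R), f.2 (+) g.2) :> G.
Proof. by []. Qed.

Lemma atilde_gt0 n : (0 < at_ n)%N.
Proof. by case: n => //= n; rewrite addnS. Qed.

Lemma asizeS n : asize r n.+1 = ((2 * r n + 1) * at_ n)%N.
Proof. by []. Qed.

Lemma bsizeS n : bsize r n.+1 = ((2 * n + 1) * at_ n)%N.
Proof. by rewrite /bsize; congr (_ * _)%N; lia. Qed.

Lemma atildeS n : at_ n.+1 = (asize r n.+1 + bsize r n.+1 + n.+1)%N.
Proof. by []. Qed.

(** The summand [-1] fits the intervals of the tiles, which are open on the left and closed on the
    right. *)
Definition col n (u : int) : int := ((u + (at_ n)%:Z - 1) %/ (2 * at_ n)%N%:Z)%Z.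

Definition row n (v : R) : int := Num.ceil ((v - (at_ n)%:R) / (2 * at_ n)%N%:R).

Lemma colP n u : 2 * (at_ n)%:Z * col n u - (at_ n)%:Z < u <= 2 * (at_ n)%:Z * col n u + (at_ n)%:Z.
Proof.
have a0 := atilde_gt0 n.
have := divz_eq (u + (at_ n)%:Z - 1) (2 * at_ n)%N%:Z.
have := modz_ge0 (u + (at_ n)%:Z - 1) (_ : (2 * at_ n)%N%:Z != 0).
have := @ltz_pmod (u + (at_ n)%:Z - 1) (2 * at_ n)%N%:Z.
rewrite -/(col n u).
move: (((u + at_ n - 1) %% (2 * at_ n)%N)%Z) (col n u) (at_ n) a0 => q c a a0 h1 h2 h3.
have {}h1 := h1 ltac:(lia); have {}h2 := h2 ltac:(lia).
lia.
Qed.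

Lemma col_unique n u (i : int) :
  2 * (at_ n)%:Z * i - (at_ n)%:Z < u <= 2 * (at_ n)%:Z * i + (at_ n)%:Z -> col n u = i.
Proof.
have := colP n u; have a0 := atilde_gt0 n.
move: (col n u) (at_ n) a0 => c a a0; nia.
Qed.

Lemma colD n u (k : int) : col n (u + 2 * (at_ n)%:Z * k) = col n u + k.
Proof. by apply: col_unique; have := colP n u; lia. Qed.

Lemma rowP n v : (2 * (at_ n)%:Z * row n v)%:~R - (at_ n)%:R < v
  <= (2 * (at_ n)%:Z * row n v)%:~R + (at_ n)%:R.
Proof.
have a0 : 0 < (at_ n)%:R :> R by rewrite ltr0n atilde_gt0.
have := ceil_itv ((v - (at_ n)%:R) / (2 * at_ n)%N%:R).
rewrite -/(row n v) => /andP[].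
rewrite ltr_pdivlMr ?ler_pdivrMr ?ltr0n ?muln_gt0 ?atilde_gt0//.
rewrite !intrM rmorphB/= !natrM; move: ((row n v)%:~R) => w h1 h2.
apply/andP; split; lra.
Qed.

Lemma row_unique n v (j : int) :
  (2 * (at_ n)%:Z * j)%:~R - (at_ n)%:R < v <= (2 * (at_ n)%:Z * j)%:~R + (at_ n)%:R ->
  row n v = j.
Proof.
have a0 : 0 < (at_ n)%:R :> R by rewrite ltr0n atilde_gt0.
have := rowP n v; rewrite !intrM; move: (row n v) => i /andP[h1 h2] /andP[h3 h4].
have E (x y : int) : (x%:~R : R) < y%:~R + 1 -> (x <= y)%R.
  by move=> h; rewrite -ltzD1 -(ltr_int R) intrD.
apply/eqP; rewrite eq_le; apply/andP; split; apply: E;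
  rewrite -(ltr_pM2l a0); lra.
Qed.

Lemma rowD n v (k : int) : row n (v + (2 * (at_ n)%:Z * k)%:~R) = row n v + k.
Proof.
by apply: row_unique; have := rowP n v; rewrite mulrDr intrD => /andP[h1 h2];
  apply/andP; split; lra.
Qed.

(** Right multiplication by [phi] moves the real coordinate of an element of [G^1] in the opposite
    direction; the sign makes [tile] additive under [phi]. *)
Definition tile n f : int * int := (col n f.1.1, (-1) ^+ f.2 * row n f.1.2).

Definition red n f : G :=
  ((f.1.1 - 2 * (at_ n)%:Z * col n f.1.1,
    f.1.2 - (2 * (at_ n)%:Z * row n f.1.2)%:~R : R), f.2).

Lemma mul_phiE n f h : (f * phi R r n h)%g =
  ((f.1.1 + 2 * (at_ n)%:Z * h.1,
    f.1.2 + (2 * (at_ n)%:Z * ((-1) ^+ f.2 * h.2))%:~R : R), f.2) :> G.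
Proof.
rewrite mulgE /= addbF; congr ((_, _), _).
  by rewrite -mulrA mulrCA; congr (_ + _); lia.
rewrite !intrM rmorphXn/= rmorphN1; lra.
Qed.

Lemma red_tile n f : (red n f * phi R r n (tile n f))%g = f.
Proof.
rewrite mul_phiE /= mulrA -signr_addb addbb mul1r !subrK.
by case: f => -[].
Qed.

Lemma tile_mul_phi n f h : tile n (f * phi R r n h)%g =
  ((tile n f).1 + h.1, (tile n f).2 + h.2).
Proof.
rewrite mul_phiE /tile /= colD rowD mulrDr mulrA -signr_addb addbb mul1r.
by [].
Qed.

Lemma red_mul_phi n f h : red n (f * phi R r n h)%g = red n f.
Proof.
rewrite mul_phiE /red /= colD rowD; congr ((_, _), _); first by lia.
by rewrite !mulrDr !intrD; lra.
Qed.

Lemma box_tile n f : @box R (at_ n) f <-> tile n f = (0, 0).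
Proof.
rewrite /box /= /tile; split => [[h1 h2]|[h1 h2]].
  rewrite (@col_unique _ _ 0) ?(@row_unique _ _ 0) ?mulr0//; by rewrite ?mulr0z ?add0r ?sub0r.
have h3 : row n f.1.2 = 0 by move: h2; case: f.2; rewrite ?expr0 ?expr1 ?mul1r// mulN1r => /eqP; rewrite oppr_eq0 => /eqP.
have := colP n f.1.1; have := rowP n f.1.2.
by rewrite h1 h3 !mulr0 ?mulr0z !add0r => h4 h5.
Qed.

Lemma red_id n f : @box R (at_ n) f -> red n f = f.
Proof.
move=> /box_tile h; have := red_tile n f; rewrite h mul_phiE /= !mulr0 !addr0 => E.
exact: E.
Qed.

Lemma box_phi n f h : @box R (at_ n) f ->
  tile n (f * phi R r n h)%g = h /\ red n (f * phi R r n h)%g = f.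
Proof.
move=> bf; rewrite tile_mul_phi red_mul_phi red_id//; move/box_tile: bf => ->.
by rewrite !add0r; case: h.
Qed.

Lemma Fset_tile n f : @Fset R r n.+1 f <-> Hset r n (tile n f).
Proof.
have a0 := atilde_gt0 n.
have a0R : 0 < (at_ n)%:R :> R by rewrite ltr0n.
rewrite /Fset /box /= /Hset /= asizeS /tile /=.
have -> : `|((-1) ^+ f.2 * row n f.1.2)%R|%N = `|row n f.1.2|%N.
  by case: f.2; rewrite ?expr0 ?expr1 ?mul1r// mulN1r abszN.
have hu := colP n f.1.1; have /andP[hv1 hv2] := rowP n f.1.2.
have h1 : (- ((2 * r n + 1) * at_ n)%N%:Z < f.1.1 <= ((2 * r n + 1) * at_ n)%N%:Z) <->
    (`|col n f.1.1| <= r n)%N.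
  by move: (col n f.1.1) (at_ n) a0 hu => c a a0 hu; split; nia.
have h2 : (- ((2 * r n + 1) * at_ n)%N%:R < f.1.2 <= ((2 * r n + 1) * at_ n)%N%:R) <->
    (`|row n f.1.2| <= r n)%N.
  move: hv1 hv2; rewrite !intrM natrM natrD natrM.
  move: (row n f.1.2) => w hv1 hv2.
  have E (x y : int) : (x%:~R : R) < y%:~R + 1 -> (x <= y)%R.
    by move=> h; rewrite -ltzD1 -(ltr_int R) intrD.
  split=> [/andP[h3 h4]|h].
    suff : (- (r n)%:Z <= w) /\ (w <= (r n)%:Z) by move=> [? ?]; lia.
    split; apply: E; rewrite -(ltr_pM2l a0R) ?rmorphN/=; lra.
  have h3 : - (r n)%:R <= (w%:~R : R) <= (r n)%:R.
    rewrite -[(r n)%:R]/((r n)%:Z%:~R) -rmorphN/= !ler_int; lia.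
  move/andP: h3 => [h3 h4].
  have h5 : (at_ n)%:R * (w%:~R : R) <= (at_ n)%:R * (r n)%:R by rewrite ler_pM2l.
  have h6 : (at_ n)%:R * (- (r n)%:R) <= (at_ n)%:R * (w%:~R : R) by rewrite ler_pM2l.
  apply/andP; split; lra.
by split=> -[/h1 ? /h2].
Qed.

Lemma box_mul (a b c : nat) f g : (a + b < c)%N ->
  @box R a f -> @box R b g -> @box R c (f * g)%g.
Proof.
move=> abc [/= hf1 /andP[hf2 hf3]] [/= hg1 /andP[hg2 hg3]]; split => /=; first lia.
have h : a%:R + b%:R < c%:R :> R by rewrite -natrD ltr_nat.
by apply/andP; case: f.2; rewrite ?expr0 ?expr1; split; lra.
Qed.

Lemma box_sub (a b : nat) : (a <= b)%N -> @box R a `<=` @box R b.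
Proof.
move=> ab g [/= h1 /andP[h2 h3]]; split => /=; first lia.
have h : a%:R <= b%:R :> R by rewrite ler_nat.
by apply/andP; split; lra.
Qed.

Lemma one_box (a : nat) : (0 < a)%N -> @box R a 1%g.
Proof.
move=> a0; have h : 0 < a%:R :> R by rewrite ltr0n.
by split => /=; [lia|apply/andP; split; lra].
Qed.

Lemma Sset_Fset_mul n f g : (0 < n)%N -> @Fset R r n f -> @Sset R r n g ->
  @box R (at_ n) (f * g)%g.
Proof. by case: n => // n _; apply: box_mul; rewrite atildeS; lia. Qed.

Definition shift (t : int) : G := ((t, 0 : R), false).

Lemma shiftE t f : (shift t * f)%g = ((t + f.1.1, f.1.2), f.2) :> G.
Proof. by rewrite mulgE /= add0r mul1r. Qed.

Lemma shiftC t f : (shift t * f)%g = (f * shift t)%g.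
Proof. by rewrite shiftE mulgE /= mulr0 addr0 addbF addrC. Qed.

Lemma shiftD t u : (shift t * shift u)%g = shift (t + u).
Proof. by rewrite shiftE. Qed.

End Tiles.

Section Choices.
Variables (R : realType) (r : nat -> nat) (xi : nat -> set (set (zrz2 R))).
Variables (D : nat -> {fset zrz2 R}) (s : nat -> int * int -> zrz2 R).
Hypothesis hc : cf_choices r xi D s.
Local Notation G := (zrz2 R).
Local Notation at_ := (atilde r).
Implicit Types (f g w : G) (n : nat) (h : int * int).

Lemma s_in_D n h : (0 < n)%N -> Hset r n h -> s n h \in D n.
Proof. by move=> n0; have [H _] := cf_s hc n0; exact: H. Qed.

Lemma D_Sset n x : (0 < n)%N -> x \in D n -> Sset r n x.
Proof. by move=> n0; have [H _ _] := cf_D hc n0; exact: H. Qed.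

Lemma mul_D_box n f x : (0 < n)%N -> Fset r n f -> x \in D n -> box (at_ n) (f * x)%g.
Proof. by move=> n0 Ff /(D_Sset n0); exact: Sset_Fset_mul. Qed.

Lemma cmap_tile n f h : (0 < n)%N -> Fset r n f -> Hset r n h ->
  [/\ tile r n (f * cmap r s n h)%g = h,
      red r n (f * cmap r s n h)%g = (f * s n h)%g &
      Fset r n.+1 (f * cmap r s n h)%g].
Proof.
move=> n0 Ff Hh; rewrite /cmap mulgA.
have bf := mul_D_box n0 Ff (s_in_D n0 Hh).
have [h1 h2] := box_phi h bf; split=> //.
by apply/Fset_tile; rewrite h1.
Qed.

(** The only candidate for the factor in [F_n] of [f]: a point of [F_(n+1)] lies in [F_n C_(n+1)]
    iff [back n f] lies in [F_n]. *)
Definition back n f : G := (red r n f * (s n (tile r n f))^-1)%g.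

Lemma backK n f : (back n f * cmap r s n (tile r n f))%g = f.
Proof. by rewrite /back /cmap mulgA mulgVK red_tile. Qed.

Lemma back_cmap n f h : (0 < n)%N -> Fset r n f -> Hset r n h ->
  back n (f * cmap r s n h)%g = f.
Proof.
by move=> n0 Ff Hh; have [h1 h2 _] := cmap_tile n0 Ff Hh; rewrite /back h1 h2 mulgK.
Qed.

Definition zrange n : seq int := [seq k%:Z - (r n)%:Z | k <- iota 0 (2 * r n).+1].
Definition Hseq n : seq (int * int) := [seq (x, y) | y <- zrange n, x <- zrange n].

Lemma mem_zrange n (z : int) : (z \in zrange n) = (`|z| <= r n)%N.
Proof.
apply/mapP/idP => [[k]|zr]; first by rewrite mem_iota => hk ->; lia.
by exists (absz (z + (r n)%:Z)); [rewrite mem_iota; lia|lia].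
Qed.

Lemma uniq_zrange n : uniq (zrange n).
Proof. by rewrite map_inj_uniq ?iota_uniq// => x y; lia. Qed.

Lemma size_zrange n : size (zrange n) = (2 * r n).+1.
Proof. by rewrite size_map size_iota. Qed.

Lemma mem_Hseq n h : h \in Hseq n <-> Hset r n h.
Proof.
split=> [/allpairsP[[y x] /= [hy hx ->]]|[h1 h2]].
  by split => /=; rewrite -mem_zrange.
by apply/allpairsP; exists (h.2, h.1); split; rewrite ?mem_zrange//; case: h {h1 h2}.
Qed.

Lemma uniq_Hseq n : uniq (Hseq n).
Proof.
apply: allpairs_uniq; rewrite ?uniq_zrange// => -[a b] [c d] _ _ /= [-> ->] //.
Qed.

Lemma size_Hseq n : size (Hseq n) = ((2 * r n).+1 ^ 2)%N.
Proof. by rewrite size_allpairs size_zrange. Qed.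

Definition Cseq n : seq G := [seq cmap r s n h | h <- Hseq n].

Lemma CsetP n c : Cset r s n.+1 c <-> c \in Cseq n.
Proof.
rewrite /Cset /=; split=> [[h Hh <-]|/mapP[h /mem_Hseq Hh ->]]; last by exists h.
by apply/mapP; exists h => //; apply/mem_Hseq.
Qed.

Lemma Fset1 n : (0 < n)%N -> Fset r n (1%g : G).
Proof.
move=> n0; apply: one_box; case: n n0 => // n _.
by rewrite asizeS muln_gt0 atilde_gt0 addn1.
Qed.

Lemma cmap_inj n h h' : (0 < n)%N -> Hset r n h -> Hset r n h' ->
  cmap r s n h = cmap r s n h' -> h = h'.
Proof.
move=> n0 Hh Hh' E; have F1 := Fset1 n0.
have [<- _ _] := cmap_tile n0 F1 Hh; have [<- _ _] := cmap_tile n0 F1 Hh'.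
by rewrite E.
Qed.

Lemma uniq_Cseq n : (0 < n)%N -> uniq (Cseq n).
Proof.
move=> n0; rewrite map_inj_in_uniq ?uniq_Hseq// => h h' /mem_Hseq Hh /mem_Hseq Hh'.
exact: cmap_inj.
Qed.

Lemma card_Cset n : (0 < n)%N -> #|` fset_set (Cset r s n.+1)| = ((2 * r n).+1 ^ 2)%N.
Proof.
move=> n0; rewrite -size_Hseq -(size_map (cmap r s n)) -/(Cseq n).
have -> : Cset r s n.+1 = [set` [fset x in Cseq n]%fset].
  apply/seteqP; split => c /=.
    by move=> /CsetP h; rewrite !inE.
  by rewrite !inE => h; apply/CsetP.
by rewrite set_fsetK card_fseq undup_id// uniq_Cseq.
Qed.

Lemma D_neq0 n : (0 < n)%N -> (0 < #|` D n|)%N.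
Proof.
move=> n0; rewrite cardfs_gt0; apply/fset0Pn; exists (s n (0, 0)).
by apply: s_in_D => //; split.
Qed.

Lemma kappa_ge0 (A : {fset G}) x : 0 <= kappa R A x.
Proof. by rewrite /kappa divr_ge0. Qed.

Lemma sum_kappa n : (0 < n)%N -> \sum_(x <- D n) kappa R (D n) x = 1.
Proof.
move=> n0; rewrite /kappa big_seq_cond (eq_bigr (fun=> #|` D n|%:R^-1)); last first.
  by move=> x /andP[-> _]; rewrite mul1r.
rewrite -big_seq_cond big_const_seq count_predT iter_addr addr0 -[LHS]mulr_natr.
by rewrite mulVf// pnatr_eq0 -lt0n D_neq0.
Qed.

Lemma kappa_parity n (e : bool) : (0 < n)%N ->
  \sum_(x <- D n) kappa R (D n) x * (x.2 == e)%:R = 2^-1.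
Proof.
move=> n0; have [_ E _] := cf_D hc n0; have D0 := D_neq0 n0.
pose d e := \sum_(x <- D n) kappa R (D n) x * (x.2 == e)%:R.
have dE b : d b = (#|` [fset x in D n | x.2 == b]%fset|)%:R / #|` D n|%:R.
  rewrite /d /kappa; under eq_bigr do rewrite mulrAC.
  rewrite -mulr_suml; congr (_ / _).
  rewrite card_fset_sum1 natr_sum big_fset/= [RHS]big_mkcond/=.
  rewrite big_seq_cond [RHS]big_seq_cond; apply: eq_bigr => x /andP[-> _].
  by rewrite mul1r; case: eqP.
have E' : d false = d true.
  rewrite !dE; congr (_%:R / _).
  rewrite (_ : [fset x in D n | x.2 == false]%fset = [fset x in D n | ~~ x.2]%fset); last first.
    by apply/fsetP => x; rewrite !inE/= eqbF_neg.
  rewrite (_ : [fset x in D n | x.2 == true]%fset = [fset x in D n | x.2]%fset)//.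
  by apply/fsetP => x; rewrite !inE/= eqb_id.
have S : d false + d true = 1.
  rewrite -(sum_kappa n0) /d -big_split/=; apply: eq_bigr => x _.
  by case: x.2; rewrite mulr1 mulr0 ?addr0 ?add0r.
rewrite -/(d e); case: e; lra.
Qed.

Lemma dist_sum (T : choiceType) (E : {fset T}) (N : nat) (u : nat -> T) (F : T -> R) :
  (forall t, (t < N)%N -> u t \in E) ->
  \sum_(x <- E) dist R N u x * F x = (\sum_(0 <= t < N) F (u t)) / N%:R.
Proof.
move=> uE; rewrite /dist; under eq_bigr do rewrite mulrAC natr_sum mulr_suml.
rewrite -mulr_suml; congr (_ / _).
rewrite exchange_big/= big_nat_cond [RHS]big_nat_cond; apply: eq_bigr => t /andP[/andP[_ tN] _].
rewrite (big_fsetD1 (u t))/=; last exact: uE.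
rewrite eqxx mul1r big_seq_cond big1 ?addr0// => x /andP[].
by rewrite !inE => /andP[/negbTE xu _] _; rewrite eq_sym xu mul0r.
Qed.

(** The l1-bound of the mixing condition, tested on a function with values in [[-1, 1]]. *)
Lemma mixing_avg n N h h' (F : G -> G -> R) : (0 < n)%N ->
  (r n)%:R / (n ^ 2)%N%:R < N%:R :> R ->
  Hset r n h -> Hset r n (h.1 + (N%:Z - 1), h.2) ->
  Hset r n h' -> Hset r n (h'.1 + (N%:Z - 1), h'.2) ->
  h <> h' -> (forall x y, `|F x y| <= 1) ->
  `|(\sum_(0 <= t < N) F (s n (h.1 + t%:Z, h.2)) (s n (h'.1 + t%:Z, h'.2))) / N%:R
    - \sum_(x <- D n) \sum_(y <- D n) kappa R (D n) x * kappa R (D n) y * F x y|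
  <= n%:R^-1.
Proof.
move=> n0 hN Hh Hh2 Hh' Hh'2 hh' F1.
have [_ mix] := cf_s hc n0.
have := mix N h h' hN Hh Hh2 Hh' Hh'2 hh'; rewrite /norm1 => mx.
pose u t := (s n (h.1 + t%:Z, h.2), s n (h'.1 + t%:Z, h'.2)).
have uD t : (t < N)%N -> u t \in (D n `*` D n)%fset.
  move=> tN; rewrite inE; apply/andP; split; apply: s_in_D => //.
    by case: Hh Hh2 => /= ? ? [/= ? ?]; split => /=; lia.
  by case: Hh' Hh'2 => /= ? ? [/= ? ?]; split => /=; lia.
rewrite -(@dist_sum _ _ _ u (fun p => F p.1 p.2) uD).
have -> : \sum_(x <- D n) \sum_(y <- D n) kappa R (D n) x * kappa R (D n) y * F x y =
   \sum_(p <- (D n `*` D n)%fset) kappa R (D n) p.1 * kappa R (D n) p.2 * F p.1 p.2.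
  rewrite -(big_allpairs (F := fun p : G * G =>
    kappa R (D n) p.1 * kappa R (D n) p.2 * F p.1 p.2)).
  apply: perm_big; apply: uniq_perm.
  - by apply: allpairs_uniq; rewrite ?fset_uniq// => -[a b] [c d] _ _ /= [-> ->].
  - exact: fset_uniq.
  - move=> [a b]; rewrite in_fsetM /=; apply/allpairsP/andP => /=.
      by move=> [[a' b'] /= [? ? [-> ->]]].
    by move=> [? ?]; exists (a, b).
rewrite -sumrB (le_trans (ler_norm_sum _ _ _))// ltW//.
apply: le_lt_trans mx; apply: ler_sum => p _.
by rewrite -mulrBl normrM ler_piMr.
Qed.

Lemma mixing_avg1 n N h (F : G -> R) : (0 < n)%N ->
  (r n)%:R / (n ^ 2)%N%:R < N%:R :> R ->
  Hset r n h -> Hset r n (h.1 + (N%:Z - 1), h.2) ->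
  (forall x, `|F x| <= 1) ->
  `|(\sum_(0 <= t < N) F (s n (h.1 + t%:Z, h.2))) / N%:R
    - \sum_(x <- D n) kappa R (D n) x * F x| <= n%:R^-1.
Proof.
move=> n0 hN Hh Hh2 F1.
(* The mixing condition speaks of pairs, so a second row is supplied; the rows 0 and 1 both exist
   since [r n >= 1]. *)
pose h' := (h.1, if h.2 == 0 then 1 else 0 : int).
have r0 := cf_r_gt0 hc n.
have e : (`|h'.2| <= r n)%N by rewrite /h' /=; case: eqP.
have Hh' : Hset r n h' by split => //; case: Hh.
have Hh'2 : Hset r n (h'.1 + (N%:Z - 1), h'.2) by split => //; case: Hh2.
have hh' : h <> h'.
  by move=> /(congr1 snd)/=; case: eqP => [->|].
have := mixing_avg n0 hN Hh Hh2 Hh' Hh'2 hh' (fun x _ => F1 x).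
rewrite [X in _ - X](eq_bigr (fun x => kappa R (D n) x * F x))// => x _.
by rewrite -mulr_suml -mulr_sumr sum_kappa// mulr1.
Qed.

(** Each full row of [H_n] is itself a window long enough for the mixing condition, and the two
    halves of [D_n] have mass 1/2 each. *)
Lemma count_parity n (e : bool) : (0 < n)%N ->
  \sum_(h <- Hseq n) ((s n h).2 == e)%:R <= ((2 * r n).+1 ^ 2)%N%:R * (2^-1 + n%:R^-1) :> R.
Proof.
move=> n0; rewrite /Hseq big_allpairs_dep/=.
have row y : y \in zrange n -> \sum_(x <- zrange n) ((s n (x, y)).2 == e)%:R <=
    (2 * r n).+1%:R * (2^-1 + n%:R^-1) :> R.
  rewrite mem_zrange => hy; rewrite /zrange big_map.
  pose h : int * int := (- (r n)%:Z, y).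
  have r0 := cf_r_gt0 hc n.
  have Hh : Hset r n h by split => /=; lia.
  have Hh2 : Hset r n (h.1 + ((2 * r n).+1%:Z - 1), h.2) by split => //=; lia.
  have hN : (r n)%:R / (n ^ 2)%N%:R < (2 * r n).+1%:R :> R.
    rewrite ltr_pdivrMr ?ltr0n ?expn_gt0 ?n0// -natrM ltr_nat.
    by rewrite (@leq_trans (2 * r n).+1)// ?leq_pmulr ?expn_gt0 ?n0//; lia.
  have F1 (x : G) : `|(x.2 == e)%:R| <= 1 :> R by case: eqP; rewrite ?normr1 ?normr0.
  have := mixing_avg1 n0 hN Hh Hh2 F1; rewrite kappa_parity// /index_iota subn0.
  rewrite (_ : \sum_(t <- _) _ = \sum_(k <- iota 0 (2 * r n).+1)
     ((s n (k%:Z - (r n)%:Z, y)).2 == e)%:R); last first.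
    by apply: eq_bigr => k _; rewrite addrC.
  move=> /ler_normlP[_ h1]; rewrite [leRHS]mulrC -ler_pdivrMr//.
  by move: h1; move: (_ / _) => q; lra.
apply: (@le_trans _ _ (\sum_(y <- zrange n) ((2 * r n).+1%:R * (2^-1 + n%:R^-1)))).
  rewrite big_seq_cond [leRHS]big_seq_cond; apply: ler_sum => y /andP[hy _].
  exact: row.
rewrite big_const_seq count_predT size_zrange iter_addr addr0 -[leLHS]mulr_natl.
by rewrite mulrA -natrM mulnn.
Qed.

End Choices.

Section Volume.
Variable R : realType.
Local Notation G := (zrz2 R).
Implicit Types (A B K : set G).

Lemma counting_seq (T : choiceType) (t : seq T) : uniq t ->
  counting [set x | x \in t] = (size t)%:R%:E :> \bar R.
Proof.
move=> ut; have -> : [set x | x \in t] = [set` [fset x in t]%fset].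
  by apply/seteqP; split => x /=; rewrite !inE.
by rewrite /counting asboolT ?set_fsetK ?card_fseq ?undup_id//; exact: finite_fset.
Qed.

Lemma counting_itv (p : int) (k : nat) :
  counting [set x : int | p < x <= p + k%:Z] = k%:R%:E :> \bar R.
Proof.
pose t := [seq p + 1 + j%:Z | j <- iota 0 k].
have -> : [set x : int | p < x <= p + k%:Z] = [set x | x \in t].
  apply/seteqP; split => x /=.
    move=> h; apply/mapP; exists (absz (x - p - 1)%R); first by rewrite mem_iota; lia.
    lia.
  by move=> /mapP[j]; rewrite mem_iota => hj ->; lia.
rewrite counting_seq ?size_map ?size_iota//.
by rewrite map_inj_uniq ?iota_uniq// => x y; lia.
Qed.

Definition slab (p : int) (k : nat) (y z : R) : set G :=
  [set g : G | p < g.1.1 <= p + k%:Z /\ y < g.1.2 <= z].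

Lemma slabE p k y z : slab p k y z =
  ([set x : int | p < x <= p + k%:Z] `*` `]y, z]%classic) `*` setT.
Proof.
apply/seteqP; split => -[[x a] n] /=; rewrite /slab /= in_itv/=.
  by move=> [? ?].
by move=> [[? ?] _].
Qed.

Lemma measurable_slab p k y z : measurable (slab p k y z).
Proof.
by rewrite slabE; apply: measurableX => //; apply: measurableX => //; exact: measurable_itv.
Qed.

Lemma haar_slab p k y z : y <= z -> haar (slab p k y z) = (k%:R * (z - y) * 2)%:E.
Proof.
move=> yz; rewrite slabE haarX; last first.
  by apply: measurableX => //; exact: measurable_itv.
rewrite haar_ZRX; last exact: measurable_itv.
rewrite [X in (X * _ * _)%E]counting_itv lebesgue_measure_itv/= lte_fin.
have -> : counting_bool R [set: bool] = 2%:E.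
  have -> : [set: bool] = [set x | x \in [:: true; false]].
    by apply/seteqP; split => -[].
  exact: counting_seq.
move: yz; rewrite le_eqVlt => /predU1P[->|yz]; last by rewrite yz -EFinB -!EFinM.
by rewrite ltxx subrr mulr0 mul0r mule0 mul0e.
Qed.

Lemma box_slab (a : nat) : box a = slab (- a%:Z) (2 * a) (- a%:R) a%:R.
Proof.
apply/seteqP; split => g; rewrite /box /slab /= => -[h1 h2]; split => //.
  by clear h2; lia.
by clear h2; lia.
Qed.

Lemma measurable_box (a : nat) : measurable (box a : set G).
Proof. by rewrite box_slab; exact: measurable_slab. Qed.

Definition vol A : R := fine (haar A).

Lemma vol_ge0 A : 0 <= vol A.
Proof. by rewrite fine_ge0. Qed.

Lemma vol_box (a : nat) : vol (box a) = 8 * a%:R ^+ 2.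
Proof.
rewrite /vol box_slab haar_slab/=; first by rewrite natrM; ring.
by rewrite (@le_trans _ _ 0)// oppr_le0.
Qed.

Lemma haar_box_fin (a : nat) : (haar (box a : set G) < +oo)%E.
Proof.
rewrite box_slab haar_slab ?ltry//.
by rewrite (@le_trans _ _ 0)// oppr_le0.
Qed.

Lemma haar_vol A (a : nat) : measurable A -> A `<=` box a -> haar A = (vol A)%:E.
Proof.
move=> mA Aa; rewrite /vol fineK// ge0_fin_numE//.
apply: le_lt_trans (haar_box_fin a); apply: le_measure; rewrite ?inE//.
exact: measurable_box.
Qed.

Lemma vol_le A B (a : nat) : measurable A -> measurable B -> A `<=` B ->
  B `<=` box a -> vol A <= vol B.
Proof.
move=> mA mB AB Ba; rewrite -lee_fin -(haar_vol mB Ba) -(haar_vol mA (subset_trans AB Ba)).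
by apply: le_measure; rewrite ?inE.
Qed.

Lemma vol_rtrans A c : measurable A -> vol (rtrans A c) = vol A.
Proof. by move=> mA; rewrite /vol haar_rtrans. Qed.

Lemma overlap_Rintegral_le (S K1 K2 : set G) (v k e F : R) : 0 < F ->
  measurable S -> measurable K1 -> measurable K2 ->
  haar S = v%:E -> haar K1 = k%:E ->
  (forall w, (haar (S `&` [set y | K2 (w * y^-1)%g]) <= e%:E)%E) ->
  \int[(@haar R \x @haar R)%E]_(p in S `*` S)
     (vol (rtrans K1 p.1 `&` rtrans K2 p.2) / F) <= F^-1 * (e * k * v).
Proof.
move=> F0 mS mK1 mK2 hS hK He.
have volE x y : (vol (rtrans K1 x `&` rtrans K2 y) / F)%:E =
    ((F^-1)%:E * haar (rtrans K1 x `&` rtrans K2 y))%E.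
  rewrite mulrC EFinM fineK// ge0_fin_numE//.
  apply: (@le_lt_trans _ _ (haar (rtrans K1 x))); last by rewrite haar_rtrans// hK ltry.
  by apply: le_measure; rewrite ?inE//; [apply: measurableI; exact: measurable_rtrans|exact: measurable_rtrans].
have F0' : (0 <= (F^-1)%:E)%E by rewrite lee_fin invr_ge0 ltW.
have h := overlap_integral_le mS mK1 mK2 hS hK He.
rewrite /Rintegral; under eq_integral do rewrite volE.
rewrite ge0_integralZl//; last 2 first.
- exact: measurableX.
- by apply: measurable_funTS; exact: measurable_overlap.
move: h; set I := integral _ _ _ => h.
have I0 : (0 <= I)%E by exact: integral_ge0.
have -> : I = (fine I)%:E by rewrite fineK// ge0_fin_numE// (le_lt_trans h)// ltry.
rewrite -EFinM/= ler_pM2l ?invr_gt0// -lee_fin fineK//.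
by rewrite ge0_fin_numE// (le_lt_trans h)// ltry.
Qed.

End Volume.

Section Sample.
Variables (R : realType) (r : nat -> nat) (xi : nat -> set (set (zrz2 R))).
Variables (D : nat -> {fset zrz2 R}) (s : nat -> int * int -> zrz2 R).
Hypothesis hc : cf_choices r xi D s.
Local Notation G := (zrz2 R).
Local Notation at_ := (atilde r).
Local Notation vol := (@vol R).
Implicit Types (f g w : G) (n : nat) (h : int * int) (A B K : set G).

(** The sampling condition tests only unions of atoms; this is the smallest one containing the part
    of [K] in [F_n]. *)
Definition hull n K : set G := \bigcup_(B in [set B | xi n B /\ B `&` K !=set0]) B.

Lemma hull_union n K : union_of_atoms (xi n) (hull n K).
Proof. by exists [set B | xi n B /\ B `&` K !=set0] => // B []. Qed.

Lemma measurable_hull n K : (0 < n)%N -> measurable (hull n K).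
Proof.
move=> n0; have [[fin _ mB] _ _ _] := cf_xi hc n0.
apply: fin_bigcup_measurable; last by move=> B [xB _]; exact: mB.
by apply: (sub_finite_set _ fin) => B [].
Qed.

Lemma sub_hull n K : (0 < n)%N -> K `<=` Fset r n -> K `<=` hull n K.
Proof.
move=> n0 KF x Kx; have [[_ [cov _ _] _] _ _ _] := cf_xi hc n0.
have : Fset r n x by exact: KF.
by rewrite -cov => -[B xB Bx]; exists B => //; split => //; exists x.
Qed.

(** Atoms have diameter less than [1 / n <= 1], so both discrete coordinates are constant on
    them. *)
Lemma hullP n K x : (0 < n)%N -> hull n K x ->
  exists y, [/\ K y, x.1.1 = y.1.1, x.2 = y.2 & `|x.1.2 - y.1.2| < n%:R^-1].
Proof.
move=> n0 [B [xB [y [By Ky]]] Bx]; exists y.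
have [_ diam _ _] := cf_xi hc n0.
have : ((zrz2_dist x y)%:E < (n%:R^-1)%:E)%E.
  by apply: le_lt_trans (diam _ xB); apply: ereal_sup_ubound; exists x => //; exists y.
rewrite lte_fin /zrz2_dist !gt_max => /andP[/andP[h1 h2] h3].
have n1 : n%:R^-1 <= 1 :> R by rewrite invf_le1 ?ler1n// ltr0n.
split => //.
  have := lt_le_trans h1 n1; rewrite -[1]/(1%:~R) ltr_int; lia.
by apply/eqP; move: h3; case: eqP => // _; rewrite ltNge n1.
Qed.

Lemma bsize_ge n : (1 < n)%N -> (2 < bsize r n)%N.
Proof.
case: n => [|[|n]]// _; rewrite bsizeS.
by rewrite (@leq_trans (2 * n.+1 + 1))// ?leq_pmulr ?atilde_gt0//; lia.
Qed.

Lemma hull_box n K (a : nat) : (0 < n)%N -> K `<=` box a -> hull n K `<=` box a.+1.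
Proof.
move=> n0 Ka x /(hullP n0)[y [/Ka[/= hy1 /andP[hy2 hy3]] h1 _ h2]].
have n1 : n%:R^-1 <= 1 :> R by rewrite invf_le1 ?ler1n// ltr0n.
split => /=; first lia.
have := lt_le_trans h2 n1; rewrite ltr_norml -natr1 => /andP[h3 h4].
by apply/andP; split; lra.
Qed.

Lemma Sset_gt0 n : (0 < n)%N -> 0 < vol (Sset r n).
Proof.
move=> n0; rewrite vol_box mulr_gt0// exprn_gt0// ltr0n.
by case: n n0 => // n _; rewrite bsizeS muln_gt0 atilde_gt0 addn1.
Qed.

Lemma Fset_gt0 n : (0 < n)%N -> 0 < vol (Fset r n).
Proof.
move=> n0; rewrite vol_box mulr_gt0// exprn_gt0// ltr0n.
by case: n n0 => // n _; rewrite asizeS muln_gt0 atilde_gt0 addn1.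
Qed.

(** The sampling condition for the hulls replaces the average over [D_n] by the integral over [S_n],
    which [overlap_integral_le] bounds. The margin [2 * bsize r n] keeps the hulls, which may stick
    out by 1, and their translates by [S_n] inside [F_n]. *)
Lemma sample_le n K1 K2 (e : R) : (1 < n)%N -> (2 * bsize r n <= asize r n)%N ->
  measurable K1 -> measurable K2 ->
  K1 `<=` box (asize r n - 2 * bsize r n) ->
  K2 `<=` box (asize r n - 2 * bsize r n) ->
  (forall w, (haar (Sset r n `&` [set y | hull n K2 (w * y^-1)%g]) <= e%:E)%E) ->
  \sum_(x <- D n) \sum_(y <- D n) kappa R (D n) x * kappa R (D n) y *
     vol (rtrans K1 x `&` rtrans K2 y)
  <= e * vol (hull n K1) / vol (Sset r n) + vol (Fset r n) / n%:R.
Proof.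
move=> n1 ba mK1 mK2 K1a K2a He; have n0 : (0 < n)%N by exact: ltnW.
have b2 := bsize_ge n1.
have [_ _ samp] := cf_D hc n0.
have F1 := Fset1 R r n0.
have HF K : K `<=` box (asize r n - 2 * bsize r n) ->
    mulset (rtrans (hull n K) 1%g) (Sset r n) `<=` Fset r n.
  move=> Ka; rewrite rtrans1 => _ [x /(hull_box n0 Ka) hx [y Sy <-]].
  apply: (@box_mul _ _ _ _ _ _ _ hx Sy); lia.
have mh K : measurable (hull n K) by exact: measurable_hull.
have mS : measurable (Sset r n : set G) by exact: measurable_box.
have hb K : K `<=` box (asize r n - 2 * bsize r n) -> hull n K `<=` Fset r n.
  move=> Ka; apply: subset_trans (hull_box n0 Ka) _; apply: box_sub; lia.
have e0 : 0 <= e by rewrite -lee_fin (le_trans _ (He 1%g)).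
have volI x y : vol (rtrans K1 x `&` rtrans K2 y) <=
    vol (rtrans (hull n K1) x `&` rtrans (hull n K2) y).
  apply: fine_le.
  - rewrite ge0_fin_numE//; apply: (@le_lt_trans _ _ (haar (rtrans K1 x))).
      by apply: le_measure; rewrite ?inE//; [apply: measurableI; exact: measurable_rtrans|exact: measurable_rtrans].
    by rewrite haar_rtrans// (haar_vol mK1 K1a) ltry.
  - rewrite ge0_fin_numE//; apply: (@le_lt_trans _ _ (haar (rtrans (hull n K1) x))).
      by apply: le_measure; rewrite ?inE//; [apply: measurableI; exact: measurable_rtrans|exact: measurable_rtrans].
    by rewrite haar_rtrans// (haar_vol (mh _) (hb _ K1a)) ltry.
  have sub K : K `<=` box (asize r n - 2 * bsize r n) -> K `<=` hull n K.
    move=> Ka; apply: sub_hull => //; apply: subset_trans Ka _; apply: box_sub; lia.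
  apply: le_measure; rewrite ?inE.
  - by apply: measurableI; exact: measurable_rtrans.
  - by apply: measurableI; exact: measurable_rtrans.
  - by move=> g [/rtransP h1 /rtransP h2]; split; apply/rtransP; apply: sub.
have Hs := samp (hull n K1) (hull n K2) 1%g 1%g (hull_union n K1) (hull_union n K2) F1 F1
  (HF _ K1a) (HF _ K2a).
have hV := haar_vol mS (@subset_refl _ _).
have V0 := Sset_gt0 n0; have F0 := Fset_gt0 n0.
move: Hs hV V0 F0; rewrite !rtrans1 /= /overlap -/(vol (Sset r n)) -/(vol (Fset r n)).
move: (vol (Sset r n)) (vol (Fset r n)) => V F Hs hV V0 F0.
have hI := overlap_Rintegral_le F0 mS (mh K1) (mh K2) hV (haar_vol (mh _) (hb _ K1a)) He.
move: Hs hI; set I := Rintegral _ _ _ => /ltr_normlP[_].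
move: I (vol (hull n K1)) => I k Hs hI.
have -> : e * k / V + F / n%:R = F * ((V ^+ 2)^-1 * (F^-1 * (e * k * V)) + n%:R^-1).
  have N0 : n%:R != 0 :> R by rewrite pnatr_eq0 -lt0n.
  by move: (n%:R : R) N0 => N N0; field; rewrite N0 !gt_eqF.
apply: le_trans (_ : F * ((V ^+ 2)^-1 * I + n%:R^-1) <= _); last first.
  by rewrite ler_pM2l// lerD2r ler_wpM2l// invr_ge0 sqr_ge0.
move: Hs; set SS := \sum_(x <- D n) _ => Hs.
apply: le_trans (_ : F * SS <= _); last first.
  by rewrite ler_pM2l//; move: Hs; move: (_ * I) => q; lra.
rewrite /SS mulr_sumr; apply: ler_sum => x _; rewrite mulr_sumr; apply: ler_sum => y _.
apply: le_trans (_ : kappa R (D n) x * kappa R (D n) y *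
    vol (rtrans (hull n K1) x `&` rtrans (hull n K2) y) <= _).
  by apply: ler_wpM2l (volI x y); rewrite mulr_ge0// kappa_ge0.
rewrite -/(vol (rtrans (hull n K1) x `&` rtrans (hull n K2) y)).
move: (vol _) (_ * kappa _ _ _) => q p.
by rewrite mulrA [F * _]mulrC divfK ?gt_eqF// mulrC.
Qed.

End Sample.

(** * Dispersion of the samples *)

Section FiniteUnions.
Context {d : measure_display} {T : measurableType d} {R : realType}.
Variable m : {measure set T -> \bar R}.

Lemma sum_measure_disjoint (I : eqType) (t : seq I) (F : I -> set T) (B : set T) :
  uniq t -> measurable B -> (forall i, i \in t -> measurable (F i)) ->
  (forall i, i \in t -> F i `<=` B) ->
  (forall i j x, i \in t -> j \in t -> F i x -> F j x -> i = j) ->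
  (\sum_(i <- t) m (F i) <= m B)%E.
Proof.
elim: t B => [|i t IH] B; first by rewrite big_nil.
move=> /= /andP[it ut] mB mF FB disj; rewrite big_cons.
have mFi : measurable (F i) by apply: mF; exact: mem_head.
rewrite -(setDUK (FB i (mem_head _ _))) measureU//; last 2 first.
- exact: measurableD.
- by rewrite setDIK.
apply: leeD => //; apply: IH => //.
- exact: measurableD.
- by move=> j jt; apply: mF; rewrite inE jt orbT.
- move=> j jt x Fx; split; first by apply: FB Fx; rewrite inE jt orbT.
  move=> Fix; have ij : i = j by apply: disj Fix Fx; rewrite inE ?eqxx ?jt ?orbT.
  by rewrite -ij (negbTE it) in jt.
- by move=> j k x jt kt; apply: disj; rewrite inE ?jt ?kt orbT.
Qed.

Lemma measure_le_sum (I : eqType) (t : seq I) (F : I -> set T) (B : set T) :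
  measurable B -> (forall i, i \in t -> measurable (F i)) ->
  (forall x, B x -> exists2 i, i \in t & F i x) ->
  (m B <= \sum_(i <- t) m (F i))%E.
Proof.
elim: t B => [|i t IH] B mB mF cov.
  rewrite (_ : B = set0); last by apply/seteqP; split => // x /cov[].
  by rewrite measure0 big_nil.
have mFi : measurable (F i) by apply: mF; exact: mem_head.
rewrite big_cons (@le_trans _ _ (m (F i `|` (B `\` F i))))//.
  apply: le_measure; rewrite ?inE//.
    by apply: measurableU => //; exact: measurableD.
  by move=> x Bx; have [?|?] := pselect (F i x); [left|right].
apply: le_trans (measureU2 _ mFi (measurableD mB mFi)) _; apply: leeD => //.
apply: IH; first exact: measurableD.
  by move=> j jt; apply: mF; rewrite inE jt orbT.
move=> x [Bx nFx]; have [j] := cov _ Bx.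
rewrite inE => /predU1P[->|jt] Fj //; by exists j.
Qed.

End FiniteUnions.

Section Spread.
Variables (R : realType) (r : nat -> nat) (xi : nat -> set (set (zrz2 R))).
Variables (D : nat -> {fset zrz2 R}) (s : nat -> int * int -> zrz2 R).
Hypothesis hc : cf_choices r xi D s.
Local Notation G := (zrz2 R).
Local Notation at_ := (atilde r).
Local Notation vol := (@vol R).
Implicit Types (f g w : G) (n : nat) (h : int * int) (A B K : set G).

Lemma measurable_first (P : int -> Prop) : measurable [set g : G | P g.1.1].
Proof.
apply: measurable_zrz2P => x n; rewrite /fiber /=.
have [Px|nPx] := pselect (P x).
  by rewrite (_ : mkset _ = setT)//; apply/seteqP; split.
by rewrite (_ : mkset _ = set0)//; apply/seteqP; split.
Qed.

Definition periodic (p lo hi u : int) : Prop := exists q : int, lo <= u - p * q < hi.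

Lemma vol_shift (t : int) A : measurable A ->
  measurable [set g | A (shift R t * g)%g] /\ haar [set g | A (shift R t * g)%g] = haar A.
Proof.
move=> mA; split; last exact: haar_mull.
exact: (measurable_preimageT (measurable_mull _) mA).
Qed.

(** The stripes have width [8 * a] and period [8 * a * l], so their [l] translates by multiples of
    [8 * a] are pairwise disjoint, and they stay in a slab longer by one period. *)
Lemma periodic_le (P : set G) (a l k : nat) (p c : int) (y : R) : (0 < a)%N -> (0 < l)%N ->
  0 <= y -> measurable P ->
  P `<=` slab p k (- y) y ->
  (forall g, P g -> periodic (8 * a * l)%N%:Z 0 (8 * a)%N%:Z (g.1.1 - c)) ->
  l%:R * vol P <= (k + 8 * a * l)%N%:R * (4 * y).
Proof.
move=> a0 l0 y0 mP Psub Pper.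
pose F (i : nat) := [set g | P (shift R (- (8 * a * i)%N%:Z) * g)%g].
have hF i := vol_shift (- (8 * a * i)%N%:Z) mP.
have yy : - y <= y by lra.
have : (\sum_(i <- iota 0 l) haar (F i) <= haar (slab p (k + 8 * a * l) (- y) y : set G))%E.
  apply: sum_measure_disjoint; first exact: iota_uniq.
  - exact: measurable_slab.
  - by move=> i _; exact: (hF i).1.
  - move=> i; rewrite mem_iota => /= hi g Fg.
    have := Psub _ Fg; rewrite /slab shiftE /= => -[h1 h2]; split => //; nia.
  - move=> i j g; rewrite !mem_iota /= => hi hj Fi Fj.
    have [q hq] := Pper _ Fi; have [q' hq'] := Pper _ Fj.
    move: hq hq'; rewrite !shiftE /= => hq hq'.
    have h : 8 * a%:Z * ((i%:Z - j%:Z) + l%:Z * (q - q')) = 0 :> int.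
      have : - (8 * a%:Z) < 8 * a%:Z * ((i%:Z - j%:Z) + l%:Z * (q - q')) < 8 * a%:Z by lia.
      move: ((i%:Z - j%:Z) + l%:Z * (q - q')) => z hz.
      have [z1|[->|z1]] : z <= - 1 \/ z = 0 \/ 1 <= z by lia.
      - nia.
      - by rewrite mulr0.
      - nia.
    have {}h : (i%:Z - j%:Z) + l%:Z * (q - q') = 0 by nia.
    have [z1|[z1|z1]] : q - q' <= - 1 \/ q - q' = 0 \/ 1 <= q - q' by lia.
    - nia.
    - by move: h; rewrite z1 mulr0; lia.
    - nia.
rewrite haar_slab//.
have hP : haar P = (vol P)%:E.
  rewrite /vol fineK// ge0_fin_numE//.
  apply: (@le_lt_trans _ _ (haar (slab p k (- y) y : set G))).
    by apply: le_measure; rewrite ?inE//; exact: measurable_slab.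
  by rewrite haar_slab// ltry.
rewrite (eq_bigr (fun=> (vol P)%:E)); last by move=> i _; rewrite -hP (hF i).2.
rewrite sumEFin lee_fin big_const_seq count_predT size_iota iter_addr_0 -(mulr_natl (vol P)).
move=> h; apply: le_trans h _.
by rewrite le_eqVlt; apply/orP; left; apply/eqP; ring.
Qed.

(** These stripes have width [4 * a], so [2 * l] translates by multiples of [4 * a] cover the box up
    to one period. *)
Lemma periodic_ge (A a l : nat) (c : int) : (0 < a)%N -> (0 < l)%N -> (8 * a * l <= 2 * A)%N ->
  (2 * A - 8 * a * l)%N%:R * (4 * A%:R) <=
  (2 * l)%N%:R * vol (box A `&` [set g | periodic (8 * a * l)%N%:Z (2 * a)%N%:Z (6 * a)%N%:Z (g.1.1 - c)]).
Proof.
move=> a0 l0 hA; set P := (_ `&` _).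
have mP : measurable P.
  apply: measurableI; first exact: measurable_box.
  exact: (measurable_first (fun u => periodic _ _ _ (u - c))).
pose F (i : nat) := [set g | P (shift R (- (4 * a * i)%N%:Z) * g)%g].
have hF i := vol_shift (- (4 * a * i)%N%:Z) mP.
have A0 : 0 <= A%:R :> R by [].
have : (haar (slab (- A%:Z + (8 * a * l)%N%:Z) (2 * A - 8 * a * l) (- A%:R) A%:R : set G) <=
    \sum_(i <- iota 0 (2 * l)) haar (F i))%E.
  apply: measure_le_sum; first exact: measurable_slab.
  - by move=> i _; exact: (hF i).1.
  move=> g [/= h1 h2].
  pose x := ((g.1.1 - c - (2 * a)%N%:Z) %% (8 * a * l)%N%:Z)%Z.
  pose q := ((g.1.1 - c - (2 * a)%N%:Z) %/ (8 * a * l)%N%:Z)%Z.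
  have hx : g.1.1 - c - (2 * a)%N%:Z = q * (8 * a * l)%N%:Z + x by exact: divz_eq.
  have p0 : (0 < 8 * a * l)%N by rewrite !muln_gt0 a0 l0.
  have x0 : 0 <= x by apply: modz_ge0; lia.
  have x1 : x < (8 * a * l)%N%:Z by apply: ltz_pmod; lia.
  pose i := (absz x %/ (4 * a))%N.
  have hi := divn_eq (absz x) (4 * a); have hi2 : (absz x %% (4 * a) < 4 * a)%N by rewrite ltn_mod muln_gt0 a0.
  have il : (i < 2 * l)%N.
    rewrite /i ltn_divLR ?muln_gt0 ?a0//; nia.
  exists i; first by rewrite mem_iota.
  split; rewrite shiftE /=.
    by split => //=; nia.
  exists q; move: hi; rewrite -/i; nia.
rewrite haar_slab; last by rewrite (@le_trans _ _ 0)// oppr_le0.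
have hP : haar P = (vol P)%:E by apply: (@haar_vol _ P A) => // g [].
rewrite (eq_bigr (fun=> (vol P)%:E)); last by move=> i _; rewrite -hP (hF i).2.
rewrite sumEFin lee_fin big_const_seq count_predT size_iota iter_addr_0 -(mulr_natl (vol P)).
move=> h; apply: le_trans h.
by rewrite le_eqVlt; apply/orP; left; apply/eqP; ring.
Qed.


(** The average overlap of stripes, of order [A ^ 2 / l ^ 2] up to the sampling error [A ^ 2 / N],
    is divided by the overlap that closeness enforces, of order [A ^ 2 / l]. The hypothesis
    [l * l <= N] absorbs the error into the main term. *)
Lemma spread_bound (A A1 b p l N H PP : R) : 0 < A -> 0 < b -> 0 < l -> 0 < N -> 0 <= p ->
  p <= 8 * b -> 4 * p <= A -> 3 / 4 * A <= A1 -> l * l <= N ->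
  0 <= H -> H <= (2 * A + p) * (4 * A) / l ->
  PP * ((2 * A1 - p) * (4 * A1) / (2 * l)) <=
    (2 * b + p) * (4 * b) / l * H / (8 * b ^+ 2) + 8 * A ^+ 2 / N ->
  PP <= 60 / l.
Proof.
move=> A0 b0 l0 N0 p0 pb pA AA1 lN H0 HA hPP.
have [PP0|PP0] := ltrP PP 0; first by rewrite (le_trans (ltW PP0))// divr_ge0// ltW.
have e1 : (2 * b + p) * (4 * b) / l / (8 * b ^+ 2) <= 5 / l.
  rewrite [leLHS](_ : _ = (2 * b + p) / (2 * b) / l); last by field; rewrite !gt_eqF.
  by rewrite ler_pM2r ?invr_gt0// ler_pdivrMr ?mulr_gt0//; lra.
have e2 : H <= 9 * A ^+ 2 / l.
  by apply: le_trans HA _; rewrite ler_pM2r ?invr_gt0//; nra.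
have e3 : 15 / 8 * A ^+ 2 / l <= (2 * A1 - p) * (4 * A1) / (2 * l).
  rewrite [leRHS](_ : _ = (2 * A1 - p) * (2 * A1) / l); last by field; rewrite !gt_eqF.
  rewrite ler_pM2r ?invr_gt0//; nra.
have e4 : (2 * b + p) * (4 * b) / l * H / (8 * b ^+ 2) <= 45 * A ^+ 2 / l ^+ 2.
  rewrite mulrAC; apply: le_trans (_ : (5 / l) * (9 * A ^+ 2 / l) <= _).
    apply: ler_pM => //; rewrite !mulr_ge0// ?invr_ge0 ?mulr_ge0 ?sqr_ge0// ?(ltW b0) ?(ltW l0)//.
    by rewrite addr_ge0// mulr_ge0// ltW.
  by rewrite le_eqVlt; apply/orP; left; apply/eqP; field; rewrite gt_eqF.
have e5 : 8 * A ^+ 2 / N <= 8 * A ^+ 2 / l ^+ 2.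
  apply: ler_wpM2l; first by rewrite mulr_ge0 ?sqr_ge0.
  by rewrite lef_pV2 ?posrE ?exprn_gt0.
have : PP * (15 / 8 * A ^+ 2 / l) <= 53 * A ^+ 2 / l ^+ 2.
  apply: le_trans (ler_wpM2l PP0 e3) _; apply: le_trans hPP _.
  apply: le_trans (lerD e4 e5) _.
  by rewrite le_eqVlt; apply/orP; left; apply/eqP; field; rewrite gt_eqF.
rewrite [leRHS](_ : _ = (53 / l) * (A ^+ 2 / l)); last by field; rewrite gt_eqF.
rewrite [leLHS](_ : _ = (15 / 8 * PP) * (A ^+ 2 / l)); last by field; rewrite gt_eqF.
rewrite ler_pM2r ?divr_gt0 ?exprn_gt0// => h.
rewrite ler_pdivlMr//; move: h; rewrite ler_pdivlMr//; lra.
Qed.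

(** Samples that bring two points close force the translates of stripes of density [1 / l] to
    overlap with density of order [1 / l], while the average overlap has density of order
    [1 / l ^ 2 + 1 / n] by the sampling condition. Markov's inequality compares the two. *)
Lemma spread n (l : nat) (c : int) : (1 < n)%N -> (16 * n <= r n.-1)%N ->
  (0 < l)%N -> (l * l <= n)%N ->
  \sum_(x <- D n) \sum_(y <- D n) kappa R (D n) x * kappa R (D n) y *
    (`|c - x.1.1 + y.1.1| < (2 * at_ n.-1)%N%:Z)%R%:R
  <= 60 / l%:R :> R.
Proof.
case: n => // n n1 hr l0 lln; rewrite [n.+1.-1]/= in hr *.
have a0 : (0 < at_ n)%N by exact: atilde_gt0.
have bE : bsize r n.+1 = ((2 * n + 1) * at_ n)%N by exact: bsizeS.
have AE : asize r n.+1 = ((2 * r n + 1) * at_ n)%N by exact: asizeS.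
have SE : Sset r n.+1 = box (bsize r n.+1) :> set G by [].
have FE : Fset r n.+1 = box (asize r n.+1) :> set G by [].
have b3 : (2 < bsize r n.+1)%N by exact: bsize_ge.
have := @sample_le _ _ _ _ _ hc n.+1; rewrite SE FE.
have SD x : x \in D n.+1 -> (box (bsize r n.+1) : set G) x by move/(D_Sset hc (ltn0Sn n)).
move: (at_ n) (bsize r n.+1) (asize r n.+1) a0 bE AE b3 SD => a b A a0 bE AE b3 SD samp {SE FE}.
have ln : (l <= n.+1)%N by nia.
have bA : (16 * b <= A)%N by nia.
have [p pE] : {p | p = (8 * a * l)%N} by exists (8 * a * l)%N.
have pA : (4 * p <= A)%N by nia.
have p8 : (p <= 8 * b)%N by nia.
have [A0 A0E] : {A0 | A0 = (A - 2 * b)%N} by exists (A - 2 * b)%N.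
have [A1 A1E] : {A1 | A1 = (A - 3 * b - 2)%N} by exists (A - 3 * b - 2)%N.
rewrite -A0E in samp.
(* The test stripes have width [8 * a]. The stripes [Q] of width [4 * a] leave room [2 * a] on both
   sides, which absorbs a displacement of less than [2 * a]. *)
pose K e : set G := box A0 `&` [set g | periodic p 0 (8 * a)%N%:Z (g.1.1 - e)].
have mK e : measurable (K e).
  apply: measurableI; first exact: measurable_box.
  exact: (measurable_first (fun u => periodic _ _ _ (u - e))).
have hK e g : hull xi n.+1 (K e) g ->
    (box A : set G) g /\ periodic p 0 (8 * a)%N%:Z (g.1.1 - e).
  move=> hg; split.
    have KA0 : K e `<=` box A0 by move=> z [].
    have := hull_box hc (ltn0Sn n) KA0 hg.
    by apply: box_sub; lia.
  by have [z [[_ h1] -> _ _]] := hullP hc (ltn0Sn n) hg.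
have mh e : measurable (hull xi n.+1 (K e)) by exact: (measurable_hull hc).
pose e1 : R := (2 * b + p)%N%:R * (4 * b%:R) / l%:R.
have l0R : 0 < l%:R :> R by rewrite ltr0n.
have He w : (haar (box b `&` [set y | hull xi n.+1 (K c) (w * y^-1)%g]) <= e1%:E)%E.
  pose P : set G := box b `&` [set y | periodic p 0 (8 * a)%N%:Z ((w * y^-1)%g.1.1 - c)].
  have mP : measurable P.
    apply: measurableI; first exact: measurable_box.
    exact: (measurable_first (fun u => periodic _ _ _ (w.1.1 - u - c))).
  apply: (@le_trans _ _ (haar P)).
    apply: le_measure; rewrite ?inE//.
      apply: measurableI; first exact: measurable_box.
      have mW : measurable_fun setT (fun y : G => (w * y^-1)%g).
        by rewrite mulV_fiberwise; exact: measurable_fiberwise_affine.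
      exact: (measurable_preimageT mW (mh c)).
    by move=> y [Sy /hK[_ ?]]; split.
  (* As a condition on [y] the stripes are reversed. The reflection restores the form expected by
     [periodic_le], at the price of a half-open interval moved by one unit. *)
  pose fl : G -> G := fiberwise_affine (fun=> true) (fun=> 0) (fun=> false) (fun=> 0) false.
  have mP' : measurable (fl @^-1` P).
    exact: (measurable_preimageT (measurable_fiberwise_affine _ _ _ _ _) mP).
  have hP' : vol P = vol (fl @^-1` P) by rewrite /vol haar_fiberwise_affine.
  have P'sub : fl @^-1` P `<=` slab (- b%:Z - 1) (2 * b) (- b%:R) b%:R.
    move=> g [[h1 h2] _]; move: h1 h2; rewrite /fl /fiberwise_affine /slab /= !addr0 mul1r => h1 h2.
    by split; [clear -h1; lia|exact: h2].
  have P'per g : (fl @^-1` P) g -> periodic (8 * a * l)%N 0 (8 * a)%N%:Z (g.1.1 - (c - w.1.1)).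
    move=> [_ [q]]; rewrite divgE /fl /fiberwise_affine /= pE => hq.
    by exists q; move: hq; clear; lia.
  have := periodic_le a0 l0 (ler0n _ b) mP' P'sub P'per.
  have -> : haar P = (vol P)%:E by apply: (@haar_vol _ P b mP) => g [].
  by rewrite -hP' -pE lee_fin /e1 ler_pdivlMr; [rewrite [leLHS]mulrC|exact: l0R].
have KA e : K e `<=` box A0 by move=> g [].
have {samp} sle := samp (K 0) (K c) e1 n1 ltac:(lia) (mK 0) (mK c) (KA 0) (KA c) He.
set PP := \sum_(x <- _) _.
pose Q (e : int) : set G := box A1 `&` [set g | periodic (8 * a * l)%N (2 * a)%N%:Z (6 * a)%N%:Z (g.1.1 - e)].
have mQ e : measurable (Q e).
  apply: measurableI; first exact: measurable_box.
  exact: (measurable_first (fun u => periodic _ _ _ (u - e))).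
pose Q0 : R := (2 * A1%:R - p%:R) * (4 * A1%:R) / (2 * l%:R).
have l20 : 0 < (2 * l)%N%:R :> R by rewrite ltr0n muln_gt0 l0.
have pA1 : (p <= 2 * A1)%N by lia.
have hQ e : Q0 <= vol (Q e).
  rewrite /Q0 -!natrM -natrB// ler_pdivrMr// [leRHS]mulrC natrM pE.
  by apply: periodic_ge => //; rewrite -pE.
have boxV z : (box b : set G) z -> (box b.+1 : set G) (z^-1)%g.
  move=> [/= h1 /andP[h2 h3]]; split => /=; first by clear h2 h3; lia.
  by rewrite -natr1; clear -h2 h3; case: z.2; rewrite ?expr0 ?expr1; apply/andP; split; lra.
have boxK w z : (box A1 : set G) w -> (box b : set G) z -> (box A0 : set G) (w * z^-1)%g.
  by move=> hw /boxV hz; apply: box_mul hw hz; lia.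
have low x y : x \in D n.+1 -> y \in D n.+1 ->
    `|c - x.1.1 + y.1.1| < (2 * a)%N%:Z ->
    Q0 <= vol (rtrans (K 0) x `&` rtrans (K c) y).
  move=> /SD Sx /SD Sy cl; apply: le_trans (hQ x.1.1) _.
  apply: (@vol_le _ _ _ (A + A)) => //.
  - by apply: measurableI; exact: measurable_rtrans.
  - move=> w [hw [q hq]]; split; apply/rtransP; split.
    + exact: boxK.
    + exists q; rewrite divgE /= pE; move: cl hq; rewrite /=; move: (w.1.1) (x.1.1) (y.1.1) => u1 u2 u3.
      by clear; lia.
    + exact: boxK.
    + exists q; rewrite divgE /= pE; move: cl hq; rewrite /=; move: (w.1.1) (x.1.1) (y.1.1) => u1 u2 u3.
      by clear; lia.
  - move=> w [/rtransP[h _] _].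
    by rewrite -[w](mulgVK x); apply: box_mul h Sx; lia.
have PPle : PP * Q0 <= e1 * vol (hull xi n.+1 (K 0)) / vol (box b) + vol (box A) / n.+1%:R.
  apply: le_trans sle; rewrite /PP mulr_suml big_seq_cond [leRHS]big_seq_cond.
  apply: ler_sum => x /andP[xD _]; rewrite mulr_suml big_seq_cond [leRHS]big_seq_cond.
  apply: ler_sum => y /andP[yD _]; rewrite -mulrA ler_wpM2l ?mulr_ge0 ?kappa_ge0//.
  case: (boolP (_ < _)) => [cl|_]; first by rewrite mul1r; exact: low.
  by rewrite mul0r vol_ge0.
have volH : vol (hull xi n.+1 (K 0)) <= (2 * A + p)%N%:R * (4 * A%:R) / l%:R.
  rewrite ler_pdivlMr// [leLHS]mulrC pE.
  have sub : hull xi n.+1 (K 0) `<=` slab (- A%:Z) (2 * A) (- A%:R) A%:R.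
    by rewrite -box_slab => g /hK[].
  apply: (@periodic_le _ a l _ _ 0 _ a0 l0 (ler0n _ A) (mh 0) sub) => g /hK[_].
  by rewrite pE.
rewrite !vol_box in PPle.
clear -PPle volH b3 p8 pA A1E pA1 bA l0 lln.
have hb : 0 < b%:R :> R by rewrite ltr0n; lia.
have hA : 0 < A%:R :> R by rewrite ltr0n; lia.
have A1A : (3 * A <= 4 * A1)%N by lia.
move: PPle volH (vol_ge0 (hull xi n.+1 (K 0))); rewrite /e1 /Q0.
move: (vol (hull xi n.+1 (K 0))) => H; move: PP => PP PPle volH H0.
have := @spread_bound A%:R A1%:R b%:R p%:R l%:R n.+1%:R H PP; apply => //.
- by rewrite ltr0n.
- by rewrite -natrM ler_nat.
- by rewrite -natrM ler_nat.
- by move: A1A; rewrite -(ler_nat R) !natrM; lra.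
- by rewrite -natrM ler_nat.
- by rewrite -natrM -natrD.
- by move: PPle; rewrite natrD natrM.
Qed.

End Spread.

(** * The variance estimate *)

Section Levels.
Variables (R : realType) (r : nat -> nat) (xi : nat -> set (set (zrz2 R))).
Variables (D : nat -> {fset zrz2 R}) (s : nat -> int * int -> zrz2 R).
Hypothesis hc : cf_choices r xi D s.
Local Notation G := (zrz2 R).
Local Notation at_ := (atilde r).
Local Notation vol := (@vol R).
Implicit Types (f g w : G) (n : nat) (h : int * int) (A B K : set G).

Definition up n A : set G :=
  [set g | exists2 h, h \in Hseq r n & rtrans A (cmap r s n h) g].

Definition parity (e : bool) : set G := [set g : G | g.2 = e].

Lemma measurable_parity e : measurable (parity e).
Proof.
apply: measurable_zrz2P => x n; rewrite /fiber /parity /=.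
have [Px|nPx] := pselect (n = e).
  by rewrite (_ : mkset _ = setT)//; apply/seteqP; split.
by rewrite (_ : mkset _ = set0)//; apply/seteqP; split.
Qed.

Lemma upE n A : up n A = \big[setU/set0]_(h <- Hseq r n) rtrans A (cmap r s n h).
Proof.
rewrite -bigcup_seq; apply/seteqP; split => g /= [h hh Ag]; by exists h.
Qed.

Lemma measurable_up n A : measurable A -> measurable (up n A).
Proof.
by move=> mA; rewrite upE; apply: bigsetU_measurable => h _; exact: measurable_rtrans.
Qed.

Lemma upP n A f : (0 < n)%N -> A `<=` Fset r n ->
  up n A f <-> Fset r n.+1 f /\ A (back r s n f).
Proof.
move=> n0 AF; split=> [[h /mem_Hseq hh /rtransP Af]|[Ff Af]].
  have Ff := AF _ Af; have [_ _ F1] := cmap_tile hc n0 Ff hh.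
  have := back_cmap hc n0 Ff hh.
  by move: F1; rewrite mulgVK => F1 ->.
exists (tile r n f); first by apply/mem_Hseq/Fset_tile.
by apply/rtransP; rewrite -{1}(backK r s n f) mulgK.
Qed.

Lemma up_sub n A : (0 < n)%N -> A `<=` Fset r n -> up n A `<=` Fset r n.+1.
Proof. by move=> n0 AF g /(upP _ n0 AF)[]. Qed.

Lemma up_mono n A B : A `<=` B -> up n A `<=` up n B.
Proof. by move=> AB g [h hh /rtransP Ag]; exists h => //; apply/rtransP/AB. Qed.

Lemma up_disjoint n A h h' g : (0 < n)%N -> A `<=` Fset r n ->
  h \in Hseq r n -> h' \in Hseq r n ->
  rtrans A (cmap r s n h) g -> rtrans A (cmap r s n h') g -> h = h'.
Proof.
move=> n0 AF /mem_Hseq hh /mem_Hseq hh' /rtransP /AF F1 /rtransP /AF F2.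
have [<- _ _] := cmap_tile hc n0 F1 hh; have [<- _ _] := cmap_tile hc n0 F2 hh'.
by rewrite !mulgVK.
Qed.

Lemma haar_up n A : (0 < n)%N -> measurable A -> A `<=` Fset r n ->
  haar (up n A) = (((2 * r n).+1 ^ 2)%N%:R%:E * haar A)%E.
Proof.
move=> n0 mA AF; have mu := measurable_up n mA.
have mh h : measurable (rtrans A (cmap r s n h)) by exact: measurable_rtrans.
have E : (\sum_(h <- Hseq r n) haar (rtrans A (cmap r s n h)) =
    ((2 * r n).+1 ^ 2)%N%:R%:E * haar A)%E.
  rewrite (eq_bigr (fun=> haar A)); last by move=> h _; rewrite haar_rtrans.
  rewrite (@haar_vol _ A (asize r n))// sumEFin big_const_seq count_predT iter_addr_0.
  by rewrite -(mulr_natl (vol A)) EFinM size_Hseq.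
rewrite -E; apply/eqP; rewrite eq_le; apply/andP; split.
  by apply: measure_le_sum.
apply: sum_measure_disjoint => //; first exact: uniq_Hseq.
- by move=> h hh g Ag; exists h.
- by move=> h h' g; exact: up_disjoint.
Qed.

Lemma vol_up n A : (0 < n)%N -> measurable A -> A `<=` Fset r n ->
  vol (up n A) = ((2 * r n).+1 ^ 2)%N%:R * vol A.
Proof.
by move=> n0 mA AF; rewrite /vol haar_up// (haar_vol mA AF) -EFinM.
Qed.

Lemma cmapV_parity n h g : (g * (cmap r s n h)^-1)%g.2 = g.2 (+) (s n h).2.
Proof. by rewrite divgE /cmap mulgE /= addbF. Qed.

Lemma vol_parity A (a : nat) : measurable A -> A `<=` box a ->
  vol (A `&` parity false) + vol (A `&` parity true) = vol A.
Proof.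
move=> mA Aa; apply: EFin_inj.
have mp e := measurableI _ _ mA (measurable_parity e).
have sp e : A `&` parity e `<=` box a by move=> g [/Aa].
have mF := mp false; have mT := mp true.
have dsj : (A `&` parity false) `&` (A `&` parity true) = set0.
  by apply/seteqP; split => // g [[_ e1] [_ e2]]; move: e1 e2; rewrite /parity /= => ->.
have h1 := @measureU _ _ _ (@haar R) _ _ mF mT dsj.
have AE : (A `&` parity false) `|` (A `&` parity true) = A.
  apply/seteqP; split => g; first by case=> -[].
  by move=> Ag; case E : g.2; [right|left].
have h2 : (vol (A `&` parity false))%:E + (vol (A `&` parity true))%:E = (vol A)%:E.
  apply: etrans (congr2 adde (esym (haar_vol mF (sp _))) (esym (haar_vol mT (sp _)))) _.
  exact: etrans (esym h1) (etrans (congr1 (@haar R) AE) (haar_vol mA Aa)).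
exact: h2.
Qed.

(** Right multiplication by [c_(n+1)(h)] adds the parity of [s n h], which is almost equidistributed
    over [H_n]; the halves are therefore balanced whatever the parities in [A] are. *)
Lemma vol_up_parity n A e : (0 < n)%N -> measurable A -> A `<=` Fset r n ->
  vol (up n A `&` parity e) <= (2^-1 + n%:R^-1) * vol (up n A).
Proof.
move=> n0 mA AF.
have mp b := measurableI _ _ mA (measurable_parity b).
have sp b : A `&` parity b `<=` Fset r n by move=> g [/AF].
have [q qE] : {q : bool -> R | forall b, q b = vol (A `&` parity (e (+) b))} by eexists.
have Sq : q false + q true = vol A.
  rewrite !qE -(vol_parity mA AF); clear; case: e; last by [].
  exact: addrC.
have q0 b : 0 <= q b by rewrite qE; exact: vol_ge0.
have : (haar (up n A `&` parity e) <=
    \sum_(h <- Hseq r n) haar (rtrans (A `&` parity (e (+) (s n h).2)) (cmap r s n h)))%E.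
  apply: measure_le_sum.
  - by apply: measurableI; [exact: measurable_up|exact: measurable_parity].
  - by move=> h _; exact: measurable_rtrans.
  move=> g [[h hh /rtransP Ag] ge]; exists h => //; apply/rtransP; split => //.
  by apply: etrans (cmapV_parity n h g) _; rewrite (ge : g.2 = e).
rewrite (haar_vol (a := asize r n.+1)); last 2 first.
- by apply: measurableI; [exact: measurable_up|exact: measurable_parity].
- by move=> g [/(up_sub n0 AF)].
rewrite (eq_bigr (fun h => (q (s n h).2)%:E)); last first.
  by move=> h _; rewrite qE haar_rtrans// (haar_vol (mp _) (sp _)).
rewrite sumEFin lee_fin => /le_trans; apply.
rewrite (eq_bigr (fun h => q false * ((s n h).2 == false)%:R + q true * ((s n h).2 == true)%:R));
  last first.
  by clear; move=> h _; case: (s n h).2; rewrite ?mulr0 ?mulr1 ?addr0 ?add0r.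
rewrite big_split/= -!mulr_sumr vol_up//.
have c1 := count_parity hc false n0; have c2 := count_parity hc true n0.
apply: le_trans (lerD (ler_wpM2l (q0 false) c1) (ler_wpM2l (q0 true) c2)) _.
by rewrite -mulrDl Sq le_eqVlt; apply/orP; left; apply/eqP; ring.
Qed.

Definition irange (k : nat) (c : int) : seq int := [seq c + j%:Z - k%:Z | j <- iota 0 (2 * k).+1].

Lemma mem_irange k c (z : int) : `|z - c| <= k%:Z -> z \in irange k c.
Proof.
move=> h; apply/mapP; exists (absz (z - c + k%:Z)); first by rewrite mem_iota; lia.
by lia.
Qed.

(* An [S_n]-neighbourhood of [w] meets few tiles, each containing a translate
   of [A]. *)
Lemma haar_up_near n A w (M : R) : (0 < n)%N -> measurable A -> A `<=` Fset r n ->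
  (forall e, vol (A `&` parity e) <= M) ->
  (haar (Sset r n.+1 `&` [set y | up n A (w * y^-1)%g]) <=
   (2 * (2 * n + 3)%N%:R ^+ 2 * M)%:E)%E.
Proof.
move=> n0 mA AF hM; have mp b := measurableI _ _ mA (measurable_parity b).
have sp b : A `&` parity b `<=` Fset r n by move=> g [/AF].
have mS : measurable (Sset r n.+1 : set G) by exact: measurable_box.
pose E := [set g : G | up n A g /\ Sset r n.+1 (g^-1 * w)%g].
have mE : measurable E.
  apply: measurableI; first exact: measurable_up.
  have : measurable ((fun g : G => (w^-1 * g)%g) @^-1` ((fun g : G => (1%g * g^-1)%g) @^-1` Sset r n.+1)).
    apply: (measurable_preimageT (measurable_mull _)).
    by rewrite mulV_fiberwise; apply: (measurable_preimageT (@measurable_fiberwise_affine _ _ _ _ _ _)).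
  by congr measurable; apply/seteqP; split => g /=; rewrite mul1g invgM invgK.
have -> : Sset r n.+1 `&` [set y | up n A (w * y^-1)%g] = (fun g : G => (w * g^-1)%g) @^-1` E.
  by apply/seteqP; split => y; rewrite /E /= invgM invgK mulgVK => -[].
rewrite haar_mulV//.
(* The index of the tile of [g] involves its row with a sign given by its parity, so the candidates
   are triples of a parity, a column and a row. Once the parity of [g] is fixed, only one half of
   [A] can contribute in each tile, whence [M] in place of [vol A]. *)
pose I := [seq (eij, j) | eij <- [seq (e, i) | e <- [:: true; false],
   i <- irange n.+1 (col r n w.1.1)], j <- irange n.+1 (row r n w.1.2)].
pose hh (p : bool * int * int) : int * int := (p.1.2, (-1) ^+ p.1.1 * p.2).
pose F p := rtrans (A `&` parity (p.1.1 (+) (s n (hh p)).2)) (cmap r s n (hh p)).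
apply: (@le_trans _ _ (\sum_(p <- I) haar (F p))%E).
  apply: measure_le_sum => //; first by move=> p _; exact: measurable_rtrans.
  move=> g [[h hH /rtransP Ag] Sg].
  have hH' : Hset r n h by apply/mem_Hseq.
  have [tg _ _] := cmap_tile hc n0 (AF _ Ag) hH'; move: tg; rewrite mulgVK => tg.
  have a0 := atilde_gt0 r n.
  have hE : hh (g.2, col r n g.1.1, row r n g.1.2) = h by rewrite -tg.
  exists (g.2, col r n g.1.1, row r n g.1.2); last first.
    rewrite /F hE; apply/rtransP; split => //.
    exact: etrans (cmapV_parity n h g) _.
  have : (g.1.1 - w.1.1 <= (bsize r n.+1)%:Z /\ - (bsize r n.+1)%:Z <= g.1.1 - w.1.1) /\
      `|g.1.2 - w.1.2 : R| <= (bsize r n.+1)%:R.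
    move: Sg; rewrite /Sset /box /= => -[h1 h2]; split; first by lia.
    move: h2; rewrite -mulrN -mulrDr.
    case: (g.2); rewrite ?expr0 ?expr1 ?mul1r ?mulN1r; rewrite ler_norml => /andP[h3 h4];
      apply/andP; split; lra.
  rewrite bsizeS => -[[h1 h2] h3].
  apply: allpairs_f; first apply: allpairs_f; first by case: (g.2).
    apply: mem_irange; have := colP r n g.1.1; have := colP r n w.1.1.
    move: h1 h2 a0; move: (at_ n) (col r n g.1.1) (col r n w.1.1) => a c c'; clear; nia.
  apply: mem_irange; have /andP[r1 r2] := rowP r n (g.1.2 : R); have /andP[r3 r4] := rowP r n (w.1.2 : R).
  move: r1 r2 r3 r4 h3; rewrite ler_norml => r1 r2 r3 r4 /andP[h3 h4].
  have a0R : 0 < (at_ n)%:R :> R by rewrite ltr0n.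
  have HH : forall z : int, (2 * (at_ n)%:Z * z)%:~R <= ((2 * n + 3)%N%:R * (at_ n)%:R : R) -> z <= n.+1%:Z.
    move=> z; rewrite -[(2 * n + 3)%N%:R]/((2 * n + 3)%N%:Z%:~R) -[(at_ n)%:R]/((at_ n)%:Z%:~R).
    rewrite -intrM ler_int; move: a0; move: (at_ n) => a; clear; nia.
  suff : row r n g.1.2 - row r n w.1.2 <= n.+1%:Z /\ row r n w.1.2 - row r n g.1.2 <= n.+1%:Z.
    by clear; lia.
  move: h3 h4; rewrite natrM natrD => h3 h4.
  by split; apply: HH; rewrite mulrBr rmorphB/= natrD; lra.
rewrite (eq_bigr (fun p => (vol (A `&` parity (p.1.1 (+) (s n (hh p)).2)))%:E)); last first.
  by move=> p _; rewrite /F haar_rtrans// (haar_vol (mp _) (sp _)).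
rewrite sumEFin lee_fin; apply: (@le_trans _ _ (\sum_(p <- I) M)).
  by apply: ler_sum => p _; exact: hM.
rewrite big_const_seq count_predT iter_addr_0 -(mulr_natl M).
have -> : size I = (2 * (2 * n + 3) ^ 2)%N.
  by rewrite !size_allpairs !size_map !size_iota/=; ring.
by rewrite natrM natrX.
Qed.

End Levels.

Section Variance.
Variables (R : realType) (r : nat -> nat) (xi : nat -> set (set (zrz2 R))).
Variables (D : nat -> {fset zrz2 R}) (s : nat -> int * int -> zrz2 R).
Hypothesis hc : cf_choices r xi D s.
Local Notation G := (zrz2 R).
Local Notation at_ := (atilde r).
Local Notation vol := (@vol R).
Implicit Types (f g w : G) (n : nat) (h : int * int) (A B K : set G).

Definition vshift (t : R) : G := ((0, t), false).

(** Vertical shifts act on the left, hence commute with the right translations by [C_(n+1)]: an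
    erosion made before [up] still protects against the diameter of the atoms after it. *)
Lemma hull_up n A A' :
  (forall t g, `|t| < n.+1%:R^-1 -> A' g -> A (vshift t * g)%g) ->
  hull xi n.+1 (up r s n A') `<=` up r s n A.
Proof.
move=> sh g /(hullP hc (ltn0Sn n))[y [[h hh /rtransP Ay] h1 h2 h3]].
exists h => //; apply/rtransP.
have -> : g = (vshift (g.1.2 - y.1.2) * y)%g :> G.
  rewrite mulgE /= add0r mul1r subrK -h1 -h2.
  by case: (g) => -[].
by rewrite -mulgA; exact: sh.
Qed.

Lemma vol_diff (U K : set G) (a : nat) : measurable U -> measurable K ->
  K `<=` U -> U `<=` box a -> vol (U `\` K) = vol U - vol K.
Proof.
move=> mU mK KU Ua; have Ka := subset_trans KU Ua.
have mUK := measurableD mU mK.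
have hU := haar_vol mU Ua; have hK := haar_vol mK Ka.
have fU : (haar U < +oo)%E by rewrite hU ltry.
apply: EFin_inj; rewrite -(haar_vol mUK (subset_trans (@subDsetl _ _ _) Ua)).
apply: etrans (@measureD _ _ _ (@haar R) U K mU mK fU) _.
rewrite (setIidr KU) EFinB; exact: congr2 hU (congr1 _ hK).
Qed.

Lemma vol_subadd (U A B : set G) (a : nat) : measurable U -> measurable A -> measurable B ->
  U `<=` A `|` B -> A `<=` box a -> B `<=` box a -> vol U <= vol A + vol B.
Proof.
move=> mU mA mB UAB Aa Ba.
have Ua : U `<=` box a by move=> g /UAB[/Aa|/Ba].
rewrite -lee_fin EFinD -(haar_vol mU Ua).
have h := le_trans (le_measure (@haar R) (mem_set mU) (mem_set (measurableU _ _ mA mB)) UAB)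
  (measureU2 (@haar R) mA mB).
by rewrite [X in (_ <= X + _)%E](haar_vol mA Aa) [X in (_ <= _ + X)%E](haar_vol mB Ba) in h.
Qed.

Lemma vol_overlap_sub (U K : set G) x y (a : nat) : measurable U -> measurable K ->
  K `<=` U -> U `<=` box a ->
  vol (rtrans U x `&` rtrans U y) <= vol (rtrans K x `&` rtrans K y) + 2 * (vol U - vol K).
Proof.
move=> mU mK KU Ua; have Ka := subset_trans KU Ua.
have mUK := measurableD mU mK.
have hU := haar_vol mU Ua; have hK := haar_vol mK Ka.
have hUK : haar (U `\` K) = (vol U - vol K)%:E.
  by rewrite -(vol_diff mU mK KU Ua) (haar_vol mUK (subset_trans (@subDsetl _ _ _) Ua)).
have mI K' : measurable K' -> measurable (rtrans K' x `&` rtrans K' y).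
  by move=> mK'; apply: measurableI; exact: measurable_rtrans.
have finI K' : measurable K' -> haar K' = (vol K')%:E ->
    haar (rtrans K' x `&` rtrans K' y) = (vol (rtrans K' x `&` rtrans K' y))%:E.
  move=> mK' hK'; rewrite /vol fineK// ge0_fin_numE//.
  apply: (@le_lt_trans _ _ (haar (rtrans K' x))).
    by apply: le_measure; rewrite ?inE//; [exact: mI|exact: measurable_rtrans].
  by rewrite haar_rtrans// hK' ltry.
have cov : (haar (rtrans U x `&` rtrans U y) <=
    haar (rtrans K x `&` rtrans K y) + (haar (rtrans (U `\` K) x) + haar (rtrans (U `\` K) y)))%E.
  have mx := measurable_rtrans x mUK; have my := measurable_rtrans y mUK.
  apply: le_trans (leeD2l _ (measureU2 (@haar R) mx my)).
  apply: le_trans (measureU2 (@haar R) (mI _ mK) (measurableU _ _ mx my)).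
  apply: le_measure; rewrite ?inE.
  - exact: mI.
  - by apply: measurableU; [exact: mI|exact: measurableU].
  move=> g [/rtransP h1 /rtransP h2].
  have [k1|k1] := pselect (K (g * x^-1)%g); last by right; left; apply/rtransP.
  have [k2|k2] := pselect (K (g * y^-1)%g); last by right; right; apply/rtransP.
  by left; split; apply/rtransP.
have eU := finI _ mU hU; have eK := finI _ mK hK.
have ex z : haar (rtrans (U `\` K) z) = (vol U - vol K)%:E by rewrite haar_rtrans.
move: cov; rewrite [X in (X <= _)%E]eU [X in (_ <= X + _)%E]eK.
rewrite [X in (_ <= _ + (X + _))%E]ex [X in (_ <= _ + (_ + X))%E]ex -!EFinD lee_fin.
by rewrite [2 * _]mulrDl !mul1r.
Qed.

(** With [N] the level, the three factors are the imbalance of the parities, the number of tiles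
    that a neighbourhood may meet over the number of tiles in [S_N], and the bound on the ratio of
    the next tile to [F_N]. *)
Lemma variance_coef (N : R) : 100 <= N ->
  (1 + 2 / (N - 2)) * ((2 * N + 1) / (2 * N - 1)) ^+ 2 * (1 + N^-1) ^+ 2 <= 1 + 10 / N.
Proof.
move=> N100; have N0 : 0 < N by lra.
have z0 : 0 < N^-1 by rewrite invr_gt0.
have z1 : N^-1 <= 100^-1 by rewrite lef_pV2 ?posrE.
have h1 : 1 + 2 / (N - 2) <= 1 + 3 * N^-1.
  rewrite lerD2l ler_pdivrMr ?subr_gt0; last lra.
  by rewrite mulrBr divfK ?gt_eqF//; lra.
have h2 : (2 * N + 1) / (2 * N - 1) <= 1 + 3 / 2 * N^-1.
  rewrite ler_pdivrMr; last lra.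
  rewrite [leRHS](_ : _ = 2 * N + 2 - 3 / 2 * N^-1); last by field; rewrite gt_eqF.
  by lra.
have h3 : ((2 * N + 1) / (2 * N - 1)) ^+ 2 <= 1 + 4 * N^-1.
  have p : 0 <= (2 * N + 1) / (2 * N - 1) by apply: divr_ge0; lra.
  apply: le_trans (_ : (1 + 3 / 2 * N^-1) ^+ 2 <= _).
    by rewrite ler_pXn2r// nnegrE//; lra.
  by move: (N^-1) z0 z1 => z z0 z1; nra.
have h4 : (1 + N^-1) ^+ 2 <= 1 + 5 / 2 * N^-1 by move: (N^-1) z0 z1 => z z0 z1; nra.
have p2 : 0 <= 2 / (N - 2) by apply: divr_ge0; lra.
have p3 := sqr_ge0 ((2 * N + 1) / (2 * N - 1)); have p4 := sqr_ge0 (1 + N^-1).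
move: p3 p4 p2 h1 h3 h4; rewrite -![_ / N]/(_ * N^-1).
move: (((2 * N + 1) / (2 * N - 1)) ^+ 2) ((1 + N^-1) ^+ 2) (2 / (N - 2)) (N^-1) z0 z1 => p q u z z0 z1 p3 p4 p2 h1 h3 h4.
have h5 : (1 + u) * p <= 1 + 29 / 4 * z.
  apply: le_trans (_ : (1 + 3 * z) * (1 + 4 * z) <= _); last nra.
  by apply: ler_pM => //; lra.
apply: le_trans (_ : (1 + 29 / 4 * z) * (1 + 5 / 2 * z) <= _); last nra.
by apply: ler_pM => //; rewrite mulr_ge0//; lra.
Qed.

(** [V] is the volume of a tile; [q], [U], [Kv] and [H] are those of [A], of [A C_(n+1)], of its
    core and of the hull of the core; [S], [F] and [v] are those of [S_(n+1)], of [F_(n+1)] and of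
    the next tile. The constant 20 covers 10 from [variance_coef], 1 from the sampling error and 6
    from the passage between [U] and the core. *)
Lemma variance_bound (N V q S F v U H E Kv a at' b Q O : R) : 100 <= N ->
  0 < V -> 0 <= q -> S = (2 * N - 1) ^+ 2 * V -> F = 8 * a ^+ 2 -> v = 8 * at' ^+ 2 ->
  0 < a -> q = V * (U / F) -> 0 <= U <= F -> 0 <= H <= U ->
  E = 2 * (2 * N + 1) ^+ 2 * ((2^-1 + (N - 2)^-1) * q) ->
  a <= at' <= a * (1 + N^-1) -> 0 <= b -> 16 * N * b <= a ->
  U - Kv - F / N <= F - 8 * (a - 2 * b) ^+ 2 ->
  O <= E * H / S + F / N -> Q <= O + 2 * (U - Kv) ->
  Q <= U ^+ 2 / v + 20 / N * v.
Proof.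
move=> N100 V0 q0 SE FE vE a0 qVF /andP[U0 UF] /andP[H0 HU] EE /andP[aat ata] b0 bB hK hO hQ.
have N0 : 0 < N by lra.
have at0 : 0 < at' by lra.
have F0 : 0 < F by rewrite FE mulr_gt0// exprn_gt0.
have v0 : 0 < v by rewrite vE mulr_gt0// exprn_gt0.
have z0 : 0 < N^-1 by rewrite invr_gt0.
have Fv : F <= v by rewrite FE vE ler_pM2l// ler_pXn2r// ?nnegrE ltW.
have vF : v <= F * (1 + N^-1) ^+ 2.
  rewrite FE vE -mulrA ler_pM2l// -exprMn ler_pXn2r// ?nnegrE ?ltW//.
  by rewrite mulr_gt0// addr_gt0.
have e1 : E * H / S <= (1 + 2 / (N - 2)) * ((2 * N + 1) / (2 * N - 1)) ^+ 2 * (U ^+ 2 / F).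
  have E0 : 0 <= E.
    have i0 : 0 <= (N - 2)^-1 by rewrite invr_ge0; lra.
    by rewrite EE !mulr_ge0 ?sqr_ge0//; lra.
  apply: le_trans (_ : E * U / S <= _).
    rewrite ler_wpM2r ?ler_wpM2l//.
    by rewrite invr_ge0 SE mulr_ge0 ?sqr_ge0// ltW.
  rewrite SE EE qVF le_eqVlt; apply/orP; left; apply/eqP; field.
  by rewrite !gt_eqF//; lra.
have c0 : 0 <= (1 + 2 / (N - 2)) * ((2 * N + 1) / (2 * N - 1)) ^+ 2.
  by rewrite mulr_ge0 ?sqr_ge0// addr_ge0// divr_ge0//; lra.
have e2 : U ^+ 2 / F <= U ^+ 2 / v * (1 + N^-1) ^+ 2.
  rewrite ler_pdivrMr// mulrAC -mulrA -[leLHS]mulr1 -[leRHS]mulrA ler_wpM2l ?sqr_ge0//.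
  by rewrite mulrC ler_pdivlMr// mul1r.
have e3 : E * H / S <= (1 + 10 / N) * (U ^+ 2 / v).
  apply: le_trans e1 _; apply: le_trans (ler_wpM2l c0 e2) _.
  rewrite [U ^+ 2 / v * _]mulrC mulrA ler_wpM2r//; last exact: variance_coef.
  by rewrite divr_ge0 ?sqr_ge0// ltW.
have e4 : U ^+ 2 / v <= v.
  by rewrite ler_pdivrMr// -expr2 ler_pXn2r// ?nnegrE ?(ltW v0)//; lra.
have e5 : F - 8 * (a - 2 * b) ^+ 2 <= 2 * (F / N).
  rewrite FE; apply: le_trans (_ : 32 * a * b <= _); first nra.
  rewrite !mulrA ler_pdivlMr//.
  nra.
have e6 : F / N <= v / N by rewrite ler_pM2r.
have e7 : 10 / N * (U ^+ 2 / v) <= 10 / N * v by rewrite ler_wpM2l// divr_ge0// ltW.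
have e8 : (1 + 10 / N) * (U ^+ 2 / v) = U ^+ 2 / v + 10 / N * (U ^+ 2 / v) by rewrite mulrDl mul1r.
have e9 k : k / N * v = k * (v / N) by rewrite mulrAC mulrA.
move: e3 e7; rewrite e8 !e9; have vN0 : 0 <= v / N by rewrite divr_ge0// ltW.
move: hO hK e5 e6 vN0.
move: (E * H / S) (F / N) (v / N) (U ^+ 2 / v) (10 / N * _) => c1 c2 c3 c4 c5 *; lra.
Qed.

Lemma asize_bounds n : (100 <= n)%N -> (n ^ 3 <= r n)%N ->
  [/\ (16 * n.+1 * bsize r n.+1 <= asize r n.+1)%N, (asize r n.+1 <= at_ n.+1)%N &
      (n.+1 * at_ n.+1 <= n.+2 * asize r n.+1)%N].
Proof.
move=> n100 rn; have a0 := atilde_gt0 r n.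
have n32 : (100 * n * n <= n ^ 3)%N by rewrite !expnS expn0 muln1 -mulnA leq_mul2r n100 orbT.
have rn2 := leq_trans n32 rn.
have rn3 : (100 * 100 * n <= r n)%N.
  by apply: leq_trans rn2; rewrite leq_mul2r leq_mul2l n100 !orbT.
have h (x y : nat) : (x <= y)%N -> (x * at_ n <= y * at_ n)%N by move=> xy; rewrite leq_mul2r xy orbT.
have h1 : (16 * n.+1 * (2 * n + 1) <= 2 * r n + 1)%N by clear -rn2 rn3 n100; nia.
have h2 : (n.+1 * (3 * n + 2) <= 2 * r n + 1)%N by clear -rn2 rn3 n100; nia.
split; first by rewrite bsizeS asizeS mulnA; exact: h.
  by rewrite atildeS; lia.
rewrite atildeS bsizeS asizeS.
have := h _ _ h2; move: a0; clear; move: (at_ n) (r n) => a q; nia.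
Qed.

Lemma measurable_mulV w : measurable_fun setT (fun y : G => (w * y^-1)%g).
Proof. by rewrite mulV_fiberwise; exact: measurable_fiberwise_affine. Qed.

Lemma mulf_ratio (F : fieldType) (p q V : F) : p != 0 -> V != 0 -> q = V * (p * q / (p * V)).
Proof. by move=> p0 V0; rewrite -mulf_div divff// mul1r mulrC divfK. Qed.

(** A second moment estimate: two independent translates of [up r s n A] overlap on average hardly
    more than independent subsets of the tile would. The sampling condition is applied to a core
    whose hull is still inside the set, and the difference is paid for by its volume. *)
Lemma variance_step n A A' : (100 <= n)%N -> (n ^ 3 <= r n)%N ->
  measurable A -> measurable A' -> A' `<=` A -> A `<=` Fset r n ->
  (forall t g, `|t| < n.+1%:R^-1 -> A' g -> A (vshift t * g)%g) ->
  (forall e, vol (A `&` parity e) <= (2^-1 + n.-1%:R^-1) * vol A) ->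
  vol A - vol A' <= vol (box (at_ n)) / n.+1%:R ->
  \sum_(x <- D n.+1) \sum_(y <- D n.+1) kappa R (D n.+1) x * kappa R (D n.+1) y *
     vol (rtrans (up r s n A) x `&` rtrans (up r s n A) y)
  <= vol (up r s n A) ^+ 2 / vol (box (at_ n.+1)) + 20 / n.+1%:R * vol (box (at_ n.+1)).
Proof.
move=> n100 rn mA mA' A'A AF sh par core.
have n0 : (0 < n)%N by apply: leq_trans n100.
have [B1 B2 B3] := asize_bounds n100 rn.
have ba : (2 * bsize r n.+1 <= asize r n.+1)%N.
  by apply: leq_trans B1; rewrite leq_mul2r; apply/orP; right; lia.
(* The core is eroded vertically through [A'] and keeps the distance to the boundary of [F_(n+1)]
   that [sample_le] requires. *)
pose U := up r s n A; pose K := up r s n A' `&` box (asize r n.+1 - 2 * bsize r n.+1).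
have mU : measurable U by exact: measurable_up.
have mU' : measurable (up r s n A') by exact: measurable_up.
have mb a : measurable (box a : set G) by exact: measurable_box.
have mK : measurable K by exact: measurableI.
have UF : U `<=` Fset r n.+1 by exact: (up_sub hc).
have A'F := subset_trans A'A AF.
have U'U : up r s n A' `<=` U by exact: up_mono.
have U'F := subset_trans U'U UF.
have KU : K `<=` U by move=> g [/U'U].
have Kb : K `<=` box (asize r n.+1 - 2 * bsize r n.+1) by move=> g [].
have hullU : hull xi n.+1 K `<=` U.
  apply: subset_trans (hull_up sh) => g [B [xB [y [By [Ky _]]]] Bg]; exists B => //; split=> //.
  by exists y.
have mhK : measurable (hull xi n.+1 K) by exact: (measurable_hull hc).
pose E := 2 * (2 * n + 3)%N%:R ^+ 2 * ((2^-1 + n.-1%:R^-1) * vol A).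
have near w : (haar (Sset r n.+1 `&` [set y | hull xi n.+1 K (w * y^-1)%g]) <= E%:E)%E.
  apply: le_trans (haar_up_near hc w n0 mA AF par); apply: le_measure; rewrite ?inE.
  - apply: measurableI; first exact: measurable_box.
    exact: (measurable_preimageT (measurable_mulV w)).
  - apply: measurableI; first exact: measurable_box.
    exact: (measurable_preimageT (measurable_mulV w)).
  - by move=> y [? /= /hullU].
have n1 : (1 < n.+1)%N by rewrite ltnS.
have samp := sample_le hc n1 ba mK mK Kb Kb near.
have mF : measurable (Fset r n.+1 : set G) by exact: measurable_box.
have NE : n.-1%:R = n.+1%:R - 2 :> R by rewrite -(@natrB _ n.+1 2); [congr (_%:R); lia|lia].
have NE2 : (2 * n + 3)%N%:R = 2 * n.+1%:R + 1 :> R by rewrite -natrM natr1; congr (_%:R); lia.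
have V0 : 0 < vol (box (at_ n)) by rewrite vol_box mulr_gt0 ?exprn_gt0// ltr0n atilde_gt0.
have F0 := Fset_gt0 R r (ltn0Sn n).
have vF : vol (Fset r n.+1) = ((2 * r n).+1 ^ 2)%N%:R * vol (box (at_ n)).
  by rewrite !vol_box asizeS natrM exprMn natrX addn1; ring.
apply: (@variance_bound n.+1%:R (vol (box (at_ n))) (vol A) (vol (Sset r n.+1)) (vol (Fset r n.+1))
  (vol (box (at_ n.+1))) (vol U) (vol (hull xi n.+1 K)) E (vol K) (asize r n.+1)%:R (at_ n.+1)%:R
  (bsize r n.+1)%:R _ _ _ _ _ _ _ _ _ _ _ _ _ _ _ _ _ samp).
- by rewrite ler_nat; lia.
- exact: V0.
- exact: vol_ge0.
- rewrite !vol_box bsizeS natrM natrD natrM -natr1; ring.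
- exact: vol_box.
- exact: vol_box.
- by rewrite ltr0n asizeS muln_gt0 addn1 atilde_gt0.
- rewrite (vol_up hc n0 mA AF) vF.
  have p0 : ((2 * r n).+1 ^ 2)%N%:R != 0 :> R by rewrite pnatr_eq0 expn_eq0.
  exact: mulf_ratio p0 (lt0r_neq0 V0).
- apply/andP; split; first exact: vol_ge0.
  exact: (@vol_le _ _ _ (asize r n.+1) mU mF UF (@subset_refl _ _)).
- apply/andP; split; first exact: vol_ge0.
  exact: (vol_le mhK mU hullU UF).
- by rewrite /E NE NE2.
- rewrite ler_nat B2/=.
  have N0 : 0 < n.+1%:R :> R by rewrite ltr0n.
  rewrite -(ler_pM2l N0) mulrCA mulrDr mulr1 mulfV ?gt_eqF// natr1 -!natrM ler_nat.
  by rewrite [leqRHS]mulnC.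
- by [].
- by rewrite -!natrM ler_nat.
- have bF : box (asize r n.+1 - 2 * bsize r n.+1) `<=` (Fset r n.+1 : set G).
    by apply: box_sub; exact: leq_subr.
  have mFb := measurableD mF (mb (asize r n.+1 - 2 * bsize r n.+1)%N).
  have U'K : up r s n A' `<=` K `|` (Fset r n.+1 `\` box (asize r n.+1 - 2 * bsize r n.+1)).
    move=> g Ug; have [bg|bg] := pselect (box (asize r n.+1 - 2 * bsize r n.+1) g); first by left.
    by right; split=> //; exact: U'F.
  have := vol_subadd mU' mK mFb U'K (subset_trans KU UF) (@subDsetl _ _ _).
  rewrite (vol_diff mF (mb _) bF (@subset_refl _ _)).
  rewrite (vol_up hc n0 mA' A'F) (vol_up hc n0 mA AF) [vol (box (_ - _))]vol_box natrB// natrM.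
  have p0 : 0 <= ((2 * r n).+1 ^ 2)%N%:R :> R by [].
  have := ler_wpM2l p0 core; rewrite mulrA -vF.
  clear; rewrite mulrBr; move: (_%:R * vol A) (_%:R * vol A') => c c'.
  move: (vol K) (vol (Fset _ _)) (_ / _) (8 * _) => *; lra.
- rewrite -[leRHS]/(_ + _); set q := 2 * _.
  have k0 x y : 0 <= kappa R (D n.+1) x * kappa R (D n.+1) y by rewrite mulr_ge0 ?kappa_ge0.
  apply: le_trans (_ : \sum_(x <- D n.+1) \sum_(y <- D n.+1) kappa R (D n.+1) x * kappa R (D n.+1) y *
     (vol (rtrans K x `&` rtrans K y) + q) <= _).
    apply: ler_sum => x _; apply: ler_sum => y _; apply: ler_wpM2l => //.
    exact: (vol_overlap_sub x y mU mK KU UF).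
  rewrite -[X in _ + X]mul1r -[X in _ + X * q](sum_kappa hc (ltn0Sn n)) mulr_suml -big_split/=.
  apply: ler_sum => x _; rewrite -[X in X * q]mulr1 -[X in _ + _ * X * q](sum_kappa hc (ltn0Sn n)).
  rewrite mulr_sumr mulr_suml -big_split/=; apply: ler_sum => y _.
  by rewrite mulrDr.
Qed.

End Variance.

Lemma sigma_algebra_seq (T : Type) (I : eqType) (E : set T) (C : set (set T)) (t : seq I)
    (F : I -> set T) :
  (forall i, i \in t -> <<s E, C >> (F i)) -> <<s E, C >> [set x | exists2 i, i \in t & F i x].
Proof.
move=> CF; rewrite (_ : mkset _ = \bigcup_k (if onth t k is Some i then F i else set0)).
  apply: sigma_algebra_bigcup => k; case E1 : (onth t k) => [i|]; last exact: sigma_algebra0.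
  by apply: CF; apply/onthP; exists k; rewrite E1.
apply/seteqP; split => [x [i it Fx]|x [k _]].
  by move/onthP : it => [k E1]; exists k => //; rewrite E1.
by case E1 : (onth t k) => [i|//] Fx; exists i => //; apply/onthP; exists k; rewrite E1.
Qed.

(** * Cylinders of X *)

Section Space.
Variables (R : realType) (r : nat -> nat) (xi : nat -> set (set (zrz2 R))).
Variables (D : nat -> {fset zrz2 R}) (s : nat -> int * int -> zrz2 R).
Hypothesis hc : cf_choices r xi D s.
Local Notation G := (zrz2 R).
Local Notation at_ := (atilde r).
Local Notation vol := (@vol R).
Context {d : measure_display} {X : measurableType d} {mu : probability X R}.
Variable iota : nat -> G * (nat -> G) -> X.
Hypothesis hs : cf_space r s mu iota.
Implicit Types (f g w : G) (n m : nat) (h : int * int) (A B K : set G) (x y : X).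
Implicit Types p q : G * (nat -> G).

Definition Xn n : set X := iota n @` Xset r s n.

(* Outside of [Xn n] the value is arbitrary. *)
Definition pt n x : G * (nat -> G) :=
  xget (1%g, fun=> 1%g) [set p | Xset r s n p /\ iota n p = x].

Definition crd n x : G := (pt n x).1.

Definition cyl n B : set X := [set x | Xn n x /\ B (crd n x)].

Lemma Xset_embed n p : (0 < n)%N -> Xset r s n p -> Xset r s n.+1 (Xembed p).
Proof.
move=> n0 [Fp Cp]; split => /=.
  have := Cp 0%N; rewrite addn0 => /CsetP/mapP[h /mem_Hseq hh ->].
  by have [_ _] := cmap_tile hc n0 Fp hh.
by move=> i; have := Cp i.+1; rewrite addnS.
Qed.

Lemma Xset_unembed n f p : (0 < n)%N -> Xset r s n.+1 p -> Fset r n (back r s n p.1) ->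
  exists2 q, Xset r s n q & [/\ Xembed q = p, q.1 = back r s n p.1 & 
     q.2 = fun i => if i is j.+1 then p.2 j else cmap r s n (tile r n p.1)].
Proof.
move=> n0 [Fp Cp] Fb.
exists (back r s n p.1, fun i => if i is j.+1 then p.2 j else cmap r s n (tile r n p.1)).
  split => //= -[|i]; last by rewrite addnS; exact: Cp.
  by rewrite addn0; exists (tile r n p.1) => //; exact/Fset_tile.
split => //; rewrite /Xembed /= backK; by case: (p).
Qed.

Lemma ptK n p : (0 < n)%N -> Xset r s n p -> pt n (iota n p) = p.
Proof.
move=> n0 Xp; rewrite /pt; case: xgetP => [q _ [Xq E]|/(_ p)/=]; last by case.
apply: (cf_inj hs n0) E; exact/mem_set.
Qed.

Lemma ptP n x : (0 < n)%N -> Xn n x -> Xset r s n (pt n x) /\ iota n (pt n x) = x.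
Proof. by move=> n0 [p Xp <-]; rewrite ptK. Qed.

Lemma crdF n x : (0 < n)%N -> Xn n x -> Fset r n (crd n x).
Proof. by move=> n0 /(ptP n0)[[]]. Qed.

Lemma pt_embed n x : (0 < n)%N -> Xn n x -> Xn n.+1 x /\ pt n.+1 x = Xembed (pt n x).
Proof.
move=> n0 /(ptP n0)[]; move: (pt n x) => p Xp <-.
have Xp' := Xset_embed n0 Xp; rewrite (cf_compat hs n0 Xp); split; first by exists (Xembed p).
by rewrite ptK.
Qed.

Lemma crdS n x : (0 < n)%N -> Xn n x ->
  exists2 h, Hset r n h & crd n.+1 x = (crd n x * cmap r s n h)%g.
Proof.
move=> n0 Xx; have [Xx1 E] := pt_embed n0 Xx; rewrite /crd E /=.
have [[_ /(_ 0%N)]] := ptP n0 Xx; rewrite addn0 => -[h Hh <-] _; by exists h.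
Qed.

Lemma crd_back n x : (0 < n)%N -> Xn n x -> crd n x = back r s n (crd n.+1 x).
Proof.
by move=> n0 Xx; have [h Hh ->] := crdS n0 Xx; rewrite (back_cmap hc n0 _ Hh)//; exact: crdF.
Qed.

Lemma XnS n x : (0 < n)%N -> Xn n.+1 x -> (Xn n x <-> Fset r n (back r s n (crd n.+1 x))).
Proof.
move=> n0 Xx; split=> [Xnx|]; first by rewrite -crd_back//; exact: crdF.
have [Xp E] := ptP (ltn0Sn n) Xx => Fb.
have [q Xq [qE _ _]] := Xset_unembed (1%g) n0 Xp Fb.
by exists q => //; rewrite (cf_compat hs n0 Xq) qE.
Qed.

Lemma Xn_mono m n : (0 < m)%N -> (m <= n)%N -> Xn m `<=` Xn n.
Proof.
move=> m0; elim: n => [|n IH]; first by rewrite leqn0 => /eqP->.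
rewrite leq_eqVlt => /orP[/eqP->//|]; rewrite ltnS => mn x /(IH mn).
by have /pt_embed H : (0 < n)%N := leq_trans m0 mn; move=> /H[].
Qed.

Lemma Xn_cover x : exists2 n, (0 < n)%N & Xn n x.
Proof. by have [n [p [n0 Xp E]]] := cf_union hs x; exists n => //; exists p. Qed.

Lemma cylI n A B : cyl n A `&` cyl n B = cyl n (A `&` B).
Proof. by apply/seteqP; split => [x [[? ?] [? ?]]|x [? [? ?]]]; split. Qed.

Lemma cylF n B : (0 < n)%N -> cyl n (B `&` Fset r n) = cyl n B.
Proof.
move=> n0; apply/seteqP; split => x [Xx]; first by case.
by move=> Bx; split => //; split => //; exact: crdF.
Qed.

Lemma cyl_up n B : (0 < n)%N -> B `<=` Fset r n -> cyl n B = cyl n.+1 (up r s n B).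
Proof.
move=> n0 BF; apply/seteqP; split => x [Xx Bx].
  have [X1 _] := pt_embed n0 Xx; split => //; apply/(upP hc _ n0 BF).
  by rewrite -crd_back//; split => //; exact: crdF.
move: Bx => /(upP hc _ n0 BF)[_ Bb].
have Xnx : Xn n x by apply/(XnS n0 Xx); exact: BF.
by split => //; rewrite crd_back.
Qed.

(** [A C_(m+1) ... C_n], the base at level [n] of a cylinder of level [m]; by default [A] when
    [n < m]. *)
Fixpoint lev A m n : set G :=
  if n is n'.+1 then (if (m <= n')%N then up r s n' (lev A m n') else A) else A.

Lemma lev_id A m : lev A m m = A.
Proof. by case: m => //= m; rewrite ltnn. Qed.

Lemma levS A m n : (m <= n)%N -> lev A m n.+1 = up r s n (lev A m n).
Proof. by move=> /= ->. Qed.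

Lemma lev_ind (P : nat -> set G -> Prop) A m : P m A ->
  (forall n B, (m <= n)%N -> P n B -> P n.+1 (up r s n B)) ->
  forall n, (m <= n)%N -> P n (lev A m n).
Proof.
move=> P0 PS n mn; rewrite -(subnK mn) addnC.
elim: (n - m)%N => [|k IH]; first by rewrite addn0 lev_id.
by rewrite addnS levS ?leq_addr//; apply: PS IH; exact: leq_addr.
Qed.

Lemma measurable_lev A m n : measurable A -> (m <= n)%N -> measurable (lev A m n).
Proof.
by move=> mA; apply: (@lev_ind (fun _ => measurable)) => // k B _; exact: measurable_up.
Qed.

Lemma lev_sub A m n : (0 < m)%N -> A `<=` Fset r m -> (m <= n)%N -> lev A m n `<=` Fset r n.
Proof.
move=> m0 AF; apply: (@lev_ind (fun n B => B `<=` Fset r n)) => // k B mk.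
by apply: (up_sub hc); exact: leq_trans mk.
Qed.

Lemma cyl_lev A m n : (0 < m)%N -> A `<=` Fset r m -> (m <= n)%N -> cyl m A = cyl n (lev A m n).
Proof.
move=> m0 AF mn.
suff [] : lev A m n `<=` Fset r n /\ cyl m A = cyl n (lev A m n) by [].
apply: (@lev_ind (fun n B => B `<=` Fset r n /\ cyl m A = cyl n B)) mn => // k B mk [BF ->].
have k0 : (0 < k)%N by exact: leq_trans mk.
by split; [exact: (up_sub hc)|exact: cyl_up].
Qed.

Lemma cyl_Xbox n B : cyl n B = iota n @` Xbox r s n B 0 (fun=> 1%g) \/ n = 0%N.
Proof.
case: n => [|n]; first by right.
left; apply/seteqP; split => [x [Xx Bx]|_ [p [Xp Bp _] <-]].
  by have [Xp E] := ptP (ltn0Sn n) Xx; exists (pt n.+1 x).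
by split; [exists p|rewrite /crd ptK].
Qed.

Definition embed_preimage (E : set (G * (nat -> G))) : set (G * (nat -> G)) :=
  [set p | E (Xembed p)].

Lemma Xbox_pull n A k c : (0 < n)%N ->
  Xset r s n `&` embed_preimage (Xbox r s n.+1 A k c) =
  [set p | exists2 h, h \in Hseq r n &
    Xbox r s n (rtrans A (cmap r s n h)^-1%g) k.+1
      (fun i => if i is j.+1 then c j else cmap r s n h) p].
Proof.
move=> n0; apply/seteqP; split => [p [Xp [Xe /= Ap cp]]|p [h /mem_Hseq Hh [Xp /rtransP Ap cp]]].
  have := Xp.2 0%N; rewrite addn0 => -[h Hh E]; exists h; first exact/mem_Hseq.
  by split => // [|[|i]//]; [apply/rtransP; rewrite invgK E|exact: cp].
have c0 := cp 0%N (ltn0Sn _); rewrite invgK -c0 in Ap.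
split => //; split => //; first exact: Xset_embed.
by move=> i ik; exact: (cp i.+1).
Qed.

(** The trace on [X_n] of a box of level [n + 1] is a finite union of boxes with one more prescribed
    coordinate; the sets with measurable trace form a sigma-algebra. *)
Lemma Xmeasurable_pull n E : (0 < n)%N -> Xmeasurable r s n.+1 E ->
  Xmeasurable r s n (Xset r s n `&` embed_preimage E).
Proof.
move=> n0; pose P : set (set (G * (nat -> G))) :=
  [set E | Xmeasurable r s n (Xset r s n `&` embed_preimage E)].
have sP : sigma_algebra (Xset r s n.+1) P.
  split.
  - rewrite /P /= (_ : _ `&` _ = set0); first exact: sigma_algebra0.
    by apply/seteqP; split => // p [].
  - move=> B PB; rewrite /P /=.
    rewrite (_ : _ `&` _ = Xset r s n `\` (Xset r s n `&` embed_preimage B)).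
      exact: sigma_algebraCD.
    apply/seteqP; split => p [Xp]; first by move=> [_ nB]; split => // -[].
    by move=> nB; split => //; split; [exact: Xset_embed|move=> Bp; apply: nB].
  - move=> F PF; rewrite /P /=.
    rewrite (_ : _ `&` _ = \bigcup_i (Xset r s n `&` embed_preimage (F i))).
      by apply: sigma_algebra_bigcup => i; exact: PF.
    apply/seteqP; split => p; first by move=> [Xp [i _ Fp]]; exists i.
    by move=> [i _ [Xp Fp]]; split => //; exists i.
move=> XE; suff : P E by []; apply: XE; split => // _ [A [k [c [mA ->]]]].
rewrite /P /= Xbox_pull//; apply: sigma_algebra_seq => h _.
apply: sub_sigma_algebra; do 3 eexists; split; last reflexivity.
exact: measurable_rtrans.
Qed.

Lemma iota_pull n (E : set X) : (0 < n)%N ->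
  Xset r s n `&` iota n @^-1` E =
  Xset r s n `&` embed_preimage (Xset r s n.+1 `&` iota n.+1 @^-1` E).
Proof.
move=> n0; apply/seteqP; split => p [Xp]; rewrite /embed_preimage /= (cf_compat hs n0 Xp).
  by move=> Ep; split => //; split => //; exact: Xset_embed.
by case.
Qed.

(** In the inductive limit measurability is checked at all levels: from [n] on the set is again a
    cylinder, and the lower levels are reached by pulling back step by step. *)
Lemma measurable_cyl n B : (0 < n)%N -> measurable B -> measurable (cyl n B).
Proof.
move=> n0 mB; rewrite -cylF//; have {mB} : measurable (B `&` Fset r n).
  by apply: measurableI => //; exact: measurable_box.
have : B `&` Fset r n `<=` Fset r n by move=> ? [].
move: (_ `&` _) => {}B BF mB; apply/(cf_measurable hs) => k k0.
have top j : (0 < j)%N -> (n <= j)%N ->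
    Xmeasurable r s j (Xset r s j `&` iota j @^-1` cyl n B).
  move=> j0 nj; rewrite (cyl_lev n0 BF nj); apply: sub_sigma_algebra.
  exists (lev B n j), 0%N, (fun=> 1%g); split; first exact: measurable_lev.
  apply/seteqP; split => p; first by move=> [Xp [_]]; rewrite /crd ptK.
  by move=> [Xp Bp _]; split => //; split; [exists p|rewrite /crd ptK].
have [nk|kn] := leqP n k; first exact: top.
suff H i : Xmeasurable r s (k + i) (Xset r s (k + i) `&` iota (k + i) @^-1` cyl n B) ->
    Xmeasurable r s k (Xset r s k `&` iota k @^-1` cyl n B).
  by apply: (H (n - k)%N); rewrite subnKC ?(ltnW kn)//; exact: top.
elim: i => [|i IH]; first by rewrite addn0.
rewrite addnS => H; apply: IH; rewrite iota_pull ?addn_gt0 ?k0//.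
by apply: Xmeasurable_pull => //; rewrite addn_gt0 k0.
Qed.

(** The density of the law of [crd n] on [X_n] with respect to [haar], that is
    [z / (|C_2| ... |C_n|)], expressed without the normalizing constant [z]. *)
Definition rho n : R := fine (mu (Xn n)) / vol (Fset r n).

Lemma Xn_cyl n : Xn n = cyl n setT.
Proof. by apply/seteqP; split => x; [|case]. Qed.

Lemma measurable_Xn n : (0 < n)%N -> measurable (Xn n).
Proof. by move=> n0; rewrite Xn_cyl; exact: measurable_cyl. Qed.

Lemma mu_cyl_prop n : (0 < n)%N -> exists2 c : R, 0 < c &
  forall A, measurable A -> A `<=` Fset r n -> mu (cyl n A) = (c * vol A)%:E.
Proof.
move=> n0; have [z z0 hz] := cf_measure hs.
exists (z * (\prod_(2 <= j < n.+1) #|` fset_set (Cset r s j)|%:R)^-1).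
  rewrite mulr_gt0// invr_gt0 big_nat_cond prodr_gt0// => -[|[|j]]// _.
  by rewrite ltr0n (card_Cset hc).
move=> A mA AF; case: (cyl_Xbox n A) n0 => [-> n0|->//].
rewrite (hz n A 0%N (fun=> 1%g) n0 mA AF)// big_ord0 mulr1 (haar_vol mA AF).
by rewrite -!EFinM; congr _%:E; ring.
Qed.

Lemma mu_Xn n : (0 < n)%N -> mu (Xn n) = (rho n * vol (Fset r n))%:E.
Proof.
move=> n0; rewrite /rho divfK ?gt_eqF ?Fset_gt0//.
by rewrite fineK// fin_num_measure//; exact: measurable_Xn.
Qed.

Lemma mu_cyl n B : (0 < n)%N -> measurable B -> B `<=` Fset r n ->
  mu (cyl n B) = (rho n * vol B)%:E.
Proof.
move=> n0 mB BF; have [c c0 hcc] := mu_cyl_prop n0; have F0 := Fset_gt0 R r n0.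
rewrite hcc// /rho Xn_cyl -cylF// setTI hcc//; last exact: measurable_box.
by rewrite /= mulfK// gt_eqF.
Qed.

Lemma rho_gt0 n : (0 < n)%N -> 0 < rho n.
Proof.
move=> n0; have [c c0 hcc] := mu_cyl_prop n0; have F0 := Fset_gt0 R r n0.
rewrite /rho Xn_cyl -cylF// setTI hcc//; last exact: measurable_box.
by rewrite /= mulfK// gt_eqF.
Qed.

Lemma rhoS n : (0 < n)%N -> rho n = rho n.+1 * ((2 * r n).+1 ^ 2)%N%:R.
Proof.
move=> n0; have F0 := Fset_gt0 R r n0; apply: (mulIf (lt0r_neq0 F0)); apply: EFin_inj.
have mF : measurable (Fset r n : set G) by exact: measurable_box.
have sF : Fset r n `<=` (Fset r n : set G) by [].
have mU := measurable_up r s n mF; have sU := up_sub hc n0 sF.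
have vU := vol_up hc n0 mF sF.
rewrite -(mu_Xn n0) Xn_cyl -(cylF _ n0) setTI (cyl_up n0 sF).
rewrite (mu_cyl (ltn0Sn n) mU sU) vU; congr (_%:E); exact: mulrA.
Qed.

Lemma vol_FsetS n : vol (Fset r n.+1) = ((2 * r n).+1 ^ 2)%N%:R * vol (box (at_ n)).
Proof. by rewrite !vol_box asizeS natrM exprMn natrX addn1; ring. Qed.

(** The tiles of level [n] fill [F_(n+1)] exactly, one for each index in [H_n]. *)
Lemma rho_box n : (0 < n)%N -> mu (Xn n.+1) = (rho n * vol (box (at_ n)))%:E.
Proof.
by move=> n0; rewrite (mu_Xn (ltn0Sn n)) (rhoS n0) vol_FsetS mulrA.
Qed.

Lemma mu_Xn_cvg (e : R) : 0 < e -> exists N, forall n, (N <= n)%N -> 1 - e <= fine (mu (Xn n)).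
Proof.
move=> e0; have cvgX : mu \o (fun n => Xn n.+1) @ \oo --> mu (\bigcup_n Xn n.+1).
  apply: nondecreasing_cvg_mu => [i||]; first exact: measurable_Xn.
    by apply: bigcup_measurable => i _; exact: measurable_Xn.
  by move=> i j ij; apply/subsetPset; apply: Xn_mono.
have UX : \bigcup_n Xn n.+1 = setT.
  apply/seteqP; split => // x _; have [n n0 Xx] := Xn_cover x.
  by exists n.-1 => //; rewrite prednK.
rewrite UX probability_setT in cvgX.
have /fine_cvgP[_ /cvgrPdist_le/(_ _ e0)[N _ HN]] := cvgX.
exists N.+1 => -[//|n]; rewrite ltnS => /HN /=; rewrite ler_norml => /andP[_]; lra.
Qed.

(** Prescribing the next [k] coordinates amounts to a right translation of [A] seen at level
    [n + k]; a prescription outside of the sets [C_i] gives the empty set. *)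
Lemma cyl_sigma n A k c : (0 < n)%N -> measurable A ->
  exists m B, [/\ (0 < m)%N, measurable B & iota n @` Xbox r s n A k c = cyl m B].
Proof.
move=> n0 mA; have [cC|ncC] := pselect (forall i, (i < k)%N -> Cset r s (n.+1 + i)%N (c i)).
  elim: k n A c n0 mA cC => [|k IH] n A c n0 mA cC.
    exists n, A; split => //; apply/seteqP; split => [_ [p [Xp Ap _] <-]|x [Xx Ax]].
      by split; [exists p|rewrite /crd ptK].
    by have [Xp E] := ptP n0 Xx; exists (pt n x).
  have c0C : Cset r s n.+1 (c 0%N) by have := cC 0%N isT; rewrite addn0.
  have mF : measurable (A `&` Fset r n) by apply: measurableI => //; exact: measurable_box.
  have [|||m [B [m0 mB E]]] := IH n.+1 (rtrans (A `&` Fset r n) (c 0%N)) (fun i => c i.+1).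
  - by [].
  - exact: measurable_rtrans.
  - by move=> i ik; have := cC i.+1 ik; rewrite addnS.
  exists m, B; split => //; rewrite -E; apply/seteqP; split => _ [p [Xp Ap cp] <-].
    exists (Xembed p); last by rewrite -(cf_compat hs).
    split; first exact: Xset_embed.
      by rewrite /= (cp 0%N isT); apply/rtransP; rewrite mulgK; split => //; case: Xp.
    by move=> i ik; exact: (cp i.+1).
  move: Ap => /rtransP[Ap Fp].
  pose q : G * (nat -> G) := ((p.1 * (c 0%N)^-1)%g, fun i => if i is j.+1 then p.2 j else c 0%N).
  have qp : Xembed q = p by rewrite /Xembed /q /= mulgVK; case: (p).
  have Xq : Xset r s n q.
    by split => //= -[|i]; [rewrite addn0|rewrite addnS; exact: Xp.2].
  exists q; last by rewrite (cf_compat hs n0 Xq) qp.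
  by split => // -[|i] //= ik; exact: cp.
exists n, set0; split => //; apply/seteqP; split => [_ [p [Xp Ap cp] <-]|x []//].
by exfalso; apply: ncC => i ik; rewrite -cp//; exact: Xp.2.
Qed.

Definition cylinders : set (set X) :=
  [set E | exists n B, [/\ (0 < n)%N, measurable B & E = cyl n B]].

(** A measurable set is cut into its parts in the sets [X_n]. Inside [X_n] images of boxes are
    cylinders by [cyl_sigma], and the injectivity of [iota n] carries complements over. *)
Lemma measurable_cylinders : measurable = <<s cylinders >> :> set (set X).
Proof.
apply/seteqP; split; last first.
  apply: smallest_sub; first exact: sigma_algebra_measurable.
  by move=> _ [n [B [n0 mB ->]]]; exact: measurable_cyl.
move=> E mE.
have -> : E = \bigcup_n (iota n.+1 @` (Xset r s n.+1 `&` iota n.+1 @^-1` E)).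
  apply/seteqP; split => [x Ex|x [n _ [p [_ Ep] <-]]//].
  have [n n0 [p Xp px]] := Xn_cover x; exists n.-1 => //; rewrite prednK//.
  by exists p => //; split => //=; rewrite px.
apply: sigma_algebra_bigcup => n.
have := (cf_measurable hs E).1 mE n.+1 isT; move: (_ `&` _) => {mE}E mE.
pose P : set (set (G * (nat -> G))) :=
  [set E | E `<=` Xset r s n.+1 /\ <<s cylinders >> (iota n.+1 @` E)].
have cylX m B : (0 < m)%N -> measurable B -> <<s cylinders >> (cyl m B).
  by move=> m0 mB; apply: sub_sigma_algebra; exists m, B.
have cXn := cylX _ _ (ltn0Sn n) measurableT.
have sI (A B : set X) : <<s cylinders >> A -> <<s cylinders >> B -> <<s cylinders >> (A `\` B).
  exact: (@measurableD _ (g_sigma_algebraType cylinders)).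
suff : P E by case.
apply: mE; split.
  split.
  - by split => //; rewrite image_set0; exact: sigma_algebra0.
  - move=> B [BX CB]; split; first by move=> p [].
    rewrite (_ : iota _ @` _ = cyl n.+1 setT `\` (iota n.+1 @` B)); first exact: sI.
    rewrite -Xn_cyl; apply/seteqP; split => [_ [p [Xp nB] <-]|_ [[p Xp <-] nB]].
      split; first by exists p.
      move=> [q Bq E1]; apply: nB; rewrite (_ : p = q)//.
      by apply: (cf_inj hs (ltn0Sn n)); rewrite ?inE//; exact: BX.
    by exists p => //; split => // Bp; apply: nB; exists p.
  - move=> F PF; split; first by move=> p [i _ Fp]; exact: (PF i).1.
    by rewrite image_bigcup; apply: sigma_algebra_bigcup => i; exact: (PF i).2.
move=> _ [A [k [c [mA ->]]]]; split; first by move=> p [].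
by have [m [B [m0 mB ->]]] := cyl_sigma k c (ltn0Sn n) mA; exact: cylX.
Qed.

Lemma crd_out n x : ~ Xn n x -> crd n x = 1%g.
Proof.
by move=> nX; rewrite /crd /pt; case: xgetP => [p _ [Xp E]|//]; exfalso; apply: nX; exists p.
Qed.

Lemma measurable_crd n : (0 < n)%N -> measurable_fun setT (crd n).
Proof.
move=> n0 _ B mB; rewrite setTI.
rewrite (_ : _ @^-1` _ = cyl n B `|` (~` Xn n `&` [set _ | B 1%g])).
  apply: measurableU; first exact: measurable_cyl.
  have [B1|nB1] := pselect (B 1%g).
    rewrite (_ : [set _ | _] = setT) ?setIT; last by apply/seteqP; split.
    by apply: measurableC; exact: measurable_Xn.
  by rewrite (_ : [set _ | _] = set0) ?setI0//; apply/seteqP; split.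
apply/seteqP; split => x /=.
  have [Xx|nXx] := pselect (Xn n x) => Bx; first by left.
  by right; split => //=; rewrite -(crd_out nXx).
by case=> [[]//|[nXx B1]]; rewrite (crd_out nXx).
Qed.

Lemma cylinders_setI : setI_closed cylinders.
Proof.
move=> _ _ [n [A [n0 mA ->]]] [m [B [m0 mB ->]]].
rewrite -(cylF A n0) -(cylF B m0).
have mA' : measurable (A `&` Fset r n) by apply: measurableI => //; exact: measurable_box.
have mB' : measurable (B `&` Fset r m) by apply: measurableI => //; exact: measurable_box.
rewrite (cyl_lev n0 (@subIsetr _ _ _) (leq_maxl n m)) (cyl_lev m0 (@subIsetr _ _ _) (leq_maxr n m)).
rewrite cylI; do 2 eexists; split; last reflexivity.
  by rewrite (leq_trans n0)// leq_maxl.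
by apply: measurableI; apply: measurable_lev => //; [exact: leq_maxl|exact: leq_maxr].
Qed.

Lemma measure_eq_cyl (m1 m2 : {measure set X -> \bar R}) :
  (m1 setT < +oo)%E ->
  (forall n B, (0 < n)%N -> measurable B -> m1 (cyl n B) = m2 (cyl n B)) ->
  forall E, measurable E -> m1 E = m2 E.
Proof.
move=> fin H E; rewrite measurable_cylinders => sE.
apply: (@g_sigma_algebra_measure_unique _ _ _ cylinders _ (fun n => Xn n.+1)) sE.
- by move=> _ [n [B [n0 mB ->]]]; exact: measurable_cyl.
- by move=> i; exists i.+1, setT; split => //; exact: Xn_cyl.
- apply/seteqP; split => // x _; have [n n0 Xx] := Xn_cover x.
  by exists n.-1 => //; rewrite prednK.
- exact: cylinders_setI.
- by move=> _ [n [B [n0 mB ->]]]; exact: H.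
- move=> k; apply: le_lt_trans fin; apply: le_measure; rewrite ?inE//.
  exact: measurable_Xn.
Qed.

End Space.

(** * Finite measures are determined by intervals *)

Lemma countable_enum (T : countType) (U : Type) (F : T -> U) (u0 : U) : exists g : nat -> U,
  (forall i, g i = u0 \/ exists t, g i = F t) /\ (forall t, exists i, g i = F t).
Proof.
exists (fun i => if @choice.unpickle T i is Some t then F t else u0); split => [i|t].
  by case: choice.unpickle => [t|]; [right; exists t|left].
by exists (choice.pickle t); rewrite choice.pickleK.
Qed.

Section Intervals.
Variable R : realType.
Local Notation G := (zrz2 R).
Local Notation MR := (measurableTypeR R).

Definition intv (x : int) (p q : R) (e : bool) : set G :=
  [set g : G | [/\ g.1.1 = x, p < g.1.2 <= q & g.2 = e]].

Lemma intvX x p q e : intv x p q e = ([set x] `*` `]p, q]%classic) `*` [set e].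
Proof.
apply/seteqP; split => -[[y a] n] /=; rewrite in_itv/=; first by case.
by move=> [[-> ?] ->]; split.
Qed.

Lemma measurable_intv x p q e : measurable (intv x p q e).
Proof.
by rewrite intvX; apply: measurableX => //; apply: measurableX => //; exact: measurable_itv.
Qed.

Definition intervals : set (set G) := [set A | exists x p q e, A = intv x p q e].

Lemma measurable_intervals : measurable = <<s intervals >> :> set (set G).
Proof.
apply/seteqP; split; last first.
  apply: smallest_sub; first exact: sigma_algebra_measurable.
  by move=> _ [x [p [q [e ->]]]]; exact: measurable_intv.
move=> A mA.
have [F [F1 F2]] := @countable_enum (int * bool)%type (set G)
  (fun xe => ([set xe.1] `*` fiber A xe.1 xe.2) `*` [set xe.2]) set0.
have -> : A = \bigcup_i F i.
  apply/seteqP; split => [[[x a] e] Ax|g [i _]].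
    by have [i Fi] := F2 (x, e); exists i => //; rewrite Fi.
  have [->|[[x e] ->]] := F1 i; first by [].
  by move=> [[/= gx fg] ge]; move: fg; rewrite /fiber /= -gx -ge; case: (g) => -[].
apply: sigma_algebra_bigcup => i; have [->|[[x e] ->]] := F1 i; first exact: sigma_algebra0.
rewrite /fst /snd.
have : measurable (fiber A x e) by exact: measurable_fiber.
move: (fiber A x e) => V mV.
pose P : set (set MR) := [set V | <<s intervals >> (([set x] `*` V) `*` [set e])].
have sT : <<s intervals >> (([set x] `*` setT) `*` [set e]).
  rewrite (_ : _ `*` _ = \bigcup_(k : nat) intv x (- k%:R) k%:R e).
    apply: sigma_algebra_bigcup => k; apply: sub_sigma_algebra.
    by exists x, (- k%:R), k%:R, e.
  apply/seteqP; split => [[[y a] f] [[/= -> _] ->]|[[y a] f] [k _ [/= -> _ ->]]]; last by [].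
  have a0 : `|a| < (Num.truncn `|a|).+1%:R :> R by exact: truncnS_gt.
  exists (Num.truncn `|a|).+1 => //; split => //=.
  by move: a0; rewrite ltr_norml => /andP[-> /ltW].
suff : P V by [].
have : <<s @ocitv R >> V by [].
apply; split; first split.
- rewrite /P /= (_ : _ `*` _ = set0); first exact: sigma_algebra0.
  by apply/seteqP; split => // -[[y a] f] [[]].
- move=> B PB; rewrite /P /= (_ : _ `*` _ = (([set x] `*` setT) `*` [set e]) `\`
     (([set x] `*` B) `*` [set e])).
    exact: (@measurableD _ (g_sigma_algebraType intervals)).
  apply/seteqP; split => -[[y a] f] /=; first by move=> [[-> [_ nB]] ->]; split => // -[[]].
  by move=> [[[-> _] ->] nB]; split => //; split => //; split => // Ba; apply: nB.
- move=> W PF; rewrite /P /= (_ : _ `*` _ = \bigcup_k (([set x] `*` W k) `*` [set e])).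
    by apply: sigma_algebra_bigcup => k; exact: PF.
  apply/seteqP; split => -[[y a] f] /=; first by move=> [[-> [k _ Fk]] ->]; exists k.
  by move=> [k _ [[/= -> Fk] ->]]; split => //; split => //; exists k.
move=> _ [[p q] _ <-]; rewrite /P /=; apply: sub_sigma_algebra; exists x, p, q, e.
by rewrite intvX.
Qed.

Lemma intvI x p q e y p' q' e' : intv x p q e `&` intv y p' q' e' =
  if (x == y) && (e == e') then intv x (Num.max p p') (Num.min q q') e else set0.
Proof.
case: ifPn => [/andP[/eqP-> /eqP->]|ne].
  apply/seteqP; split => g /=.
    move=> [[? /andP[h1 h2] ?] [_ /andP[h3 h4] _]]; split => //.
    by rewrite gt_max le_min h1 h2 h3 h4.
  by move=> [? +  ?]; rewrite gt_max le_min => /andP[/andP[h1 h2] /andP[h3 h4]]; split; split=> //; apply/andP.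
apply/seteqP; split => // g [[gx _ ge] [gx' _ ge']]; move: ne.
by rewrite -gx -gx' -ge -ge' !eqxx.
Qed.

Lemma intv0 x p q e : q <= p -> intv x p q e = set0.
Proof.
move=> qp; apply/seteqP; split => // g [_ /andP[h1 h2] _].
by have := lt_le_trans h1 (le_trans h2 qp); rewrite ltxx.
Qed.

Lemma measure_eq_intv (m1 m2 : {measure set G -> \bar R}) :
  (m1 setT < +oo)%E ->
  (forall x p q e, m1 (intv x p q e) = m2 (intv x p q e)) ->
  forall E, measurable E -> m1 E = m2 E.
Proof.
move=> fin H E; rewrite measurable_intervals => sE.
have [F [F1 F2]] := @countable_enum (int * bool * nat)%type (set G)
  (fun xek => intv xek.1.1 (- xek.2%:R) xek.2%:R xek.1.2) (intv 0 0 0 false).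
apply: (@g_sigma_algebra_measure_unique _ _ _ intervals _ F) sE.
- by move=> _ [x [p [q [e ->]]]]; exact: measurable_intv.
- move=> i; have [->|[[[x e] k] ->]] := F1 i; first by exists 0, 0, 0, false.
  by exists x, (- k%:R), k%:R, e.
- apply/seteqP; split => // -[[x a] e] _.
  have [i Fi] := F2 (x, e, (Num.truncn `|a|).+1); exists i; first by [].
  rewrite Fi; split => //=.
  have a0 : `|a| < (Num.truncn `|a|).+1%:R :> R by exact: truncnS_gt.
  by move: a0; rewrite ltr_norml => /andP[-> /ltW].
- move=> _ _ [x [p [q [e ->]]]] [y [p' [q' [e' ->]]]]; rewrite intvI; case: ifP => _.
    by do 4 eexists.
  by exists 0, 0, 0, false; rewrite intv0.
- by move=> _ [x [p [q [e ->]]]].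
- move=> k; apply: le_lt_trans fin; apply: le_measure; rewrite ?inE//.
  by have [->|[[[x e] j] ->]] := F1 k; exact: measurable_intv.
Qed.

Lemma intv_box x p q e (a : nat) : intv x p q e `&` box a =
  if - a%:Z < x <= a%:Z then intv x (Num.max p (- a%:R)) (Num.min q a%:R) e else set0.
Proof.
case: ifPn => [xa|nxa]; apply/seteqP; split => g //=.
- move=> [[gx /andP[h1 h2] ge] [_ /andP[h3 h4]]]; split => //.
  by rewrite gt_max le_min h1 h2 h3 h4.
- move=> [gx + ge]; rewrite gt_max le_min => /andP[/andP[h1 h2] /andP[h3 h4]].
  by split; [split=> //; apply/andP|split; [rewrite gx|apply/andP]].
by move=> [[gx _ _] [+ _]]; rewrite gx (negbTE nxa).
Qed.

End Intervals.

Section Uniqueness.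
Variables (R : realType) (r : nat -> nat) (xi : nat -> set (set (zrz2 R))).
Variables (D : nat -> {fset zrz2 R}) (s : nat -> int * int -> zrz2 R).
Hypothesis hc : cf_choices r xi D s.
Local Notation G := (zrz2 R).
Context {d : measure_display} {X : measurableType d} {mu : probability X R}.
Variable iota : nat -> G * (nat -> G) -> X.
Hypothesis hs : cf_space r s mu iota.
Local Notation cyl := (@cyl R r s d X iota).

(** Reduces identities of measures to cylinders over nondegenerate intervals, the sets for which the
    loss by erosion is under control. *)
Lemma measure_eq_cyl_intv (m1 m2 : {measure set X -> \bar R}) :
  (m1 setT < +oo)%E ->
  (forall n x p q e, (0 < n)%N -> p < q -> intv x p q e `<=` Fset r n ->
     m1 (cyl n (intv x p q e)) = m2 (cyl n (intv x p q e))) ->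
  forall E, measurable E -> m1 E = m2 E.
Proof.
move=> fin H; apply: (measure_eq_cyl hc hs) => // n B n0 mB.
have mX := measurable_Xn hc hs n0.
have mcr := measurable_crd hc hs n0.
pose M (m : {measure set X -> \bar R}) : {measure set G -> \bar R} :=
  push_measure (mrestr m mX) mcr.
have ME m A : M m A = m (cyl n A).
  by rewrite /M push_measureE /mrestr; congr (m _); apply/seteqP; split => x [].
rewrite -!ME; apply: measure_eq_intv => //.
  by rewrite ME; apply: le_lt_trans fin; apply: le_measure; rewrite ?inE//; exact: (measurable_cyl hc hs).
move=> x p q e; rewrite !ME -(cylF hs _ n0) intv_box; case: ifPn => [xa|_]; last first.
  by rewrite (_ : cyl n set0 = set0) ?measure0//; apply/seteqP; split => // y [].
have [le|lt] := lerP (Num.min q (asize r n)%:R) (Num.max p (- (asize r n)%:R)).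
  by rewrite intv0// (_ : cyl n set0 = set0) ?measure0//; apply/seteqP; split => // y [].
apply: H => // g [gx + ge]; rewrite gt_max le_min => /andP[/andP[h1 h2] /andP[h3 h4]].
by split; [rewrite gx|apply/andP].
Qed.

End Uniqueness.

(** * The action *)

Section Action.
Variables (R : realType) (r : nat -> nat) (xi : nat -> set (set (zrz2 R))).
Variables (D : nat -> {fset zrz2 R}) (s : nat -> int * int -> zrz2 R).
Hypothesis hc : cf_choices r xi D s.
Local Notation G := (zrz2 R).
Local Notation at_ := (atilde r).
Context {d : measure_display} {X : measurableType d} {mu : probability X R}.
Variable iota : nat -> G * (nat -> G) -> X.
Hypothesis hs : cf_space r s mu iota.
Variable T : G -> X -> X.
Hypothesis hT : cf_action r s iota T.
Local Notation cyl := (@cyl R r s d X iota).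
Local Notation crd := (@crd R r s d X iota).
Local Notation pt := (@pt R r s d X iota).
Local Notation Xn := (@Xn R r s d X iota).
Local Notation lev := (@lev R r s).
Implicit Types (f g w : G) (n m : nat) (h : int * int) (A B K : set G) (x y : X).

Lemma in_box g : exists k : nat, box k g.
Proof.
have a0 : `|g.1.2| < (Num.truncn `|g.1.2|).+1%:R :> R by exact: truncnS_gt.
exists (`|g.1.1|.+1 + (Num.truncn `|g.1.2|).+1)%N; split; first by clear; lia.
move: a0; rewrite natrD ltr_norml => /andP[h1 h2].
have : 0 <= (`|g.1.1|.+1)%N%:R :> R by []. 
by move: (_%:R) => b b0; apply/andP; split; lra.
Qed.

Lemma mul_cmap_box g k n f h : box k g -> (k.+1 < n)%N -> Fset r n f -> Hset r n h ->
  Fset r n.+1 (g * f * cmap r s n h)%g.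
Proof.
move=> gk kn Ff Hh; have n0 : (0 < n)%N by exact: leq_ltn_trans kn.
have Ss := D_Sset hc n0 (s_in_D hc n0 Hh).
have Fs : box (asize r n + bsize r n).+1 (f * s n h)%g by apply: box_mul Ff Ss.
have gFs : box (at_ n) (g * (f * s n h))%g.
  by apply: box_mul gk Fs; rewrite (atildeE r n0); lia.
rewrite /cmap -mulgA (mulgA f) mulgA.
have [h1 _] := box_phi h gFs.
by apply/Fset_tile; rewrite h1.
Qed.

Lemma act_large g : exists2 n0, (0 < n0)%N & forall n, (n0 <= n)%N ->
  forall p, Xset r s n p ->
   T g (iota n p) = iota n.+1 ((g * p.1 * p.2 0%N)%g, fun i => p.2 i.+1).
Proof.
have [k gk] := in_box g; exists k.+2 => // n kn p Xp.
apply: hT => //; first by exact: leq_trans kn.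
by move=> f c Ff [h Hh <-]; exact: mul_cmap_box gk _ Ff Hh.
Qed.

(** [cf_action] gives the formula only at levels where [g F_n C_(n+1)] fits into [F_(n+1)]. It
    descends from a large level to every level at which the translated point stays in [F_n], because
    [Xembed] commutes with left translations. *)
Lemma act_iota g n p : (0 < n)%N -> Xset r s n p -> Fset r n (g * p.1)%g ->
  T g (iota n p) = iota n ((g * p.1)%g, p.2).
Proof.
have [n0 n00 hg] := act_large g; have [N nN] : exists N, (n0 <= n + N)%N by exists n0; exact: leq_addl.
elim: N n nN p => [|N IH] n nN p npos Xp Fg.
  rewrite addn0 in nN; rewrite hg//.
  have Xgp : Xset r s n ((g * p.1)%g, p.2) by split => //; exact: Xp.2.
  by rewrite (cf_compat hs npos Xgp).
have Xgp : Xset r s n ((g * p.1)%g, p.2) by split => //; exact: Xp.2.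
rewrite (cf_compat hs npos Xp) (cf_compat hs npos Xgp).
have [Fe _] := Xset_embed hc npos Xgp; move: Fe; rewrite /= -mulgA => Fe.
rewrite (IH n.+1) ?addSnnS//; last exact: (Xset_embed hc).
by rewrite /Xembed /= mulgA.
Qed.

Lemma act_crd g n x : (0 < n)%N -> Xn n x -> Fset r n (g * crd n x)%g ->
  [/\ Xn n (T g x), crd n (T g x) = (g * crd n x)%g & (pt n (T g x)).2 = (pt n x).2].
Proof.
move=> n0 Xx; have [Xp E] := ptP hs n0 Xx; rewrite /crd => Fg.
have Xgp : Xset r s n ((g * (pt n x).1)%g, (pt n x).2) by split => //; exact: Xp.2.
have -> : T g x = iota n ((g * (pt n x).1)%g, (pt n x).2) by rewrite -{1}E act_iota.
by rewrite (ptK hs n0 Xgp); split => //; exists ((g * (pt n x).1)%g, (pt n x).2).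
Qed.

Lemma Fset_mul_large g : exists2 n0, (0 < n0)%N &
  forall n x, (n0 <= n)%N -> Xn n x -> Fset r n.+1 (g * crd n.+1 x)%g.
Proof.
have [k gk] := in_box g; exists k.+2 => // n x kn Xx.
have n0 : (0 < n)%N by exact: leq_trans kn.
have [h Hh ->] := crdS hc hs n0 Xx; rewrite mulgA.
by apply: mul_cmap_box gk _ _ Hh => //; exact: (crdF hs).
Qed.

Lemma point_eq n x y : (0 < n)%N -> Xn n x -> Xn n y -> crd n x = crd n y ->
  (pt n x).2 = (pt n y).2 -> x = y.
Proof.
move=> n0 Xx Xy c t; have [_ <-] := ptP hs n0 Xx; have [_ <-] := ptP hs n0 Xy.
congr (iota n _); move: c t; rewrite /crd; case: (pt n x) => a b; case: (pt n y) => a' b'.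
by move=> /= -> ->.
Qed.

Lemma Xn_common x g : exists n, [/\ (0 < n)%N, Xn n x & Fset r n (g * crd n x)%g].
Proof.
have [n0 n00 H] := Fset_mul_large g; have [m m0 Xx] := Xn_cover hs x.
have Xx' : Xn (maxn n0 m) x by apply: (Xn_mono hc hs m0) Xx; exact: leq_maxr.
exists (maxn n0 m).+1; split => //; last by apply: H Xx'; exact: leq_maxl.
by apply: (Xn_mono hc hs m0) Xx; rewrite (leq_trans (leq_maxr n0 m)).
Qed.

Lemma act1 x : T 1%g x = x.
Proof.
have [n [n0 Xx F]] := Xn_common x 1%g; have [X1 c1 t1] := act_crd n0 Xx F.
by apply: (point_eq n0 X1 Xx _ t1); rewrite c1 mul1g.
Qed.

Lemma actM g g' x : T g (T g' x) = T (g * g')%g x.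
Proof.
have [n0 n00 H] := Fset_mul_large g'; have [n1 n10 H1] := Fset_mul_large (g * g')%g.
have [m m0 Xx] := Xn_cover hs x.
pose N := maxn (maxn n0 n1) m.
have XN : Xn N x by apply: (Xn_mono hc hs m0) Xx; exact: leq_maxr.
have XN1 : Xn N.+1 x.
  by apply: (Xn_mono hc hs m0) Xx; rewrite (leq_trans (leq_maxr (maxn n0 n1) m)).
have F1 : Fset r N.+1 (g' * crd N.+1 x)%g.
  by apply: H XN; rewrite (leq_trans (leq_maxl n0 n1))// leq_maxl.
have F2 : Fset r N.+1 (g * g' * crd N.+1 x)%g.
  by apply: H1 XN; rewrite (leq_trans (leq_maxr n0 n1))// leq_maxl.
have [Xa ca ta] := act_crd (ltn0Sn N) XN1 F1.
have [Xb cb tb] := act_crd (ltn0Sn N) XN1 F2.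
have F3 : Fset r N.+1 (g * crd N.+1 (T g' x))%g by rewrite ca mulgA.
have [Xc cc tc] := act_crd (ltn0Sn N) Xa F3.
apply: (point_eq (ltn0Sn N) Xc Xb); first by rewrite cc ca cb mulgA.
by rewrite tc ta tb.
Qed.

Lemma actK g x : T g^-1%g (T g x) = x.
Proof. by rewrite actM mulVg act1. Qed.

Lemma actVK g x : T g (T g^-1%g x) = x.
Proof. by rewrite actM mulgV act1. Qed.

(** At a level large enough for [g^-1], translating the base does not leave [F_N], so [T g] acts on
    the coordinate alone. *)
Lemma act_preimage_cyl g n B : (0 < n)%N -> B `<=` Fset r n -> exists N,
  [/\ (n <= N)%N, [set f | lev B n N (g * f)%g] `<=` Fset r N &
      T g @^-1` cyl n B = cyl N [set f | lev B n N (g * f)%g]].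
Proof.
move=> n0 BF; have [k gk] := in_box (g^-1)%g.
pose N0 := maxn n k.+2; have nN0 : (n <= N0)%N by exact: leq_maxl.
have N00 : (0 < N0)%N by exact: leq_trans nN0.
have nN : (n <= N0.+1)%N by exact: leq_trans nN0 _.
have sub f : lev B n N0.+1 (g * f)%g -> Fset r N0.+1 f.
  rewrite levS// => -[h /mem_Hseq Hh /rtransP lB].
  have := mul_cmap_box gk (leq_maxr n k.+2) (lev_sub hc n0 BF nN0 lB) Hh.
  by rewrite -mulgA mulgVK mulKg.
exists N0.+1; split => //.
rewrite (cyl_lev hc hs n0 BF nN); apply/seteqP; split => x.
  move=> [/= Xg lg].
  have F : Fset r N0.+1 (g^-1 * crd N0.+1 (T g x))%g by apply: sub; rewrite mulgA mulgV mul1g.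
  have [Xa ca _] := act_crd (ltn0Sn _) Xg F; rewrite actK in Xa ca.
  by split => //=; rewrite ca mulgA mulgV mul1g.
move=> [Xx /= lx].
have F : Fset r N0.+1 (g * crd N0.+1 x)%g by exact: (lev_sub hc n0 BF nN).
by have [Xa ca _] := act_crd (ltn0Sn _) Xx F; split => //; rewrite ca.
Qed.

Lemma measurable_act g : measurable_fun setT (T g).
Proof.
apply: (@measurability _ _ X X setT (T g) _ (measurable_cylinders hc hs)) => _ [_ [n [B [n0 mB ->]]] <-].
rewrite setTI -(cylF hs _ n0).
have mBF : measurable (B `&` Fset r n) by apply: measurableI => //; exact: measurable_box.
have [N [nN sub ->]] := act_preimage_cyl g n0 (@subIsetr _ B _).
apply: (measurable_cyl hc hs); first exact: leq_trans nN.
exact: (measurable_preimageT (measurable_mull g) (measurable_lev r s mBF nN)).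
Qed.

Lemma act_preserving g : measure_preserving mu (T g).
Proof.
split; first exact: measurable_act.
apply: (measure_eq_cyl hc hs (m1 := push_measure mu (measurable_act g)) (m2 := mu)).
  rewrite push_measureE preimage_setT -ge0_fin_numE//.
  exact: (fin_num_measure mu _ measurableT).
move=> n B n0 mB; rewrite push_measureE -(cylF hs _ n0).
have mBF : measurable (B `&` Fset r n) by apply: measurableI => //; exact: measurable_box.
have sBF : B `&` Fset r n `<=` Fset r n by move=> ? [].
move: (_ `&` _) mBF sBF => {mB}B mB sB.
have [N [nN sub ->]] := act_preimage_cyl g n0 sB.
have N0 : (0 < N)%N by exact: leq_trans nN.
have mL := measurable_lev r s mB nN.
rewrite (cyl_lev hc hs n0 sB nN).
apply: etrans (mu_cyl hc hs N0 (measurable_preimageT (measurable_mull g) mL) sub) _.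
apply: etrans (esym (mu_cyl hc hs N0 mL (lev_sub hc n0 sB nN))).
by rewrite /vol haar_mull.
Qed.

Lemma act_invertible g : invertible_mpt mu (T g).
Proof.
split; first exact: act_preserving.
exists (T g^-1%g); split; first exact: measurable_act.
  by apply: aeW => x; exact: actK.
by apply: aeW => x; exact: actVK.
Qed.

Local Notation S := (T ((1, 0), false)).

Lemma act_centralizer g : centralizer mu S (T g).
Proof.
split; first exact: act_invertible.
apply: aeW => x; rewrite !actM; congr (T _ x); exact/esym/shiftC.
Qed.

Lemma iter_act (t : nat) x : iter t S x = T (shift R t) x.
Proof.
elim: t => [|t IH]; first by rewrite act1.
by rewrite iterS IH actM; congr (T _ x); rewrite -[((1, 0), false)]/(shift R 1) shiftD.
Qed.

Definition red_phi_cover n B : set G := [set f | Fset r n.+1 f /\ B (red r n f)].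

Lemma red_phi_coverE n B : B `<=` box (at_ n) ->
  red_phi_cover n B = [set f | exists2 h, h \in Hseq r n & rtrans B (phi R r n h) f].
Proof.
move=> Bb; apply/seteqP; split => [f [/Fset_tile Hf Bf]|f [h /mem_Hseq Hh /rtransP Bf]].
  exists (tile r n f); first exact/mem_Hseq.
  by apply/rtransP; rewrite -{1}(red_tile r n f) mulgK.
have [h1 h2] := box_phi h (Bb _ Bf); rewrite mulgVK in h1 h2.
by split; [apply/Fset_tile; rewrite h1|rewrite h2].
Qed.

Lemma measurable_red_phi_cover n B : measurable B -> B `<=` box (at_ n) ->
  measurable (red_phi_cover n B).
Proof.
move=> mB Bb; rewrite (red_phi_coverE Bb).
rewrite (_ : mkset _ = \big[setU/set0]_(h <- Hseq r n) rtrans B (phi R r n h)).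
  by apply: bigsetU_measurable => h _; exact: measurable_rtrans.
by rewrite -bigcup_seq; apply/seteqP; split => g [h hh Bg]; exists h.
Qed.

Lemma vol_red_phi_cover n B : measurable B -> B `<=` box (at_ n) ->
  vol (red_phi_cover n B) = ((2 * r n).+1 ^ 2)%N%:R * vol B.
Proof.
move=> mB Bb; have mC := measurable_red_phi_cover mB Bb.
have mh h : measurable (rtrans B (phi R r n h)) by exact: measurable_rtrans.
have E : (\sum_(h <- Hseq r n) haar (rtrans B (phi R r n h)) =
    (((2 * r n).+1 ^ 2)%N%:R * vol B)%:E)%E.
  rewrite (eq_bigr (fun=> (vol B)%:E)); last first.
    by move=> h _; rewrite haar_rtrans// (haar_vol mB Bb).
  rewrite sumEFin big_const_seq count_predT iter_addr_0.
  by rewrite -(mulr_natl (vol B)) size_Hseq.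
apply: EFin_inj; rewrite -E -(haar_vol mC (a := asize r n.+1)); last by move=> g [].
have CE := red_phi_coverE Bb.
apply/eqP; rewrite eq_le; apply/andP; split.
  by apply: measure_le_sum => // g; rewrite CE.
apply: sum_measure_disjoint => //; first exact: uniq_Hseq.
- by move=> h hh g Bg; rewrite CE; exists h.
- move=> h h' g _ _ /rtransP B1 /rtransP B2.
  have [h1 _] := box_phi h (Bb _ B1); have [h2 _] := box_phi h' (Bb _ B2).
  by rewrite mulgVK in h1; rewrite mulgVK in h2; rewrite -h1 -h2.
Qed.

(** On [X_(n+1)] the position inside the tile of level [n] is uniformly distributed, since [F_(n+1)]
    consists of full tiles. *)
Lemma mu_red n B : (0 < n)%N -> measurable B -> B `<=` box (at_ n) ->
  measurable [set x | Xn n.+1 x /\ B (red r n (crd n.+1 x))] /\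
  mu [set x | Xn n.+1 x /\ B (red r n (crd n.+1 x))] = (@rho R r s d X mu iota n * vol B)%:E.
Proof.
move=> n0 mB Bb.
have -> : [set x | Xn n.+1 x /\ B (red r n (crd n.+1 x))] = cyl n.+1 (red_phi_cover n B).
  apply/seteqP; split => x [Xx Bx]; split => //; last by case: Bx.
  by split => //; exact: (crdF hs).
have mC := measurable_red_phi_cover mB Bb.
split; first exact: (measurable_cyl hc hs).
rewrite (mu_cyl hc hs (ltn0Sn n) mC); last by move=> f [].
by rewrite vol_red_phi_cover// (rhoS hc hs n0) mulrA.
Qed.

End Action.

(** * Orbit windows *)

Section Windows.
Variables (R : realType) (r : nat -> nat) (xi : nat -> set (set (zrz2 R))).
Variables (D : nat -> {fset zrz2 R}) (s : nat -> int * int -> zrz2 R).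
Hypothesis hc : cf_choices r xi D s.
Local Notation G := (zrz2 R).
Local Notation at_ := (atilde r).
Local Notation shift := (shift R).
Implicit Types (f g w : G) (n m : nat) (h : int * int) (A B K : set G).

(* The mixing condition applies to windows longer than [r n / n ^ 2]. *)
Definition wlen n : nat := (r n %/ n ^ 2).+1.

(* [f] stays in the tiles of [F_(n+1)] when moved along its row by [k] windows in
   either direction. *)
Definition inner k n f : Prop :=
  (`|col r n f.1.1| + k * wlen n + 1 <= r n)%N /\ (`|row r n (f.1.2 : R)| <= r n)%N.

(* At least [2 * (bsize r n + atilde r n.-1)], so that two points which are not apart
   at the levels [n - 1] and [n] are in the same tile at level [n]. *)
Definition gap n : nat := (4 * n * at_ n.-1)%N.

(* The pairs of points of [F_(n+1)] that are not close to being in the same tile. *)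
Definition apart n f f' : Prop := (tile r n f).2 <> (tile r n f').2 \/
  (2 * at_ n <= `|(f.1.1 - f'.1.1)%R| + gap n)%N.

Lemma shift_phi n (k : int) f : (shift (2 * (at_ n)%:Z * k) * f)%g = (f * phi R r n (k, 0))%g.
Proof.
rewrite mul_phiE shiftE /= mulr0 mulr0 mulr0z addr0; congr ((_, _), _).
by rewrite addrC.
Qed.

Lemma tile_shift n f (k t : int) : tile r n (shift (2 * (at_ n)%:Z * k + t) * f)%g =
  ((tile r n (shift t * f)%g).1 + k, (tile r n (shift t * f)%g).2).
Proof. by rewrite -shiftD -mulgA shift_phi tile_mul_phi /= addr0. Qed.

Lemma red_shift n f (k t : int) :
  red r n (shift (2 * (at_ n)%:Z * k + t) * f)%g = red r n (shift t * f)%g.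
Proof. by rewrite -shiftD -mulgA shift_phi red_mul_phi. Qed.

Lemma col_shift n u (t k : nat) : (t < 2 * at_ n * k)%N ->
  col r n u <= col r n (t%:Z + u) <= col r n u + k%:Z.
Proof.
have a0 := atilde_gt0 r n; have := colP r n u; have := colP r n (t%:Z + u).
move: (col r n u) (col r n (t%:Z + u)) => c c'; nia.
Qed.

Lemma tile_shift2 n f t : (tile r n (shift t * f)%g).2 = (tile r n f).2.
Proof. by rewrite shiftE. Qed.

Lemma Hset_tileE n f (i : int) : Hset r n ((tile r n f).1 + i, (tile r n f).2) <->
  (`|(col r n f.1.1 + i)%R| <= r n)%N /\ (`|row r n (f.1.2 : R)| <= r n)%N.
Proof.
rewrite /Hset /tile /=.
have -> // : `|((-1) ^+ f.2 * row r n f.1.2)%R|%N = `|row r n (f.1.2 : R)|%N.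
by case: f.2; rewrite ?expr0 ?expr1 ?mul1r// mulN1r abszN.
Qed.

Lemma Hset_tileE0 n f : Hset r n (tile r n f) <->
  (`|col r n f.1.1| <= r n)%N /\ (`|row r n (f.1.2 : R)| <= r n)%N.
Proof. by have := Hset_tileE n f 0; rewrite !addr0 -surjective_pairing. Qed.

Lemma wlen_gt0 n : (0 < wlen n)%N.
Proof. by []. Qed.

Lemma inner_start n f (t : nat) (i : int) : inner 1 n f -> (t < 2 * at_ n)%N ->
  0 <= i <= (wlen n)%:Z - 1 ->
  Hset r n ((tile r n (shift t%:Z * f)%g).1 + i, (tile r n (shift t%:Z * f)%g).2).
Proof.
move=> [i1 i2] tn iN; have := @col_shift n f.1.1 t 1; rewrite muln1 => /(_ tn) ct.
apply/Hset_tileE; rewrite shiftE /=.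
by move: i1; rewrite mul1n => i1; split => //; lia.
Qed.

Lemma inner_Fset n f (t : nat) : inner 1 n f -> (t < 2 * at_ n * wlen n)%N ->
  Fset r n.+1 (shift t%:Z * f)%g.
Proof.
move=> [i1 i2] tn; have ct := col_shift f.1.1 tn.
apply/Fset_tile/Hset_tileE0; rewrite shiftE /=.
by move: i1; rewrite mul1n => i1; split => //; lia.
Qed.

Lemma inner_back n f (t : nat) : inner 2 n (shift t%:Z * f)%g ->
  (t < 2 * at_ n * wlen n)%N -> inner 1 n f.
Proof.
move=> [i1 i2] tn; have ct := col_shift f.1.1 tn.
move: i1 i2; rewrite shiftE /= => i1 i2; split => //; rewrite mul1n.
lia.
Qed.

Lemma inner_Fset0 k n f : inner k n f -> Fset r n.+1 f.
Proof.
by move=> [i1 i2]; apply/Fset_tile/Hset_tileE0; split => //; lia.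
Qed.

(** Two points at a distance of nearly a tile width share a column only while one is at its start
    and the other at its end. The offset [q] of the left point in its column is injective over one
    period and less than [gap n] at these times. *)
Lemma same_tile_count n (u u' : int) : (2 * at_ n <= `|(u - u')%R| + gap n)%N ->
  (count (fun t : nat => col r n (t%:Z + u) == col r n (t%:Z + u')) (iota 0 (2 * at_ n))
    <= gap n)%N.
Proof.
wlog uu : u u' / u <= u'.
  move=> H; have [uu|/ltW uu] := lerP u u'; first exact: H.
  rewrite distnC => h; rewrite (eq_count (a2 := fun t : nat => col r n (t%:Z + u') == col r n (t%:Z + u))).
    exact: H.
  by move=> t; rewrite eq_sym.
move=> h; have a0 := atilde_gt0 r n.
have key (t t' a : nat) (z : int) : (t < 2 * a)%N -> (t' < 2 * a)%N ->
    t%:Z - t'%:Z = 2 * a%:Z * z -> t = t'.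
  clear; move=> h1 h2 h3.
  have [z0|[z0|z0]] : z <= - 1 \/ z = 0 \/ 1 <= z by lia.
  - nia.
  - by move: h3; rewrite z0 mulr0; lia.
  - nia.
pose q (t : nat) := absz (t%:Z + u + (at_ n)%:Z - 1 - 2 * (at_ n)%:Z * col r n (t%:Z + u))%R.
have qE t : (q t)%:Z = t%:Z + u + (at_ n)%:Z - 1 - 2 * (at_ n)%:Z * col r n (t%:Z + u).
  by rewrite /q; have := colP r n (t%:Z + u); lia.
set P := fun t : nat => _; rewrite -size_filter -(size_map q) -[leqRHS](size_iota 0).
apply: uniq_leq_size.
  rewrite map_inj_in_uniq ?filter_uniq ?iota_uniq// => t t'.
  rewrite !mem_filter !mem_iota !add0n => /andP[_ /andP[_ ht]] /andP[_ /andP[_ ht']] /(congr1 Posz).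
  rewrite !qE => E; apply: (key _ _ (at_ n) (col r n (t%:Z + u) - col r n (t'%:Z + u))) => //.
  by lia.
move=> _ /mapP[t + ->]; rewrite mem_filter => /andP[/eqP Pt _].
rewrite mem_iota add0n /= -ltz_nat qE.
have := colP r n (t%:Z + u'); rewrite -Pt; have := colP r n (t%:Z + u).
by move: h; move: (col r n _) (gap n) (at_ n) => c g a; lia.
Qed.

(** The times of a window are grouped by their residue modulo the width of a tile: within a class
    the position in the tile is constant and the samples read are those of consecutive tiles. *)
Lemma big_mul_iota (F : nat -> R) (p k : nat) :
  \sum_(t < p * k) F t = \sum_(t < p) \sum_(i < k) F (p * i + t)%N.
Proof.
elim: k => [|k IH].
  by rewrite muln0 big_ord0 big1// => t _; rewrite big_ord0.
rewrite mulnS addnC big_split_ord/= IH -big_split/=.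
by apply: eq_bigr => t _; rewrite big_ord_recr.
Qed.

Lemma wlen_ok n : (0 < n)%N -> (r n)%:R / (n ^ 2)%N%:R < (wlen n)%:R :> R.
Proof.
move=> n0; rewrite ltr_pdivrMr ?ltr0n ?expn_gt0 ?n0// -natrM ltr_nat.
by rewrite /wlen mulSn {1}(divn_eq (r n) (n ^ 2)) addnC ltn_add2r ltn_mod expn_gt0 n0.
Qed.

Definition sample_at n f (t i : nat) : G :=
  s n ((tile r n (shift t%:Z * f)%g).1 + i%:Z, (tile r n (shift t%:Z * f)%g).2).

Lemma norm_le_avg (a b N e : R) : 0 < N -> `|a / N - b| <= e -> `|a| <= N * (`|b| + e).
Proof.
move=> N0 h; have -> : a = N * (a / N) by rewrite mulrC divfK// gt_eqF.
rewrite normrM gtr0_norm// ler_pM2l// -[a / N](subrK b) addrC.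
by apply: le_trans (ler_normD _ _) _; rewrite lerD2l.
Qed.

Lemma window_single n f (F : nat -> G -> R) : (0 < n)%N -> inner 1 n f ->
  (forall t x, `|F t x| <= 1) ->
  `|\sum_(t < 2 * at_ n) \sum_(i < wlen n) F t (sample_at n f t i)| <=
  (wlen n)%:R * (\sum_(t < 2 * at_ n) `|\sum_(x <- D n) kappa R (D n) x * F t x|
     + (2 * at_ n)%N%:R / n%:R).
Proof.
move=> n0 inf F1; have N0 : 0 < (wlen n)%:R :> R by rewrite ltr0n.
apply: le_trans (ler_norm_sum _ _ _) _.
have -> : (2 * at_ n)%N%:R / n%:R = \sum_(t < 2 * at_ n) n%:R^-1 :> R.
  by rewrite sumr_const card_ord mulr_natl.
rewrite -big_split/= mulr_sumr; apply: ler_sum => t _.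
have H0 := inner_start (i := 0) inf (ltn_ord t) ltac:(by have := wlen_gt0 n; clear; lia).
have H1 := inner_start (i := (wlen n)%:Z - 1) inf (ltn_ord t) ltac:(by have := wlen_gt0 n; clear; lia).
rewrite addr0 -surjective_pairing in H0.
have := mixing_avg1 hc n0 (wlen_ok n0) H0 H1 (F1 t).
by rewrite big_mkord; exact: norm_le_avg.
Qed.

(** For each residue [t] the two points read the samples along two runs of tiles. If the runs start
    in different tiles, [mixing_avg] applies; otherwise the trivial bound is taken, for at most
    [gap n] values of [t]. *)
Lemma window_pair n f f' (F : nat -> G -> G -> R) : (0 < n)%N -> inner 1 n f -> inner 1 n f' ->
  apart n f f' -> (forall t x y, `|F t x y| <= 1) ->
  `|\sum_(t < 2 * at_ n) \sum_(i < wlen n) F t (sample_at n f t i) (sample_at n f' t i)| <=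
  (wlen n)%:R * (\sum_(t < 2 * at_ n) `|\sum_(x <- D n) \sum_(y <- D n)
     kappa R (D n) x * kappa R (D n) y * F t x y| + (2 * at_ n)%N%:R / n%:R + (gap n)%:R).
Proof.
move=> n0 inf inf' ap F1; have N0 : 0 < (wlen n)%:R :> R by rewrite ltr0n.
apply: le_trans (ler_norm_sum _ _ _) _.
pose P (t : nat) := tile r n (shift t%:Z * f)%g == tile r n (shift t%:Z * f')%g.
have cnt : (\sum_(t < 2 * at_ n) (P t)%:R <= (gap n)%:R :> R).
  rewrite -(big_mkord xpredT (fun t => (P t)%:R)) -natr_sum ler_nat /index_iota subn0.
  have -> : (\sum_(t <- iota 0 (2 * at_ n)) P t)%N = count P (iota 0 (2 * at_ n)).
    by rewrite -sum1_count [RHS]big_mkcond/=; apply: eq_bigr => t _; case: (P t).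
  case: ap => [rows|cols].
    rewrite (eq_count (a2 := pred0)) ?count_pred0// => t /=; apply/negbTE/negP => /eqP E.
    by apply: rows; rewrite -(tile_shift2 n f t) -(tile_shift2 n f' t) E.
  apply: leq_trans (same_tile_count cols); apply: sub_count => t /= /eqP/(congr1 fst).
  by rewrite !shiftE /= => ->.
have -> : (2 * at_ n)%N%:R / n%:R = \sum_(t < 2 * at_ n) n%:R^-1 :> R.
  by rewrite sumr_const card_ord mulr_natl.
apply: le_trans (_ : (wlen n)%:R * (\sum_(t < 2 * at_ n) `|\sum_(x <- D n) \sum_(y <- D n)
     kappa R (D n) x * kappa R (D n) y * F t x y| + \sum_(t < 2 * at_ n) n%:R^-1 +
     \sum_(t < 2 * at_ n) (P t)%:R) <= _); last first.
  by rewrite ler_pM2l// lerD2l.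
rewrite -!big_split/= mulr_sumr; apply: ler_sum => t _.
case: (boolP (P t)) => [Pt|/eqP nP].
  apply: le_trans (ler_norm_sum _ _ _) _.
  apply: le_trans (_ : \sum_(i < wlen n) 1 <= _); first exact: ler_sum.
  have -> : \sum_(i < wlen n) 1 = (wlen n)%:R :> R by rewrite sumr_const card_ord.
  by apply: ler_peMr; [exact: ltW|rewrite lerDr addr_ge0].
rewrite addr0.
have H0 := inner_start (i := 0) inf (ltn_ord t) ltac:(by have := wlen_gt0 n; clear; lia).
have H1 := inner_start (i := (wlen n)%:Z - 1) inf (ltn_ord t) ltac:(by have := wlen_gt0 n; clear; lia).
have H0' := inner_start (i := 0) inf' (ltn_ord t) ltac:(by have := wlen_gt0 n; clear; lia).
have H1' := inner_start (i := (wlen n)%:Z - 1) inf' (ltn_ord t) ltac:(by have := wlen_gt0 n; clear; lia).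
rewrite addr0 -surjective_pairing in H0; rewrite addr0 -surjective_pairing in H0'.
have := mixing_avg hc n0 (wlen_ok n0) H0 H1 H0' H1' nP (F1 t).
by rewrite big_mkord; exact: norm_le_avg.
Qed.

End Windows.

(** * Deviation of visit frequencies from densities *)

Section Deviation.
Variables (R : realType) (r : nat -> nat) (xi : nat -> set (set (zrz2 R))).
Variables (D : nat -> {fset zrz2 R}) (s : nat -> int * int -> zrz2 R).
Hypothesis hc : cf_choices r xi D s.
Local Notation G := (zrz2 R).
Local Notation at_ := (atilde r).
Local Notation vol := (@vol R).
Local Notation lev := (@lev R r s).
Implicit Types (f g w : G) (n m : nat) (h : int * int) (A B K : set G).

Lemma vol_intv x (p q : R) e : p <= q -> vol (intv x p q e) = q - p.
Proof.
move=> pq; rewrite /vol intvX haarX; last first.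
  by apply: measurableX => //; exact: measurable_itv.
rewrite haar_ZRX; last exact: measurable_itv.
have c1 (T : choiceType) (z : T) : counting [set z] = 1%:E :> \bar R.
  rewrite (_ : [set z] = [set y | y \in [:: z]]); first exact: counting_seq.
  by apply/seteqP; split => y /=; rewrite inE => /eqP.
rewrite [X in (X * _ * _)%E]c1 [X in (_ * X)%E]c1 mul1e mule1.
rewrite lebesgue_measure_itv/= lte_fin.
by move: pq; rewrite le_eqVlt => /predU1P[->|->]; rewrite ?ltxx ?subrr.
Qed.

Lemma vol_core x (p q d : R) e : p < q -> 0 < d ->
  vol (intv x p q e) - vol (intv x (p + d) (q - d) e) <= 2 * d.
Proof.
move=> pq d0; rewrite vol_intv ?(ltW pq)//.
have [h|h] := lerP (p + d) (q - d); first by rewrite vol_intv//; lra.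
by rewrite intv0 ?(ltW h)// /vol measure0/=; lra.
Qed.

(** [k] is the number of copies, [|C_(m+1)| ... |C_n|]. Its bound makes an erosion of the base by
    [1 / (n + 1)] cost less than the fraction [1 / (n + 1)] of the tile. *)
Lemma lev_scale m n : (0 < m)%N -> (m <= n)%N -> exists k : R, [/\ 0 <= k,
  (forall B, measurable B -> B `<=` Fset r m -> vol (lev B m n) = k * vol B) &
  8 * k <= vol (box (at_ n))].
Proof.
move=> m0 mn; rewrite -(subnK mn) addnC; elim: (n - m)%N => [|j [k [k0 hk bk]]].
  exists 1; rewrite addn0; split => //.
    by move=> B _ _; rewrite lev_id mul1r.
  by rewrite vol_box ler_wpM2l// exprn_ege1// ler1n atilde_gt0.
exists (((2 * r (m + j)).+1 ^ 2)%N%:R * k); rewrite addnS; split.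
- by rewrite mulr_ge0.
- move=> B mB BF; rewrite levS ?leq_addr// (vol_up hc).
  + by rewrite hk// mulrA.
  + by rewrite addn_gt0 m0.
  + by apply: measurable_lev => //; exact: leq_addr.
  + by apply: (lev_sub hc) => //; exact: leq_addr.
rewrite mulrCA; apply: le_trans (_ : vol (Fset r (m + j).+1) <= _).
  by rewrite vol_FsetS ler_wpM2l.
rewrite !vol_box ler_wpM2l// ler_pXn2r ?nnegrE// ler_nat atildeS; lia.
Qed.

Lemma lev_vshift A A' (d : R) m n : (m <= n)%N ->
  (forall t g, `|t| < d -> A' g -> A (vshift t * g)%g) ->
  forall t g, `|t| < d -> lev A' m n g -> lev A m n (vshift t * g)%g.
Proof.
move=> mn H; rewrite -(subnK mn) addnC; elim: (n - m)%N => [|j IH].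
  by rewrite addn0 !lev_id.
move=> t g td; rewrite addnS !levS ?leq_addr// => -[h Hh /rtransP Ag].
by exists h => //; apply/rtransP; rewrite -mulgA; exact: IH.
Qed.

Lemma lev_mono A A' m n : A' `<=` A -> (m <= n)%N -> lev A' m n `<=` lev A m n.
Proof.
move=> AA mn; rewrite -(subnK mn) addnC; elim: (n - m)%N => [|j IH].
  by rewrite addn0 !lev_id.
by rewrite addnS !levS ?leq_addr//; exact: up_mono.
Qed.

Lemma variance_lev m n x p q e : (0 < m)%N -> (m < n)%N -> (100 <= n)%N -> (n ^ 3 <= r n)%N ->
  p < q -> intv x p q e `<=` Fset r m ->
  forall A, A = lev (intv x p q e) m n.+1 ->
  \sum_(x <- D n.+1) \sum_(y <- D n.+1) kappa R (D n.+1) x * kappa R (D n.+1) y *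
     vol (rtrans A x `&` rtrans A y)
  <= vol A ^+ 2 / vol (box (at_ n.+1)) + 20 / n.+1%:R * vol (box (at_ n.+1)).
Proof.
move=> m0 mn n100 rn pq AF A AE.
have [dl dlE d0] : exists2 dl : R, n.+1%:R^-1 = dl & 0 < dl.
  by exists n.+1%:R^-1 => //; rewrite invr_gt0.
(* The erosion [dl] is the bound on the diameter of the atoms of [xi n.+1]. *)
pose A0 := intv x p q e; pose A1 := intv x (p + dl) (q - dl) e.
have A10 : A1 `<=` A0.
  by move=> g [gx /andP[h1 h2] ge]; split => //; apply/andP; split; lra.
have mn' : (m <= n)%N by exact: ltnW.
have mA0 : measurable A0 by exact: measurable_intv.
have mA1 : measurable A1 by exact: measurable_intv.
have A1F := subset_trans A10 AF.
rewrite AE levS//; apply: (variance_step hc n100 rn (A' := lev A1 m n)).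
- exact: measurable_lev.
- exact: measurable_lev.
- exact: lev_mono.
- exact: (lev_sub hc).
- rewrite dlE; apply: lev_vshift => // t g td [gx /andP[h1 h2] ge].
  move: td; rewrite ltr_norml => /andP[h3 h4].
  by split; rewrite mulgE /= ?add0r ?addFb//; rewrite mul1r; apply/andP; split; lra.
(* Since [m < n], the set of level [n] is the result of a step [up], which has balanced its
   parities. *)
- move=> f; case: n mn mn' {n100 rn A AE dl dlE d0 A1 A10 mA1 A1F} => // n mn mn'.
  rewrite levS//; apply: (vol_up_parity hc).
  + exact: (leq_trans m0 mn).
  + exact: measurable_lev.
  + exact: (lev_sub hc).
- have [k [k0 hk bk]] := lev_scale m0 mn'.
  rewrite !hk// -mulrBr; have := vol_core x e pq d0; rewrite -/A1 => h.
  apply: le_trans (ler_wpM2l k0 h) _.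
  rewrite -dlE mulrA ler_pM2r ?invr_gt0//; clear -k0 bk; lra.
Qed.

End Deviation.

Lemma indic_iff (T U : Type) (R : pzRingType) (A : set T) (B : set U) x y :
  (A x <-> B y) -> \1_A x = \1_B y :> R.
Proof.
move=> AB; rewrite !indicE; congr (nat_of_bool _)%:R.
by apply/idP/idP; rewrite !inE => /AB.
Qed.

Lemma mulr2_ge0 (R : realType) (a b : R) : 0 <= a -> 0 <= b -> 0 <= 2 * a * b.
Proof. by move=> a0 b0; rewrite !mulr_ge0. Qed.

Lemma variance_real (R : realType) (SS a v rh e : R) : 0 <= e -> 0 < v -> 0 < rh -> rh * v <= 1 ->
  SS <= a ^+ 2 / v + e * v ->
  rh * SS + (a / v) ^+ 2 * (rh * v) <= e + 2 * (a / v) * (rh * a).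
Proof.
move=> e0 v0 rh0 rh1 H.
apply: le_trans (_ : rh * (a ^+ 2 / v + e * v) + (a / v) ^+ 2 * (rh * v) <= _).
  by rewrite lerD2r ler_pM2l.
have -> : rh * (a ^+ 2 / v + e * v) + (a / v) ^+ 2 * (rh * v) =
  e * (rh * v) + 2 * (a / v) * (rh * a) by field; rewrite gt_eqF.
by rewrite lerD2r ler_piMr.
Qed.

Section Good.
Variables (R : realType) (r : nat -> nat) (xi : nat -> set (set (zrz2 R))).
Variables (D : nat -> {fset zrz2 R}) (s : nat -> int * int -> zrz2 R).
Hypothesis hc : cf_choices r xi D s.
Local Notation G := (zrz2 R).
Local Notation at_ := (atilde r).
Local Notation vol := (@vol R).
Context {d : measure_display} {X : measurableType d} {mu : probability X R}.
Variable iota : nat -> G * (nat -> G) -> X.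
Hypothesis hs : cf_space r s mu iota.
Variable T : G -> X -> X.
Hypothesis hT : cf_action r s iota T.
Local Notation cyl := (@cyl R r s d X iota).
Local Notation crd := (@crd R r s d X iota).
Local Notation Xn := (@Xn R r s d X iota).
Local Notation rho := (@rho R r s d X mu iota).
Local Notation lev := (@lev R r s).
Local Notation S := (T ((1, 0), false)).
Implicit Types (f g w : G) (n m : nat) (h : int * int) (A B K : set G) (x y : X).

(* Conditional probability, under [kappa], that the point of [F_(n+1)] reducing
   to [w] lies in the level-[n] set [A]. *)
Definition alpha n A w : R := \sum_(c <- D n) kappa R (D n) c * \1_A (w * c^-1)%g.

Definition dens n A : R := vol A / vol (box (at_ n)).

Definition devn n A x : R :=
  \1_(Xn n.+1) x * (alpha n A (red r n (crd n.+1 x)) - dens n A) ^+ 2.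

Definition hit n B : set X := [set x | Xn n.+1 x /\ B (red r n (crd n.+1 x))].

(** Expansion of the square, with the cross term kept on the left so that all terms are nonnegative
    and can be integrated separately. *)
Lemma devn_expand n A x : (0 < n)%N ->
  devn n A x + 2 * dens n A * \sum_(c <- D n) kappa R (D n) c * \1_(hit n (rtrans A c)) x =
  \sum_(c <- D n) \sum_(c' <- D n) kappa R (D n) c * kappa R (D n) c' *
     \1_(hit n (rtrans A c `&` rtrans A c')) x + dens n A ^+ 2 * \1_(Xn n.+1) x.
Proof.
move=> n0; rewrite /devn ![\1_(Xn n.+1) x]indicE; case: (boolP (x \in Xn n.+1)) => [|/negP nX]; last first.
  have z B : \1_(hit n B) x = 0 :> R.
    by rewrite indicE memNset// => -[Xx _]; apply: nX; rewrite inE.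
  rewrite mul0r mulr0 add0r addr0 !big1 ?mulr0//.
    by move=> c _; rewrite big1// => c' _; rewrite z mulr0.
  by move=> c _; rewrite z mulr0.
rewrite inE => Xx; rewrite mul1r mulr1; set w := red r n (crd n.+1 x).
have h1 c : \1_(hit n (rtrans A c)) x = \1_A (w * c^-1)%g :> R.
  apply: indic_iff; split; first by move=> [_ /rtransP].
  by move=> Aw; split => //; apply/rtransP.
have h2 c c' : \1_(hit n (rtrans A c `&` rtrans A c')) x =
    \1_A (w * c^-1)%g * \1_A (w * c'^-1)%g :> R.
  rewrite -h1 -h1 (_ : hit n (_ `&` _) = hit n (rtrans A c) `&` hit n (rtrans A c')) ?indicI//.
  by apply/seteqP; split => y; [move=> [? [? ?]]|move=> [[? ?] [_ ?]]].
under eq_bigr do rewrite h1; rewrite -/(alpha n A w).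
have -> : \sum_(c <- D n) \sum_(c' <- D n) kappa R (D n) c * kappa R (D n) c' *
     \1_(hit n (rtrans A c `&` rtrans A c')) x = alpha n A w ^+ 2.
  rewrite expr2 /alpha mulr_suml; apply: eq_bigr => c _; rewrite mulr_sumr.
  by apply: eq_bigr => c' _; rewrite h2; ring.
by ring.
Qed.

Lemma hit_mu n B : (0 < n)%N -> measurable B -> B `<=` box (at_ n) ->
  measurable (hit n B) /\ mu (hit n B) = (rho n * vol B)%:E.
Proof. exact: (mu_red hc hs). Qed.

Lemma rtrans_box n A c : (0 < n)%N -> A `<=` Fset r n -> c \in D n ->
  rtrans A c `<=` box (at_ n).
Proof.
move=> n0 AF cD g /rtransP Ag; rewrite -(mulgVK c g); apply: (mul_D_box hc) => //.
exact: AF.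
Qed.

(** Empty outside of [D_n], so that measurability holds for every [c] and sums over [D n] can be
    integrated without a membership condition. *)
Definition hitD n A c : set X := if c \in D n then hit n (rtrans A c) else set0.

Definition hitD2 n A c c' : set X :=
  if c \in D n then hit n (rtrans A c `&` rtrans A c') else set0.

Lemma hitD_mu n A c : (0 < n)%N -> measurable A -> A `<=` Fset r n ->
  measurable (hitD n A c) /\ (c \in D n -> mu (hitD n A c) = (rho n * vol A)%:E).
Proof.
move=> n0 mA AF; rewrite /hitD; case: ifPn => [cD|//].
have [m1 m2] := hit_mu n0 (measurable_rtrans c mA) (rtrans_box n0 AF cD).
by split=> [|_]; [exact: m1|rewrite m2 vol_rtrans].
Qed.

Lemma hitD2_mu n A c c' : (0 < n)%N -> measurable A -> A `<=` Fset r n ->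
  measurable (hitD2 n A c c') /\
  (c \in D n -> mu (hitD2 n A c c') = (rho n * vol (rtrans A c `&` rtrans A c'))%:E).
Proof.
move=> n0 mA AF; rewrite /hitD2; case: ifPn => [cD|//].
have mI : measurable (rtrans A c `&` rtrans A c') by apply: measurableI; exact: measurable_rtrans.
have sI : rtrans A c `&` rtrans A c' `<=` box (at_ n) by move=> g [/(rtrans_box n0 AF cD)].
by have [m1 m2] := hit_mu n0 mI sI.
Qed.

Lemma devn_expandD n A x : (0 < n)%N ->
  devn n A x + \sum_(c <- D n) 2 * dens n A * kappa R (D n) c * \1_(hitD n A c) x =
  \sum_(c <- D n) \sum_(c' <- D n) kappa R (D n) c * kappa R (D n) c' * \1_(hitD2 n A c c') x
  + dens n A ^+ 2 * \1_(Xn n.+1) x.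
Proof.
move=> n0; transitivity (devn n A x + 2 * dens n A * \sum_(c <- D n) kappa R (D n) c *
    \1_(hit n (rtrans A c)) x).
  congr (_ + _); rewrite mulr_sumr big_seq_cond [RHS]big_seq_cond.
  by apply: eq_bigr => c /andP[cD _]; rewrite /hitD cD mulrA.
rewrite devn_expand//; congr (_ + _); rewrite big_seq_cond [RHS]big_seq_cond.
by apply: eq_bigr => c /andP[cD _]; rewrite /hitD2 cD.
Qed.

Lemma devn_ge0 n A x : 0 <= devn n A x.
Proof. by rewrite /devn mulr_ge0 ?sqr_ge0// indicE. Qed.

Lemma dens_ge0 n A : 0 <= dens n A.
Proof. by rewrite divr_ge0// vol_ge0. Qed.

Lemma measurable_devn n A : (0 < n)%N -> measurable A -> A `<=` Fset r n ->
  measurable_fun setT (devn n A).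
Proof.
move=> n0 mA AF.
have E : devn n A = (fun x => \sum_(c <- D n) \sum_(c' <- D n) kappa R (D n) c * kappa R (D n) c' *
     \1_(hitD2 n A c c') x + dens n A ^+ 2 * \1_(Xn n.+1) x
   - \sum_(c <- D n) 2 * dens n A * kappa R (D n) c * \1_(hitD n A c) x).
  by apply/funext => x; rewrite -devn_expandD// addrK.
rewrite E; apply: measurable_funB; first apply: measurable_funD.
- apply: measurable_sum => c; apply: measurable_sum => c'; apply: measurable_funM => //.
  by apply: measurable_indic; exact: (hitD2_mu c c' n0 mA AF).1.
- by apply: measurable_funM => //; apply: measurable_indic; exact: (measurable_Xn hc hs).
- apply: measurable_sum => c; apply: measurable_funM => //.
  by apply: measurable_indic; exact: (hitD_mu c n0 mA AF).1.
Qed.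

Lemma integral_sumR (I : Type) (t : seq I) (F : I -> X -> R) :
  (forall i, measurable_fun setT (F i)) -> (forall i x, 0 <= F i x) ->
  (\int[mu]_x (\sum_(i <- t) F i x)%:E = \sum_(i <- t) \int[mu]_x (F i x)%:E)%E.
Proof.
move=> mF F0; under eq_integral do rewrite -sumEFin.
rewrite ge0_integral_sum// => [i|i x _]; first exact/measurable_EFinP.
by rewrite lee_fin.
Qed.

Lemma integral_indicZ (k : R) (U : set X) : 0 <= k -> measurable U ->
  (\int[mu]_x (k * \1_U x)%:E = k%:E * mu U)%E.
Proof.
move=> k0 mU; under eq_integral do rewrite EFinM.
rewrite ge0_integralZl//; first by rewrite integral_indic// setIT.
by apply/measurable_EFinP; exact: measurable_indic.
Qed.

(** As the position in the tile is uniform, the double sum integrates to [rho n] times the averaged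
    overlap, while the linear terms are exact by translation invariance of [haar]. The variance
    estimate is then the hypothesis. *)
Lemma integral_devn n A (e : R) : (0 < n)%N -> measurable A -> A `<=` Fset r n -> 0 <= e ->
  \sum_(x <- D n) \sum_(y <- D n) kappa R (D n) x * kappa R (D n) y *
     vol (rtrans A x `&` rtrans A y) <= vol A ^+ 2 / vol (box (at_ n)) + e * vol (box (at_ n)) ->
  (\int[mu]_x (devn n A x)%:E <= e%:E)%E.
Proof.
move=> n0 mA AF e0 H; have mdev := measurable_devn n0 mA AF.
have mX : measurable (Xn n.+1) by exact: (measurable_Xn hc hs).
have v0 : 0 < vol (box (at_ n)) by rewrite vol_box mulr_gt0// exprn_gt0// ltr0n atilde_gt0.
have rho0 : 0 < rho n by exact: (rho_gt0 hc hs).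
have rhoX := rho_box hc hs n0.
have rho1 : rho n * vol (box (at_ n)) <= 1.
  by rewrite -lee_fin -rhoX probability_le1.
have kd c : 0 <= 2 * dens n A * kappa R (D n) c by exact: mulr2_ge0 (dens_ge0 n A) (kappa_ge0 _ _).
have kk c c' : 0 <= kappa R (D n) c * kappa R (D n) c' by rewrite mulr_ge0 ?kappa_ge0.
have ind0 (k : R) (U : set X) x : 0 <= k -> 0 <= k * \1_U x.
  by move=> k0; rewrite mulr_ge0// indicE.
have mi (k : R) (U : set X) : measurable U -> measurable_fun setT (fun x => k * \1_U x).
  by move=> mU; apply: measurable_funM => //; exact: measurable_indic.
have mh c := (hitD_mu c n0 mA AF).1; have mh2 c c' := (hitD2_mu c c' n0 mA AF).1.
have E1 : (\int[mu]_x (devn n A x + \sum_(c <- D n) 2 * dens n A * kappa R (D n) c *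
    \1_(hitD n A c) x)%:E =
   \int[mu]_x (devn n A x)%:E + (2 * dens n A * (rho n * vol A))%:E)%E.
  under eq_integral do rewrite EFinD.
  rewrite ge0_integralD//; last 4 first.
  - by move=> x _; rewrite lee_fin devn_ge0.
  - exact/measurable_EFinP.
  - by move=> x _; rewrite lee_fin sumr_ge0// => c _; exact: ind0.
  - by apply/measurable_EFinP; apply: measurable_sum => c; exact: mi.
  congr (_ + _)%E; rewrite integral_sumR; last 2 first.
  - by move=> c; exact: mi.
  - by move=> c x; exact: ind0.
  rewrite big_seq_cond (eq_bigr (fun c => (kappa R (D n) c * (2 * dens n A * (rho n * vol A)))%:E)).
    by rewrite -big_seq_cond sumEFin -mulr_suml (sum_kappa hc)// mul1r.
  move=> c /andP[cD _]; rewrite integral_indicZ// (hitD_mu c n0 mA AF).2// -EFinM.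
  by congr _%:E; ring.
have E2 : (\int[mu]_x (\sum_(c <- D n) \sum_(c' <- D n) kappa R (D n) c * kappa R (D n) c' *
    \1_(hitD2 n A c c') x + dens n A ^+ 2 * \1_(Xn n.+1) x)%:E =
   (rho n * (\sum_(x <- D n) \sum_(y <- D n) kappa R (D n) x * kappa R (D n) y *
     vol (rtrans A x `&` rtrans A y)) + dens n A ^+ 2 * (rho n * vol (box (at_ n))))%:E)%E.
  under eq_integral do rewrite EFinD.
  rewrite ge0_integralD//; last 4 first.
  - by move=> x _; rewrite lee_fin sumr_ge0// => c _; rewrite sumr_ge0// => c' _; exact: ind0.
  - apply/measurable_EFinP; apply: measurable_sum => c; apply: measurable_sum => c'; exact: mi.
  - by move=> x _; rewrite lee_fin; apply: ind0; exact: sqr_ge0.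
  - by apply/measurable_EFinP; exact: mi.
  rewrite EFinD (integral_indicZ (sqr_ge0 _) mX) rhoX -EFinM; congr (_ + _)%E.
  rewrite integral_sumR; last 2 first.
  - by move=> c; apply: measurable_sum => c'; exact: mi.
  - by move=> c x; rewrite sumr_ge0// => c' _; exact: ind0.
  rewrite mulr_sumr -sumEFin big_seq_cond [RHS]big_seq_cond; apply: eq_bigr => c /andP[cD _].
  rewrite integral_sumR; last 2 first.
  - by move=> c'; exact: mi.
  - by move=> c' x; exact: ind0.
  rewrite mulr_sumr -sumEFin; apply: eq_bigr => c' _.
  rewrite integral_indicZ// (hitD2_mu c c' n0 mA AF).2// -EFinM.
  by congr _%:E; ring.
have E3 : (\int[mu]_x (devn n A x)%:E + (2 * dens n A * (rho n * vol A))%:E =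
  (rho n * (\sum_(x <- D n) \sum_(y <- D n) kappa R (D n) x * kappa R (D n) y *
     vol (rtrans A x `&` rtrans A y)) + dens n A ^+ 2 * (rho n * vol (box (at_ n))))%:E)%E.
  by rewrite -E1 -E2; apply: eq_integral => x _; rewrite devn_expandD.
rewrite -(leeD2rE (x := (2 * dens n A * (rho n * vol A))%:E))// E3 -EFinD lee_fin.
exact: variance_real.
Qed.

Definition dev_sum n A x : R := \sum_(t < 2 * at_ n) devn n A (iter t S x).

(* By the Cauchy-Schwarz inequality, a point outside of [bad n A eps] deviates from the
   density of [A] by at most [eps] on average. *)
Definition bad n A (eps : R) : set X := [set x | eps ^+ 2 * (2 * at_ n)%N%:R < dev_sum n A x].

Lemma measurable_dev_sum n A : (0 < n)%N -> measurable A -> A `<=` Fset r n ->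
  measurable_fun setT (dev_sum n A).
Proof.
move=> n0 mA AF; apply: measurable_sum => t.
apply: (measurableT_comp (measurable_devn n0 mA AF)).
exact: (measurable_iter (act_preserving hc hs hT _)).
Qed.

Lemma dev_sum_ge0 n A x : 0 <= dev_sum n A x.
Proof. by apply: sumr_ge0 => t _; exact: devn_ge0. Qed.

Lemma integral_preserving (f : X -> X) (g : X -> R) : measure_preserving mu f ->
  measurable_fun setT g -> (forall x, 0 <= g x) ->
  (\int[mu]_x (g (f x))%:E = \int[mu]_x (g x)%:E)%E.
Proof.
move=> [mf pf] mg g0.
have mgE : measurable_fun setT (fun x => (g x)%:E) by exact/measurable_EFinP.
have h := @ge0_integral_pushforward _ _ X X R f mf mu setT (fun x => (g x)%:E) measurableT.
rewrite preimage_setT in h; apply: etrans (esym (h mgE _)) _; first by move=> x _; rewrite lee_fin.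
by apply: eq_measure_integral => A mA _; exact: pf.
Qed.

Lemma integral_dev_sum n A (e : R) : (0 < n)%N -> measurable A -> A `<=` Fset r n ->
  (\int[mu]_x (devn n A x)%:E <= e%:E)%E ->
  (\int[mu]_x (dev_sum n A x)%:E <= ((2 * at_ n)%N%:R * e)%:E)%E.
Proof.
move=> n0 mA AF H; have mdev := measurable_devn n0 mA AF.
have mit t := measure_preserving_iter (act_preserving hc hs hT ((1, 0), false)) t.
rewrite integral_sumR; last 2 first.
- by move=> t; apply: (measurableT_comp mdev); exact: (mit t).1.
- by move=> t x; exact: devn_ge0.
rewrite (eq_bigr (fun=> \int[mu]_x (devn n A x)%:E)%E); last first.
  by move=> t _; apply: integral_preserving (mit t) mdev _ => x; exact: devn_ge0.
rewrite (_ : ((2 * at_ n)%N%:R * e)%:E = (\sum_(t < 2 * at_ n) e%:E)%E); last first.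
  by rewrite sumEFin sumr_const card_ord mulr_natl.
by apply: lee_sum => t _.
Qed.

Lemma mu_bad n A (e eps : R) : (0 < n)%N -> measurable A -> A `<=` Fset r n -> 0 < eps ->
  (\int[mu]_x (devn n A x)%:E <= e%:E)%E ->
  measurable (bad n A eps) /\ (mu (bad n A eps) <= (e / eps ^+ 2)%:E)%E.
Proof.
move=> n0 mA AF eps0 H; have mdev := measurable_dev_sum n0 mA AF.
have mb : measurable (bad n A eps).
  rewrite -[X in measurable X]setTI (_ : bad n A eps = dev_sum n A @^-1`
    `]eps ^+ 2 * (2 * at_ n)%N%:R, +oo[%classic); last first.
    by apply/seteqP; split => x /=; rewrite in_itv/= andbT.
  by apply: mdev => //; exact: measurable_itv.
split => //.
have c0 : 0 < eps ^+ 2 * (2 * at_ n)%N%:R.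
  by rewrite mulr_gt0 ?exprn_gt0// ltr0n muln_gt0 atilde_gt0.
have : ((eps ^+ 2 * (2 * at_ n)%N%:R)%:E * mu (bad n A eps) <= ((2 * at_ n)%N%:R * e)%:E)%E.
  apply: le_trans (integral_dev_sum n0 mA AF H); rewrite -integral_indicZ ?(ltW c0)//.
  apply: ge0_le_integral => //.
  - by move=> x _; rewrite lee_fin mulr_ge0 ?(ltW c0)// indicE.
  - by apply/measurable_EFinP; apply: measurable_funM => //; exact: measurable_indic.
  - exact/measurable_EFinP.
  - move=> x _; rewrite lee_fin indicE; case: (boolP (_ \in _)).
      by rewrite inE mulr1 => /ltW.
    by rewrite mulr0 dev_sum_ge0.
rewrite -(@fineK _ (mu (bad n A eps))) ?fin_num_measure// -EFinM !lee_fin => h.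
rewrite ler_pdivlMr ?exprn_gt0//.
have a0 : 0 < (2 * at_ n)%N%:R :> R by rewrite ltr0n muln_gt0 atilde_gt0.
by rewrite -(ler_pM2l a0); apply: le_trans h; rewrite le_eqVlt; apply/orP; left; apply/eqP; ring.
Qed.

Lemma win_crd n x (t : nat) : Xn n.+1 x -> inner r 1 n (crd n.+1 x) ->
  (t < 2 * at_ n * wlen r n)%N ->
  Xn n.+1 (iter t S x) /\ crd n.+1 (iter t S x) = (shift R t%:Z * crd n.+1 x)%g.
Proof.
move=> Xx inx tL; have Ft := inner_Fset inx tL.
by rewrite (iter_act hc hs hT); have [] := act_crd hc hs hT (ltn0Sn n) Xx Ft.
Qed.

Lemma win_cyl m n B x (i t : nat) : (0 < m)%N -> (m <= n)%N -> B `<=` Fset r m ->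
  Xn n.+1 x -> inner r 1 n (crd n.+1 x) -> (t < 2 * at_ n)%N -> (i < wlen r n)%N ->
  cyl m B (iter (2 * at_ n * i + t) S x) <->
  lev B m n (red r n (shift R t%:Z * crd n.+1 x) * (sample_at r s n (crd n.+1 x) t i)^-1)%g.
Proof.
move=> m0 mn BF Xx inx tn iN; have n0 : (0 < n)%N by exact: leq_trans mn.
have tL : (2 * at_ n * i + t < 2 * at_ n * wlen r n)%N.
  apply: (@leq_trans (2 * at_ n * i.+1)); first by rewrite mulnS addnC ltn_add2r.
  by rewrite leq_mul2l iN orbT.
have [Xt ct] := win_crd Xx inx tL; have Ft := inner_Fset inx tL.
rewrite (cyl_lev hc hs m0 BF (leqW mn)) levS// /cyl /= ct.
have tE : (2 * at_ n * i + t)%N%:Z = 2 * (at_ n)%:Z * i%:Z + t%:Z by rewrite PoszD !PoszM.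
have bE : back r s n (shift R (2 * at_ n * i + t)%N%:Z * crd n.+1 x)%g =
    (red r n (shift R t%:Z * crd n.+1 x) * (sample_at r s n (crd n.+1 x) t i)^-1)%g.
  by rewrite /back tE red_shift tile_shift.
have h := upP hc (shift R (2 * at_ n * i + t)%N%:Z * crd n.+1 x)%g n0 (lev_sub hc m0 BF mn).
rewrite bE in h; split; first by move=> [_ /h[]].
by move=> lB; split => //; apply/h.
Qed.

Lemma dev_sum_window n A x : (0 < n)%N -> Xn n.+1 x -> inner r 1 n (crd n.+1 x) ->
  dev_sum n A x = \sum_(t < 2 * at_ n)
    (alpha n A (red r n (shift R t%:Z * crd n.+1 x)%g) - dens n A) ^+ 2.
Proof.
move=> n0 Xx inx; apply: eq_bigr => t _.
have tL : (t < 2 * at_ n * wlen r n)%N by rewrite (leq_trans (ltn_ord t))// leq_pmulr.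
have [Xt ct] := win_crd Xx inx tL.
by rewrite /devn ct indicE mem_set// mul1r.
Qed.

Lemma periodic_sum (g : nat -> R) p t : (forall i, g (p + i)%N = g i) ->
  \sum_(i < p) g (i + t)%N = \sum_(i < p) g i.
Proof.
move=> gp; elim: t => [|t <-]; first by apply: eq_bigr => i _; rewrite addn0.
case: p gp => [|p] gp; first by rewrite !big_ord0.
rewrite big_ord_recr [RHS]big_ord_recl/= addnS -addSn gp addrC; congr (_ + _).
by apply: eq_bigr => i _; rewrite /= addnS addSn.
Qed.

(** On a window the position in the tile has period [2 * at_ n], the number of terms of [dev_sum].
    Badness is thus a property of the whole window, and detecting it at one time gives it at the
    start. *)
Lemma dev_sum_shift n A x (t : nat) : (0 < n)%N -> Xn n.+1 x -> inner r 1 n (crd n.+1 x) ->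
  (t < 2 * at_ n * wlen r n)%N -> inner r 1 n (shift R t%:Z * crd n.+1 x)%g ->
  dev_sum n A (iter t S x) = dev_sum n A x.
Proof.
move=> n0 Xx inx tL int; have [Xt ct] := win_crd Xx inx tL.
rewrite dev_sum_window// ?ct// dev_sum_window//.
pose g (i : nat) := (alpha n A (red r n (shift R i%:Z * crd n.+1 x)%g) - dens n A) ^+ 2.
rewrite -(@periodic_sum g (2 * at_ n) t); last first.
  move=> i; rewrite /g; congr ((alpha n A _ - _) ^+ 2).
  by rewrite PoszD PoszM -(mulr1 (2 * (at_ n)%:Z)) red_shift.
by apply: eq_bigr => i _; rewrite /g mulgA shiftD PoszD.
Qed.

(** Termwise, [|f t| <= f t ^ 2 / (2 * eps) + eps / 2]. *)
Lemma amgm_sum (f : nat -> R) (eps : R) k : 0 < eps ->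
  \sum_(t < k) f t ^+ 2 <= eps ^+ 2 * k%:R -> \sum_(t < k) `|f t| <= eps * k%:R.
Proof.
move=> e0 H.
apply: le_trans (_ : \sum_(t < k) (f t ^+ 2 / (2 * eps) + eps / 2) <= _).
  apply: ler_sum => t _.
  have : 0 <= (`|f t| - eps) ^+ 2 by exact: sqr_ge0.
  rewrite -(real_normK (num_real (f t))); move: `|f t| => a h.
  have -> : a ^+ 2 / (2 * eps) + eps / 2 = (a ^+ 2 + eps ^+ 2) / (2 * eps) by field; rewrite gt_eqF.
  by rewrite ler_pdivlMr ?mulr_gt0//; nra.
rewrite big_split/= -mulr_suml sumr_const card_ord -(mulr_natr (eps / 2)).
have : (\sum_(t < k) f t ^+ 2) / (2 * eps) <= (eps ^+ 2 * k%:R) / (2 * eps).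
  by rewrite ler_pM2r// invr_gt0 mulr_gt0.
have -> : (eps ^+ 2 * k%:R) / (2 * eps) = eps / 2 * k%:R by field; rewrite gt_eqF.
by move: (_ / (2 * eps)) => b h; lra.
Qed.

Lemma kappa_avg_sub n (u : G -> R) (c : R) : (0 < n)%N ->
  \sum_(x <- D n) kappa R (D n) x * (u x - c) = \sum_(x <- D n) kappa R (D n) x * u x - c.
Proof.
move=> n0; under eq_bigr do rewrite mulrBr.
by rewrite sumrB -mulr_suml (sum_kappa hc)// mul1r.
Qed.

Lemma kappa_avg_prod n (u v : G -> R) :
  \sum_(x <- D n) \sum_(y <- D n) kappa R (D n) x * kappa R (D n) y * (u x * v y) =
  (\sum_(x <- D n) kappa R (D n) x * u x) * (\sum_(y <- D n) kappa R (D n) y * v y).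
Proof.
rewrite mulr_suml; apply: eq_bigr => x _; rewrite mulr_sumr; apply: eq_bigr => y _.
by ring.
Qed.

Lemma indic01 (Y : Type) (B : set Y) (y : Y) : 0 <= (\1_B y : R) <= 1.
Proof. by rewrite indicE; case: (_ \in _); rewrite ?lexx ler01. Qed.

Lemma kappa_avg01 n (v : G -> R) : (0 < n)%N -> (forall x : G, 0 <= v x <= 1) ->
  0 <= \sum_(x <- D n) kappa R (D n) x * v x <= 1.
Proof.
move=> n0 v01; apply/andP; split.
  by apply: sumr_ge0 => x _; rewrite mulr_ge0 ?kappa_ge0//; case/andP: (v01 x).
rewrite -(sum_kappa hc n0); apply: ler_sum => x _.
by rewrite ler_piMr ?kappa_ge0//; case/andP: (v01 x).
Qed.

Lemma dens_le1 n A : (0 < n)%N -> measurable A -> A `<=` Fset r n -> dens n A <= 1.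
Proof.
move=> n0 mA AF; have v0 : 0 < vol (box (at_ n)) by rewrite vol_box mulr_gt0// exprn_gt0// ltr0n atilde_gt0.
rewrite ler_pdivrMr// mul1r; have mb : measurable (box (at_ n) : set G) by exact: measurable_box.
have sb : A `<=` box (at_ n).
  by move=> g /AF; apply: box_sub; rewrite (atildeE r n0); lia.
exact: vol_le mA mb sb (@subset_refl _ _).
Qed.

Lemma dev_le1 n A (u : R) : (0 < n)%N -> measurable A -> A `<=` Fset r n ->
  0 <= u <= 1 -> `|u - dens n A| <= 1.
Proof.
move=> n0 mA AF u01; have := dens_le1 n0 mA AF; have := dens_ge0 n A.
by move: (dens n A) u01 => c /andP[h1 h2] h3 h4; rewrite ler_norml; apply/andP; split; lra.
Qed.

Lemma dev_single m n A0 x (eps : R) : (0 < m)%N -> (m <= n)%N -> measurable A0 ->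
  A0 `<=` Fset r m -> 0 < eps -> Xn n.+1 x -> inner r 1 n (crd n.+1 x) ->
  ~ bad n (lev A0 m n) eps x ->
  `|\sum_(t < 2 * at_ n * wlen r n) (\1_(cyl m A0) (iter t S x) - dens n (lev A0 m n))| <=
  (2 * at_ n * wlen r n)%N%:R * (eps + n%:R^-1).
Proof.
move=> m0 mn mA0 AF e0 Xx inx nbad; have n0 : (0 < n)%N by exact: leq_trans mn.
have mA := measurable_lev r s mA0 mn; have sA := lev_sub hc m0 AF mn.
rewrite (big_mul_iota (fun t => \1_(cyl m A0) (iter t S x) - dens n (lev A0 m n))).
pose F (t : nat) a := \1_(lev A0 m n) (red r n (shift R t%:Z * crd n.+1 x) * a^-1)%g - dens n (lev A0 m n).
have F1 t a : `|F t a| <= 1 by apply: dev_le1 => //; exact: indic01.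
rewrite (eq_bigr (fun t : 'I_(2 * at_ n) => \sum_(i < wlen r n) F t (sample_at r s n (crd n.+1 x) t i))); last first.
  move=> t _; apply: eq_bigr => i _; congr (_ - _); apply: indic_iff.
  exact: win_cyl m0 mn AF Xx inx (ltn_ord t) (ltn_ord i).
apply: le_trans (window_single hc n0 inx F1) _.
rewrite (_ : (2 * at_ n * wlen r n)%N%:R = (wlen r n)%:R * (2 * at_ n)%N%:R); last by rewrite natrM mulrC.
rewrite -mulrA ler_wpM2l// mulrDr lerD2r.
rewrite [leRHS]mulrC.
rewrite (eq_bigr (fun t : 'I_(2 * at_ n) => `|alpha n (lev A0 m n) (red r n (shift R t%:Z * crd n.+1 x)%g)
   - dens n (lev A0 m n)|)); last by move=> t _; rewrite kappa_avg_sub.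
apply: (amgm_sum (f := fun t : nat => alpha n (lev A0 m n) (red r n (shift R t%:Z * crd n.+1 x)%g)
   - dens n (lev A0 m n)) e0).
by rewrite -dev_sum_window// leNgt; apply/negP.
Qed.

(** For independent samples the average of the centred indicator of the first point times the
    indicator of the second factorizes, and the second factor is at most 1. Hence only the first
    point has to be good. *)
Lemma dev_pair m m' n A0 B0 x y (eps : R) : (0 < m)%N -> (m <= n)%N -> (0 < m')%N -> (m' <= n)%N ->
  measurable A0 -> A0 `<=` Fset r m -> B0 `<=` Fset r m' -> 0 < eps ->
  Xn n.+1 x -> inner r 1 n (crd n.+1 x) -> Xn n.+1 y -> inner r 1 n (crd n.+1 y) ->
  apart r n (crd n.+1 x) (crd n.+1 y) -> ~ bad n (lev A0 m n) eps x ->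
  `|\sum_(t < 2 * at_ n * wlen r n) (\1_(cyl m A0) (iter t S x) - dens n (lev A0 m n)) *
     \1_(cyl m' B0) (iter t S y)| <=
  (2 * at_ n * wlen r n)%N%:R * (eps + n%:R^-1) + (wlen r n)%:R * (gap r n)%:R.
Proof.
move=> m0 mn m0' mn' mA0 AF BF e0 Xx inx Xy iny ap nbad.
have n0 : (0 < n)%N by exact: leq_trans mn.
have mA := measurable_lev r s mA0 mn; have sA := lev_sub hc m0 AF mn.
rewrite (big_mul_iota (fun t => (\1_(cyl m A0) (iter t S x) - dens n (lev A0 m n)) *
   \1_(cyl m' B0) (iter t S y))).
pose u (t : nat) a := \1_(lev A0 m n) (red r n (shift R t%:Z * crd n.+1 x) * a^-1)%g - dens n (lev A0 m n).
pose v (t : nat) a : R := \1_(lev B0 m' n) (red r n (shift R t%:Z * crd n.+1 y) * a^-1)%g.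
have u1 t a : `|u t a| <= 1 by apply: dev_le1 => //; exact: indic01.
have v01 t a : 0 <= v t a <= 1 by exact: indic01.
have F1 t a b : `|u t a * v t b| <= 1.
  have /andP[v0 v1] := v01 t b.
  by rewrite normrM (ger0_norm v0) -[leRHS]mulr1 ler_pM.
rewrite (eq_bigr (fun t : 'I_(2 * at_ n) => \sum_(i < wlen r n)
    u t (sample_at r s n (crd n.+1 x) t i) * v t (sample_at r s n (crd n.+1 y) t i))); last first.
  move=> t _; apply: eq_bigr => i _; congr ((_ - _) * _); apply: indic_iff.
    exact: win_cyl m0 mn AF Xx inx (ltn_ord t) (ltn_ord i).
  exact: win_cyl m0' mn' BF Xy iny (ltn_ord t) (ltn_ord i).
apply: le_trans (window_pair hc (F := fun t a b => u t a * v t b) n0 inx iny ap F1) _.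
rewrite (_ : (2 * at_ n * wlen r n)%N%:R = (wlen r n)%:R * (2 * at_ n)%N%:R); last by rewrite natrM mulrC.
rewrite -[X in _ <= X + _]mulrA -mulrDr ler_wpM2l// lerD2r mulrDr lerD2r.
rewrite [leRHS]mulrC.
apply: le_trans (_ : \sum_(t < 2 * at_ n) `|alpha n (lev A0 m n) (red r n (shift R t%:Z * crd n.+1 x)%g)
   - dens n (lev A0 m n)| <= _).
  apply: ler_sum => t _; rewrite kappa_avg_prod normrM kappa_avg_sub// -/(alpha _ _ _).
  have /andP[k0 k1] := kappa_avg01 n0 (v01 t).
  by rewrite (ger0_norm k0) ler_piMr.
apply: (amgm_sum (f := fun t : nat => alpha n (lev A0 m n) (red r n (shift R t%:Z * crd n.+1 x)%g)
   - dens n (lev A0 m n)) e0).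
by rewrite -dev_sum_window// leNgt; apply/negP.
Qed.

End Good.

Section Probability.
Context {R : realType} {d : measure_display} {Y : measurableType d}.
Variable P : probability Y R.

Lemma prob_fine (A : set Y) : measurable A -> P A = (fine (P A))%:E.
Proof. by move=> mA; rewrite fineK ?fin_num_measure. Qed.

Lemma prob_le (A B : set Y) : measurable A -> measurable B -> A `<=` B -> fine (P A) <= fine (P B).
Proof.
move=> mA mB AB; rewrite -lee_fin -(prob_fine mA) -(prob_fine mB).
by apply: le_measure; rewrite ?inE.
Qed.

Lemma prob_ge0 (A : set Y) : 0 <= fine (P A).
Proof. by rewrite fine_ge0. Qed.

Lemma prob_sub (U A B : set Y) : measurable U -> measurable A -> measurable B ->
  U `<=` A `|` B -> fine (P U) <= fine (P A) + fine (P B).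
Proof.
move=> mU mA mB UAB; rewrite -lee_fin EFinD -(prob_fine mU) -(prob_fine mA) -(prob_fine mB).
apply: le_trans (measureU2 P mA mB); apply: le_measure; rewrite ?inE//.
exact: measurableU.
Qed.

Lemma prob_sub3 (U A B C : set Y) : measurable U -> measurable A -> measurable B -> measurable C ->
  U `<=` (A `|` B) `|` C -> fine (P U) <= fine (P A) + fine (P B) + fine (P C).
Proof.
move=> mU mA mB mC UABC; have mAB := measurableU _ _ mA mB.
apply: le_trans (prob_sub mU mAB mC UABC) _.
by rewrite lerD2r; exact: prob_sub.
Qed.

Lemma prob_setC (A : set Y) : measurable A -> fine (P (~` A)) = 1 - fine (P A).
Proof.
by move=> mA; rewrite probability_setC// {1}(prob_fine mA) -EFinB.
Qed.

Lemma prob_bound (A : set Y) (e : R) : measurable A -> (P A <= e%:E)%E -> fine (P A) <= e.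
Proof. by move=> mA h; rewrite -lee_fin -(prob_fine mA). Qed.

Lemma prob_ae_eq (A B : set Y) : measurable A -> measurable B ->
  {ae P, forall x, A x <-> B x} -> P A = P B.
Proof.
move=> mA mB [N [mN N0 sub]].
have half (U V : set Y) : measurable U -> measurable V -> U `\` V `<=` N -> fine (P U) <= fine (P V).
  have N0' : fine (P N) = 0 by rewrite N0.
  move=> mU mV UV; rewrite -[leRHS]addr0 -N0'; apply: prob_sub => //.
  by move=> x Ux; have [Vx|nVx] := pselect (V x); [left|right; apply: UV].
rewrite (prob_fine mA) (prob_fine mB); congr _%:E; apply/eqP; rewrite eq_le; apply/andP; split.
  by apply: half => // x [Ax nBx]; apply: sub => /= h; apply/nBx/h.
by apply: half => // x [Bx nAx]; apply: sub => /= h; apply/nAx/h.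
Qed.

Lemma indic_sum_le (I J : Type) (t : seq I) (u : seq J) (k : I -> R) (k' : J -> R)
    (U : I -> set Y) (U' : J -> set Y) :
  (forall i, 0 <= k i) -> (forall j, 0 <= k' j) ->
  (forall i, measurable (U i)) -> (forall j, measurable (U' j)) ->
  (forall x, \sum_(i <- t) k i * \1_(U i) x <= \sum_(j <- u) k' j * \1_(U' j) x) ->
  \sum_(i <- t) k i * fine (P (U i)) <= \sum_(j <- u) k' j * fine (P (U' j)).
Proof.
move=> k0 k0' mU mU' H.
have E (K : Type) (v : seq K) (a : K -> R) (V : K -> set Y) : (forall i, 0 <= a i) ->
    (forall i, measurable (V i)) ->
    (\int[P]_x (\sum_(i <- v) a i * \1_(V i) x)%:E = (\sum_(i <- v) a i * fine (P (V i)))%:E)%E.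
  move=> a0 mV; rewrite integral_sumR; last 2 first.
  - by move=> i; apply: measurable_funM => //; exact: measurable_indic.
  - by move=> i x; rewrite mulr_ge0// indicE.
  rewrite -sumEFin; apply: eq_bigr => i _; rewrite integral_indicZ//.
  by rewrite EFinM -prob_fine.
have mS (K : Type) (v : seq K) (a : K -> R) (V : K -> set Y) : (forall i, measurable (V i)) ->
    measurable_fun setT (fun x => (\sum_(i <- v) a i * \1_(V i) x)%:E).
  move=> mV; apply/measurable_EFinP; apply: measurable_sum => i.
  by apply: measurable_funM => //; exact: measurable_indic.
rewrite -lee_fin -!E//; apply: ge0_le_integral => //; try exact: mS.
- by move=> x _; rewrite lee_fin sumr_ge0// => i _; rewrite mulr_ge0// indicE.
- by move=> x _; rewrite lee_fin.
Qed.

End Probability.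

(** * Ergodicity *)

Section Growth.
Variables (R : realType) (r : nat -> nat) (xi : nat -> set (set (zrz2 R))).
Variables (D : nat -> {fset zrz2 R}) (s : nat -> int * int -> zrz2 R).
Hypothesis hc : cf_choices r xi D s.
Local Notation G := (zrz2 R).
Local Notation at_ := (atilde r).
Local Notation vol := (@vol R).
Context {d : measure_display} {X : measurableType d} {mu : probability X R}.
Variable iota : nat -> G * (nat -> G) -> X.
Hypothesis hs : cf_space r s mu iota.
Variable T : G -> X -> X.
Hypothesis hT : cf_action r s iota T.
Local Notation cyl := (@cyl R r s d X iota).
Local Notation crd := (@crd R r s d X iota).
Local Notation Xn := (@Xn R r s d X iota).
Local Notation rho := (@rho R r s d X mu iota).
Local Notation lev := (@lev R r s).
Local Notation S := (T ((1, 0), false)).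
Local Notation dens := (@dens R r).
Local Notation bad := (@bad R r D s d X iota T).
Implicit Types (f g w : G) (n m : nat) (h : int * int) (A B K : set G) (x y : X).

Lemma growth : exists N, (100 <= N)%N /\ forall n, (N <= n)%N -> (n ^ 4 <= r n)%N.
Proof.
have /cvgrPdist_lt/(_ 1 ltr01)[N _ HN] := cf_r_growth hc.
exists (maxn 100 N); split; first exact: leq_maxl.
move=> n; rewrite geq_max => /andP[_ /HN] /=.
have r0 : 0 < (r n)%:R :> R by rewrite ltr0n (cf_r_gt0 hc).
rewrite sub0r normrN ger0_norm ?divr_ge0 ?exprn_ge0// ltr_pdivrMr// mul1r -natrX ltr_nat.
exact: ltnW.
Qed.

Lemma growth2 n : (100 <= n)%N -> (n ^ 4 <= r n)%N ->
  [/\ (n ^ 3 <= r n)%N, (n ^ 2 <= r n)%N, (16 * n <= r n)%N & (n.+1 ^ 2 <= r n)%N].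
Proof.
move=> n100 rn; have p a b : (a <= b)%N -> (n ^ a <= n ^ b)%N by move=> ab; rewrite leq_exp2l//; lia.
have h3 := leq_trans (p 3 4 isT) rn; have h2 := leq_trans (p 2 4 isT) rn.
split => //; first by apply: leq_trans h2; rewrite -mulnn leq_mul2r; apply/orP; right; lia.
apply: leq_trans h3; rewrite !expnS !expn0 !muln1; nia.
Qed.

Lemma gap_le n : (100 <= n)%N -> (n ^ 4 <= r n)%N -> (n.+1 * gap r n.+1 <= 2 * at_ n.+1)%N.
Proof.
move=> n100 rn; have [_ _ _ h] := growth2 n100 rn.
rewrite /gap atildeS asizeS /=; move: h (atilde_gt0 r n) n100; rewrite -mulnn.
move: (r n) (at_ n) (bsize _ _) => q a b h a0 n100; clear -h a0.
have : (2 * (n.+1 * n.+1) * a <= 2 * q * a)%N by rewrite leq_mul2r leq_mul2l h !orbT.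
nia.
Qed.

Definition edge n : set X := [set x | Xn n.+1 x /\ ~ inner r 2 n (crd n.+1 x)].

Lemma measurable_inner k n : measurable [set f : G | inner r k n f].
Proof.
rewrite (_ : mkset _ = [set f : G | (`|col r n f.1.1| + k * wlen r n + 1 <= r n)%N] `&`
  [set f : G | (`|row r n (f.1.2 : R)| <= r n)%N]); last by apply/seteqP; split => f.
apply: measurableI.
  exact: (measurable_first (fun u => is_true (`|col r n u| + k * wlen r n + 1 <= r n)%N)).
rewrite (_ : mkset _ = [set f : G | - ((2 * r n + 1) * at_ n)%N%:R < (f.1.2 : R) <= ((2 * r n + 1) * at_ n)%N%:R]).
  apply: measurable_zrz2P => x e; rewrite /fiber /=.
  rewrite (_ : mkset _ = `]- ((2 * r n + 1) * at_ n)%N%:R, ((2 * r n + 1) * at_ n)%N%:R]%classic).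
    exact: measurable_itv.
  by apply/seteqP; split => a /=; rewrite in_itv.
apply/seteqP; split => f /= h.
  have /(Fset_tile r n) : Hset r n (tile r n (((0, f.1.2), false) : G)).
    apply/Hset_tileE0 => /=; split => //.
    by rewrite (@col_unique r n 0 0) ?mulr0 ?sub0r ?add0r//; have := atilde_gt0 r n; lia.
  by case.
have : Fset r n.+1 (((0, f.1.2), false) : G).
  split => //=; rewrite asizeS; have := atilde_gt0 r n; move: (at_ n) => a; clear; nia.
by move/Fset_tile/Hset_tileE0 => [].
Qed.

Lemma edge_cyl n : edge n = cyl n.+1 (Fset r n.+1 `\` [set f : G | inner r 2 n f]).
Proof.
apply/seteqP; split => x [Xx nx]; split => //; last by case: nx.
by split => //; exact: (crdF hs).
Qed.

Lemma slab_box (p : int) (k a : nat) : - (a + k)%N%:Z <= p <= a%:Z ->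
  slab p k (- a%:R) a%:R `<=` (box (a + k) : set G).
Proof.
move=> hp g [/= h1 /andP[h2 h3]]; split; first by clear -h1 hp; lia.
by rewrite natrD; have := ler0n R k; move: (k%:R) => kk k0; apply/andP; split; lra.
Qed.

Lemma wlen_edge n : (100 <= n)%N -> (n ^ 4 <= r n)%N ->
  (2 * (2 * wlen r n + 1) * n ^ 2 <= 6 * (2 * r n + 1))%N.
Proof.
move=> n100 rn; have [_ r2 _ _] := growth2 n100 rn; rewrite /wlen.
have := leq_trunc_div (r n) (n ^ 2); move: r2; move: (r n) (n ^ 2)%N (r n %/ n ^ 2)%N => a q z; clear; nia.
Qed.

(** About [2 * wlen r n] columns at each end of a row of [2 * r n + 1] tiles are excluded, and
    [wlen r n] is about [r n / n ^ 2]. The bound is summable, so almost every point is eventually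
    off the edges. *)
Lemma edge_le n : (100 <= n)%N -> (n ^ 4 <= r n)%N ->
  measurable (edge n) /\ (mu (edge n) <= (6 / n%:R ^+ 2)%:E)%E.
Proof.
move=> n100 rn; have [_ r2 _ _] := growth2 n100 rn.
have mF : measurable (Fset r n.+1 : set G) by exact: measurable_box.
have mE := measurableD mF (measurable_inner 2 n).
rewrite edge_cyl; split; first exact: (measurable_cyl hc hs).
rewrite (mu_cyl hc hs (ltn0Sn n) mE (@subDsetl _ _ _)) lee_fin.
pose a := asize r n.+1; pose k := ((2 * wlen r n + 1) * (2 * at_ n))%N.
pose s1 : set G := slab (- a%:Z) k (- a%:R) a%:R; pose s2 : set G := slab (a%:Z - k%:Z) k (- a%:R) a%:R.
have m1 : measurable s1 by exact: measurable_slab.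
have m2 : measurable s2 by exact: measurable_slab.
have aa : - a%:R <= a%:R :> R by rewrite (@le_trans _ _ 0)// oppr_le0.
have v1 : vol s1 = k%:R * (2 * a%:R) * 2 by rewrite /vol haar_slab//=; ring.
have v2 : vol s2 = k%:R * (2 * a%:R) * 2 by rewrite /vol haar_slab//=; ring.
have b1 : s1 `<=` box (a + k) by apply: slab_box; clear; lia.
have b2 : s2 `<=` box (a + k) by apply: slab_box; clear; lia.
have cov : Fset r n.+1 `\` [set f : G | inner r 2 n f] `<=` s1 `|` s2.
  move=> f [Ff nin]; have /Fset_tile/Hset_tileE0[t1 t2] := Ff.
  have [f1 f2] := Ff.
  have : ~ (`|col r n f.1.1| + 2 * wlen r n + 1 <= r n)%N by move=> h; apply: nin.
  have cp := colP r n f.1.1; have a0 := atilde_gt0 r n.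
  have aE : a = ((2 * r n + 1) * at_ n)%N by exact: asizeS.
  move=> /negP; rewrite -ltnNge => hcol.
  have [c0|c0] := lerP (col r n f.1.1) 0; [left|right]; split => //.
    move: f1 cp hcol; rewrite -/a /k aE.
    by move: (col r n f.1.1) (wlen r n) (at_ n) (r n) c0 a0; clear; nia.
  move: f1 cp hcol; rewrite -/a /k aE.
  by move: (col r n f.1.1) (wlen r n) (at_ n) (r n) c0 a0; clear; nia.
have hv := vol_subadd mE m1 m2 cov b1 b2.
have rho0 : 0 < rho n.+1 by exact: (rho_gt0 hc hs).
have r1 : rho n.+1 * vol (Fset r n.+1) <= 1.
  by rewrite -lee_fin -(mu_Xn hc hs (ltn0Sn n)) probability_le1//; exact: (measurable_Xn hc hs).
have hw := wlen_edge n100 rn; have a0 := atilde_gt0 r n.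
have aE : a%:R = (2 * r n + 1)%N%:R * (at_ n)%:R :> R by rewrite /a asizeS natrM.
have kE : k%:R = (2 * (2 * wlen r n + 1))%N%:R * (at_ n)%:R :> R by rewrite /k -natrM; congr (_%:R); ring.
rewrite v1 v2 in hv; rewrite vol_box -/a in r1; move: hv r1.
have w0 : 0 <= (2 * (2 * wlen r n + 1))%N%:R :> R by [].
have q0 : 0 < (2 * r n + 1)%N%:R :> R by rewrite ltr0n addn1.
have hwR : (2 * (2 * wlen r n + 1))%N%:R * n%:R ^+ 2 <= 6 * (2 * r n + 1)%N%:R :> R.
  by rewrite -natrX -!natrM ler_nat.
have t0 : 0 < (at_ n)%:R :> R by rewrite ltr0n.
have n0 : 0 < n%:R :> R by rewrite ltr0n; clear -n100; lia.
rewrite aE kE.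
move: (vol _) (rho n.+1) rho0 (_%:R) (2 * r n + 1)%N%:R (at_ n)%:R n%:R w0 q0 hwR t0 n0.
clear => v rh rh0 w q t N w0 q0 hwR t0 n0 hv r1.
apply: le_trans (ler_wpM2l (ltW rh0) hv) _.
rewrite ler_pdivlMr ?exprn_gt0//.
have -> : rh * (w * t * (2 * (q * t)) * 2 + w * t * (2 * (q * t)) * 2) * N ^+ 2 =
  (rh * (8 * t ^+ 2 * q)) * (w * N ^+ 2) by ring.
apply: le_trans (_ : rh * (8 * t ^+ 2 * q) * (6 * q) <= _).
  by rewrite ler_wpM2l// !mulr_ge0 ?sqr_ge0 ?ltW.
have -> : rh * (8 * t ^+ 2 * q) * (6 * q) = 6 * (rh * (8 * (q * t) ^+ 2)) by ring.
by rewrite ger_pMr.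
Qed.

Lemma bad_le m n (z : int) (p q : R) (e : bool) (eps : R) : (0 < m)%N -> (m < n)%N -> (100 <= n)%N ->
  (n ^ 4 <= r n)%N -> p < q -> intv z p q e `<=` Fset r m -> 0 < eps ->
  measurable (bad n.+1 (lev (intv z p q e) m n.+1) eps) /\
  (mu (bad n.+1 (lev (intv z p q e) m n.+1) eps) <= (20 / n.+1%:R / eps ^+ 2)%:E)%E.
Proof.
move=> m0 mn n100 rn pq AF e0; have [r3 _ _ _] := growth2 n100 rn.
have mI : measurable (intv z p q e) by exact: measurable_intv.
have mn1 : (m <= n.+1)%N by rewrite ltnW// ltnS ltnW.
have mA := measurable_lev r s mI mn1; have sA := lev_sub hc m0 AF mn1.
apply: (mu_bad hc hs hT (ltn0Sn n) mA sA e0).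
apply: (integral_devn hc hs (ltn0Sn n) mA sA); first by rewrite divr_ge0.
exact: (variance_lev hc m0 mn n100 r3 pq AF erefl).
Qed.

Lemma dens_cyl m n A0 : (0 < m)%N -> (m <= n)%N -> measurable A0 -> A0 `<=` Fset r m ->
  fine (mu (cyl m A0)) = dens n (lev A0 m n) * fine (mu (Xn n.+1)).
Proof.
move=> m0 mn mA AF; have n0 : (0 < n)%N by exact: leq_trans mn.
rewrite (cyl_lev hc hs m0 AF mn) (rho_box hc hs n0).
rewrite (mu_cyl hc hs n0 (measurable_lev r s mA mn) (lev_sub hc m0 AF mn)) /=.
have v0 : 0 < vol (box (at_ n)) by rewrite vol_box mulr_gt0// exprn_gt0// ltr0n atilde_gt0.
by rewrite /dens; field; rewrite gt_eqF.
Qed.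

Lemma fine_le1 (B : set X) : measurable B -> 0 <= fine (mu B) <= 1.
Proof.
move=> mB; rewrite fine_ge0//= -lee_fin fineK ?fin_num_measure//.
exact: probability_le1.
Qed.

(** The density is the conditional measure given [X_(n+1)], whose mass tends to 1. *)
Lemma dens_near m n A0 : (0 < m)%N -> (m <= n)%N -> measurable A0 -> A0 `<=` Fset r m ->
  `|dens n (lev A0 m n) - fine (mu (cyl m A0))| <= 1 - fine (mu (Xn n.+1)).
Proof.
move=> m0 mn mA AF; have n0 : (0 < n)%N by exact: leq_trans mn.
have d0 := dens_ge0 r n (lev A0 m n).
have d1 := dens_le1 n0 (measurable_lev r s mA mn) (lev_sub hc m0 AF mn).
have /andP[x0 x1] := fine_le1 (measurable_Xn hc hs (ltn0Sn n)).
rewrite (dens_cyl m0 mn mA AF); move: (dens n _) (fine _) d0 d1 x0 x1 => c u d0 d1 x0 x1.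
have -> : c - c * u = c * (1 - u) by ring.
rewrite ger0_norm; first by rewrite ler_piMl//; lra.
by rewrite mulr_ge0//; lra.
Qed.

Lemma small_eventually (eps : R) : 0 < eps -> exists N, (101 <= N)%N /\ forall n, (N <= n)%N ->
  [/\ (n.-1 ^ 4 <= r n.-1)%N, (n ^ 4 <= r n)%N, n%:R^-1 <= eps &
    1 - eps <= fine (mu (Xn n.+1))].
Proof.
move=> e0; have [N1 [N100 H1]] := growth; have [N2 H2] := mu_Xn_cvg hc hs e0.
exists (maxn N1 (maxn N2 (Num.truncn eps^-1))).+1; split.
  by rewrite ltnS (leq_trans N100)// leq_maxl.
move=> n; rewrite -!maxnSS !geq_max => /andP[h1 /andP[h2 h3]]; split.
- by apply: H1; lia.
- by apply: H1; lia.
- rewrite -[leRHS]invrK lef_pV2 ?posrE ?invr_gt0// ?ltr0n; last by lia.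
  by apply: ltW; apply: lt_le_trans (truncnS_gt _) _; rewrite ler_nat.
- by apply: H2; lia.
Qed.

Definition good m A0 n (eps : R) : set X :=
  Xn n.+1 `&` ~` edge n `&` ~` bad n (lev A0 m n) eps.

Lemma good_large m (z : int) (p q : R) (e : bool) (eps dl : R) : (0 < m)%N -> p < q -> intv z p q e `<=` Fset r m ->
  0 < eps -> 0 < dl -> exists N, (101 <= N)%N /\ forall n, (N <= n)%N -> [/\ (m <= n)%N, n%:R^-1 <= dl,
    `|dens n (lev (intv z p q e) m n) - fine (mu (cyl m (intv z p q e)))| <= dl,
    measurable (good m (intv z p q e) n eps) &
    fine (mu (~` good m (intv z p q e) n eps)) <= dl].
Proof.
move=> m0 pq AF e0 d0.
(* A third of [dl] for each of the three exceptional sets; the second entry brings the bound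
   [20 / n / eps ^ 2] on the bad set down to [dl / 3]. *)
pose d1 := Num.min (dl / 3) (dl * eps ^+ 2 / 60).
have d10 : 0 < d1 by rewrite lt_min !divr_gt0 ?mulr_gt0 ?exprn_gt0.
have d1a : d1 <= dl / 3 by rewrite ge_min lexx.
have d1b : d1 <= dl * eps ^+ 2 / 60 by rewrite ge_min lexx orbT.
have [N [N101 HN]] := small_eventually d10.
exists (maxn N m.+2); split; first by rewrite (leq_trans N101)// leq_maxl.
move=> n; rewrite geq_max => /andP[Nn mn]; have [r4' r4 nd X1] := HN n Nn.
have mI : measurable (intv z p q e) by exact: measurable_intv.
have nE : n = n.-1.+1 by rewrite prednK//; lia.
have mn' : (m <= n)%N by lia.
have n100 : (100 <= n)%N by lia.
have n0 : 0 < n%:R :> R by rewrite ltr0n; clear -n100; lia.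
have n18 : 18 <= n%:R :> R by rewrite ler_nat; clear -n100; lia.
have [mB Bd] : measurable (bad n (lev (intv z p q e) m n) eps) /\
  (mu (bad n (lev (intv z p q e) m n) eps) <= (20 / n%:R / eps ^+ 2)%:E)%E.
  have h1 : (m < n.-1)%N by clear -mn; lia.
  have h2 : (100 <= n.-1)%N by clear -Nn N101; lia.
  by rewrite nE; exact: bad_le.
have [mE Ed] := edge_le n100 r4.
have mX := measurable_Xn hc hs (ltn0Sn n).
have mG : measurable (good m (intv z p q e) n eps).
  by apply: measurableI; [apply: measurableI => //|]; exact: measurableC.
split => //; first by lra.
- by apply: le_trans (dens_near m0 mn' mI AF) _; lra.
have sub : ~` good m (intv z p q e) n eps `<=` (~` Xn n.+1 `|` edge n) `|` bad n (lev (intv z p q e) m n) eps.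
  move=> y ng; have [By|nBy] := pselect (bad n (lev (intv z p q e) m n) eps y); first by right.
  have [Ey|nEy] := pselect (edge n y); first by left; right.
  by left; left => Xy; apply: ng.
apply: le_trans (prob_sub3 mu (measurableC mG) (measurableC mX) mE mB sub) _.
rewrite (prob_setC mu mX); have {}Ed := prob_bound mE Ed; have {}Bd := prob_bound mB Bd.
have z0 : 0 < n%:R^-1 :> R by rewrite invr_gt0.
have k1 : 6 / n%:R ^+ 2 <= d1.
  apply: le_trans nd; rewrite expr2 invfM mulrA -ler_pdivlMr// mulfV ?gt_eqF//.
  by rewrite ler_pdivrMr//; lra.
have k2 : 20 / n%:R / eps ^+ 2 <= dl / 3.
  rewrite ler_pdivrMr ?exprn_gt0//; move: nd d1b; move: (n%:R^-1) => zz; lra.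
lra.
Qed.

Lemma good_dev m (z : int) (p q : R) (e : bool) n (eps : R) y : (0 < m)%N -> (m <= n)%N -> p < q ->
  intv z p q e `<=` Fset r m -> 0 < eps -> good m (intv z p q e) n eps y ->
  `|visits S (cyl m (intv z p q e)) (2 * at_ n * wlen r n) y -
    dens n (lev (intv z p q e) m n) * (2 * at_ n * wlen r n)%N%:R| <=
  (eps + n%:R^-1) * (2 * at_ n * wlen r n)%N%:R.
Proof.
move=> m0 mn pq AF e0 [[Xy ne] nb].
have inn : inner r 1 n (crd n.+1 y).
  have [h1 h2] : inner r 2 n (crd n.+1 y) by apply: contrapT => h; apply: ne.
  by split => //; clear -h1; lia.
have mI : measurable (intv z p q e) by exact: measurable_intv.
have := dev_single hc hs hT m0 mn mI AF e0 Xy inn nb.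
by rewrite sumrB sumr_const card_ord -(mulr_natr (dens _ _)) [leRHS]mulrC.
Qed.

Let pS := act_preserving hc hs hT ((1, 0), false).

Lemma measure_invariant (E A : set X) t : measurable E -> measurable A ->
  {ae mu, forall x, E x <-> E (S x)} -> mu (E `&` iter t S @^-1` A) = mu (E `&` A).
Proof.
move=> mE mA invE; elim: t => [//|t <-].
have mI : measurable (iter t S @^-1` A) by exact: (measurable_preimageT (measurable_iter pS t) mA).
have mS := pS.1.
rewrite -(pS.2 _ (measurableI _ _ mE mI)).
apply: prob_ae_eq.
- by apply: measurableI => //; exact: (measurable_preimageT (measurable_iter pS t.+1) mA).
- exact: (measurable_preimageT mS (measurableI _ _ mE mI)).
apply: filterS invE => x invx /=; rewrite -iterSr iterS.
by split => -[Ex Ax]; split => //; apply/invx.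
Qed.

Lemma squeeze_eq (a b : R) : (forall dl, 0 < dl -> `|a - b| <= 4 * dl) -> a = b.
Proof.
move=> H; apply/eqP; rewrite -subr_eq0 -normr_le0 leNgt; apply/negP => h.
have := H (`|a - b| / 8); rewrite divr_gt0// => /(_ isT); lra.
Qed.

(** Moving the cylinder along the orbit does not change the measure of its intersection with [E].
    Averaging over a window therefore replaces its indicator by its visit frequency, which is nearly
    constant on good points. *)
Lemma invariant_intv (E : set X) m (z : int) (p q : R) (e : bool) : measurable E ->
  {ae mu, forall x, E x <-> E (S x)} -> (0 < m)%N -> p < q -> intv z p q e `<=` Fset r m ->
  fine (mu (E `&` cyl m (intv z p q e))) = fine (mu (cyl m (intv z p q e))) * fine (mu E).
Proof.
move=> mE invE m0 pq AF; set A := cyl m _.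
have AE : cyl m (intv z p q e) = A by [].
have mI : measurable (intv z p q e) by exact: measurable_intv.
have mA : measurable A by exact: (measurable_cyl hc hs).
apply: squeeze_eq => dl d0.
have [N [N101 HN]] := good_large m0 pq AF d0 d0.
have [mN nd dd mG Gd] := HN N (leqnn N); rewrite AE in dd.
have mGC := measurableC mG.
set Y := good m (intv z p q e) N dl in mG Gd mGC *.
pose L := (2 * at_ N * wlen r N)%N.
have L0 : 0 < L%:R :> R by rewrite ltr0n /L !muln_gt0 atilde_gt0.
pose c := dens N (lev (intv z p q e) m N).
have c0 : 0 <= c by exact: dens_ge0.
have /andP[E0 E1] := fine_le1 mE.
have dev y : Y y -> `|visits S A L y - c * L%:R| <= (dl + N%:R^-1) * L%:R.
  exact: good_dev m0 mN pq AF d0.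
have mIt t : measurable (E `&` iter t S @^-1` A).
  by apply: measurableI => //; exact: (measurable_preimageT (measurable_iter pS t) mA).
have sumE : \sum_(t <- seq.iota 0 L) 1 * fine (mu (E `&` iter t S @^-1` A)) = L%:R * fine (mu (E `&` A)).
  under eq_bigr do rewrite mul1r measure_invariant//.
  by rewrite big_const_seq count_predT size_iota iter_addr_0 -(mulr_natl (fine _)).
have visE y : \sum_(t <- seq.iota 0 L) 1 * \1_(E `&` iter t S @^-1` A) y = \1_E y * visits S A L y :> R.
  rewrite /visits -(big_mkord xpredT (fun t => \1_A (iter t S y))) /index_iota subn0 mulr_sumr.
  by apply: eq_bigr => t _; rewrite mul1r indicI.
have up : L%:R * fine (mu (E `&` A)) <= (c + (dl + N%:R^-1)) * L%:R * fine (mu E) + L%:R * fine (mu (~` Y)).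
  have := @indic_sum_le _ _ _ mu _ _ (seq.iota 0 L) [:: true; false] (fun=> 1)
    (fun b => if b then (c + (dl + N%:R^-1)) * L%:R else L%:R)
    (fun t => E `&` iter t S @^-1` A) (fun b => if b then E else ~` Y).
  rewrite sumE !big_cons big_nil addr0; apply.
  - by [].
  - by case => //; rewrite mulr_ge0// addr_ge0// addr_ge0// ltW.
  - exact: mIt.
  - by case.
  move=> y; rewrite visE !big_cons big_nil addr0.
  have [Yy|nYy] := pselect (Y y).
    have := dev y Yy; rewrite ler_norml => /andP[_ h].
    rewrite [X in _ + _ * X]indicE memNset ?mulr0 ?addr0; last by move=> /(_ Yy).
    by rewrite mulrC ler_wpM2r ?indicE//; lra.
  rewrite [X in _ + _ * X]indicE mem_set// mulr1.
  have v1 := visits_le S A L y (R := R); have v0 := visits_ge0 S A L y (R := R).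
  apply: (@le_trans _ _ L%:R).
    by apply: le_trans v1; rewrite ler_piMl// indicE; case: (_ \in _); rewrite ?lexx.
  rewrite lerDr; apply: mulr_ge0; last by rewrite indicE.
  by rewrite mulr_ge0 ?(ltW L0)// addr_ge0// addr_ge0 ?(ltW d0)// invr_ge0.
have low : c * L%:R * fine (mu E) <= L%:R * fine (mu (E `&` A)) + ((dl + N%:R^-1) * L%:R * fine (mu E) + L%:R * fine (mu (~` Y))).
  (* The sum type lets a single list index the [L] terms of the visits and the two error terms, as
     [indic_sum_le] expects. *)
  pose us : seq (nat + bool) := [seq inl t | t <- seq.iota 0 L] ++ [:: inr true; inr false].
  pose kk (j : nat + bool) : R :=
    match j with inl _ => 1 | inr b => if b then (dl + N%:R^-1) * L%:R else L%:R end.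
  pose UU (j : nat + bool) : set X :=
    match j with inl t => E `&` iter t S @^-1` A | inr b => if b then E else ~` Y end.
  have K : \sum_(i <- [:: tt]) c * L%:R * fine (mu E) <= \sum_(j <- us) kk j * fine (mu (UU j)).
    apply: (@indic_sum_le _ _ _ mu _ _ [:: tt] us (fun=> c * L%:R) kk (fun=> E) UU).
    - by move=> _; rewrite mulr_ge0// ltW.
    - by case=> [t|[]] //; rewrite /kk mulr_ge0 ?addr_ge0 ?(ltW d0)// invr_ge0.
    - by [].
    - by case=> [t|[]]; [exact: mIt|exact: mE|exact: mGC].
    move=> y; rewrite /us big_seq1 big_cat/= big_map !big_cons !big_nil !addr0 /kk /UU visE.
    have v0 := visits_ge0 S A L y (R := R).
    have [Yy|nYy] := pselect (Y y).
      have := dev y Yy; rewrite ler_norml => /andP[h _].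
      rewrite [X in _ + (_ + _ * X)]indicE memNset ?mulr0 ?addr0; last by move=> /(_ Yy).
      by rewrite ![_ * \1_E y]mulrC -mulrDr ler_wpM2l ?indicE//; lra.
    rewrite [X in _ <= _ + (_ + _ * X)]indicE mem_set// mulr1.
    have c1 : c <= 1.
      by apply: dens_le1; [exact: leq_trans mN|exact: measurable_lev|exact: (lev_sub hc)].
    apply: (@le_trans _ _ L%:R).
      have [i0 i1] : 0 <= (\1_E y : R) /\ (\1_E y : R) <= 1.
        by rewrite indicE; case: (_ \in _); rewrite ?lexx ler01.
      rewrite -mulrA mulrCA; apply: ler_piMr; first exact: ltW.
      exact: mulr_ile1.
    rewrite addrA lerDr; apply: addr_ge0; apply: mulr_ge0 => //; rewrite ?indicE//.
    by rewrite mulr_ge0 ?(ltW L0)// addr_ge0 ?(ltW d0)// invr_ge0.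
  by move: K; rewrite /us big_seq1 big_cat/= big_map !big_cons !big_nil !addr0 /kk /UU sumE.
rewrite -mulrA mulrCA in low.
have low' : c * fine (mu E) <= fine (mu (E `&` A)) + ((dl + N%:R^-1) * fine (mu E) + fine (mu (~` Y))).
  rewrite -(ler_pM2l L0); apply: le_trans low _.
  by rewrite le_eqVlt; apply/orP; left; apply/eqP; ring.
have up' : fine (mu (E `&` A)) <= (c + (dl + N%:R^-1)) * fine (mu E) + fine (mu (~` Y)).
  rewrite -(ler_pM2l L0); apply: le_trans up _.
  by rewrite le_eqVlt; apply/orP; left; apply/eqP; ring.
rewrite -/c in dd; clear dev up low sumE visE mIt AE.
move: low' up' dd Gd nd E0 E1 c0.
have n0 : 0 <= N%:R^-1 :> R by rewrite invr_ge0.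
move: (fine (mu (E `&` A))) (fine (mu A)) (fine (mu E)) (fine (mu (~` Y))) (N%:R^-1) c n0.
clear -d0 => a al u g zz b z0 h1 h2 /ler_normlP[h3 h4] h5 h6 h7 h8 h9.
have zu : (dl + zz) * u <= 2 * dl.
  by apply: le_trans (ler_piMr _ h8) _; lra.
have k1 : (b - al) * u <= dl.
  have [|] := lerP 0 (b - al) => k; first by apply: le_trans (ler_piMr k h8) _; lra.
  by apply: le_trans (mulr_le0_ge0 (ltW k) h7) _; exact: ltW.
have k2 : (al - b) * u <= dl.
  have [|] := lerP 0 (al - b) => k; first by apply: le_trans (ler_piMr k h8) _; lra.
  by apply: le_trans (mulr_le0_ge0 (ltW k) h7) _; exact: ltW.
rewrite !mulrBl in k1 k2; rewrite mulrDl in h2.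
rewrite ler_norml; apply/andP; split; lra.
Qed.

(** [E] is independent of the cylinders over intervals, hence of all measurable sets and of itself.
    Invariance is required almost everywhere only, because [centralizer_act] applies this to sets
    defined through a map that commutes with [S] almost everywhere. *)
Lemma invariant_trivial (E : set X) : measurable E ->
  {ae mu, forall x, E x <-> E (S x)} -> mu E = 0%E \/ mu E = 1%E.
Proof.
move=> mE invE.
have key F : measurable F -> mu (E `&` F) = (mu E * mu F)%E.
  move=> mF; rewrite setIC.
  have ge0E : 0 <= fine (mu E) by exact: prob_ge0.
  pose m2 := mscale (NngNum ge0E) mu.
  have h := @measure_eq_cyl_intv R r xi D s hc d X mu iota hs (mrestr mu mE) m2.
  have hF : mrestr mu mE F = m2 F.
    have fT : (mu ([set: X] `&` E) < +oo)%E by rewrite setTI (prob_fine mu mE) ltry.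
    apply: (h fT _ F mF).
    move=> n x p q e n0 pq AF; have mI : measurable (intv x p q e) by exact: measurable_intv.
    have mc := measurable_cyl hc hs n0 mI.
    have e1 : mu (cyl n (intv x p q e) `&` E) = ((fine (mu E))%:E * mu (cyl n (intv x p q e)))%E.
      rewrite setIC (prob_fine mu (measurableI _ _ mE mc)) invariant_intv//.
      by rewrite (prob_fine mu mc) -EFinM mulrC.
    exact: e1.
  apply: etrans hF _; rewrite /m2 /mscale /=.
  by rewrite [in RHS](prob_fine mu mE).
have := key E mE; rewrite setIid (prob_fine mu mE) -EFinM => -[h].
have [->|h0] := eqVneq (fine (mu E)) 0; first by left.
by right; congr _%:E; apply: (mulfI h0); rewrite -h mulr1.
Qed.

Lemma S_ergodic : ergodic mu S.
Proof.
move=> A mA SA; apply: invariant_trivial => //; apply: aeW => x.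
by rewrite -{1}SA.
Qed.

End Growth.

(** * Joinings *)

Section BorelCantelli.
Context {R : realType} {d : measure_display} {Y : measurableType d}.
Variable P : probability Y R.

(** The telescoping form of the hypothesis bounds the partial sums by [u N] at once. *)
Lemma borel_cantelli (F : nat -> set Y) (u : nat -> R) (N : nat) :
  (forall n, measurable (F n)) -> (forall n, 0 <= u n) ->
  (forall n, (N <= n)%N -> fine (P (F n)) <= u n - u n.+1) ->
  {ae P, forall x, exists K, forall n, (K <= n)%N -> ~ F n x}.
Proof.
move=> mF u0 H; pose F' n := if (N <= n)%N then F n else set0.
have mF' n : measurable (F' n) by rewrite /F'; case: ifP.
have part M : \sum_(0 <= i < M) fine (P (F' i)) <= u N - u (maxn N M).
  elim: M => [|M IH]; first by rewrite big_geq// maxn0 subrr.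
  rewrite big_nat_recr//= {2}/F'; have [NM|MN] := leqP N M.
    move: IH; rewrite (maxn_idPr NM) (maxn_idPr (leqW NM)) => IH.
    by have := H M NM; lra.
  by rewrite measure0 addr0; move: IH; rewrite (maxn_idPl (ltnW MN)) (maxn_idPl MN).
have fin : (\sum_(n <oo) P (F' n) < +oo)%E.
  apply: (@le_lt_trans _ _ (u N)%:E); last exact: ltry.
  apply: lime_le; first by apply: is_cvg_nneseries => n _ _.
  apply: nearW => M /=; rewrite (eq_bigr (fun i => (fine (P (F' i)))%:E)); last first.
    by move=> i _; rewrite -prob_fine.
  rewrite sumEFin lee_fin; apply: le_trans (part M) _.
  by have := u0 (maxn N M); lra.
have z := lim_sup_set_cvg0 mF' fin.
exists (lim_sup_set F'); split => //.
  by apply: bigcap_measurable => // k _; apply: bigcup_measurable => i _.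
move=> x /= nx k _; apply: contrapT => nF; apply: nx; exists (maxn k N) => n.
rewrite geq_max => /andP[kn Nn] Fx; apply: nF; exists n => //.
by rewrite /F' Nn.
Qed.

Lemma prob0_le (A : set Y) : measurable A -> (forall e : R, 0 < e -> fine (P A) <= e) -> P A = 0%E.
Proof.
move=> mA H; rewrite (prob_fine P mA); congr _%:E; apply/eqP; rewrite eq_le prob_ge0 andbT.
by apply/ler_addgt0Pr => e e0; rewrite add0r; exact: H.
Qed.

End BorelCantelli.

Section Pairs.
Variables (R : realType) (r : nat -> nat) (xi : nat -> set (set (zrz2 R))).
Variables (D : nat -> {fset zrz2 R}) (s : nat -> int * int -> zrz2 R).
Hypothesis hc : cf_choices r xi D s.
Local Notation G := (zrz2 R).
Local Notation at_ := (atilde r).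
Local Notation vol := (@vol R).
Context {d : measure_display} {X : measurableType d} {mu : probability X R}.
Variable iota : nat -> G * (nat -> G) -> X.
Hypothesis hs : cf_space r s mu iota.
Variable T : G -> X -> X.
Hypothesis hT : cf_action r s iota T.
Local Notation cyl := (@cyl R r s d X iota).
Local Notation crd := (@crd R r s d X iota).
Local Notation pt := (@pt R r s d X iota).
Local Notation Xn := (@Xn R r s d X iota).
Local Notation lev := (@lev R r s).
Local Notation S := (T ((1, 0), false)).
Local Notation dens := (@dens R r).
Local Notation bad := (@bad R r D s d X iota T).
Local Notation edge := (@edge R r s d X iota).
Implicit Types (f g w : G) (n m : nat) (h : int * int) (A B K : set G) (x y : X).

Lemma pt_tail n x i : (0 < n)%N -> Xn n x ->
  (pt n x).2 i = cmap r s (n + i) (tile r (n + i) (crd (n + i).+1 x)).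
Proof.
elim: i n => [|i IH] n n0 Xx; have [X1 E] := pt_embed hc hs n0 Xx.
  rewrite addn0 /crd E /=; have [[Ff /(_ 0%N)]] := ptP hs n0 Xx.
  rewrite addn0 => -[h Hh Eh] _; rewrite -Eh.
  by have [-> _ _] := cmap_tile hc n0 Ff Hh.
by rewrite addnS -addSn -IH// E.
Qed.

(** By [pt_tail] the tiles determine the tails, so the two points differ only in their coordinate in
    [F_n]. *)
Lemma same_tiles n x y : (0 < n)%N -> Xn n x -> Xn n y ->
  (forall k, (n <= k)%N -> tile r k (crd k.+1 x) = tile r k (crd k.+1 y)) ->
  y = T (crd n y * (crd n x)^-1)%g x.
Proof.
move=> n0 Xx Xy H; have F : Fset r n (crd n y * (crd n x)^-1 * crd n x)%g.
  by rewrite mulgVK; exact: (crdF hs).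
have [X1 c1 t1] := act_crd hc hs hT n0 Xx F.
apply: (point_eq hs n0 Xy X1); first by rewrite c1 mulgVK.
by rewrite t1; apply/funext => i; rewrite !pt_tail// H// leq_addr.
Qed.

(** Not being apart at level [n - 1] puts the coordinates of level [n] within [2 * at_ n.-1], and
    two samples differ by at most [2 * bsize r n]. So the distance at level [n + 1] is that of the
    centres of the tiles up to [gap r n]; being less than [2 * at_ n - gap r n], it forces the same
    column. *)
Lemma apart_tile n x y : (0 < n)%N -> Xn n x -> Xn n y ->
  ~ apart r n.-1 (crd n x) (crd n y) -> ~ apart r n (crd n.+1 x) (crd n.+1 y) ->
  tile r n (crd n.+1 x) = tile r n (crd n.+1 y).
Proof.
move=> n0 Xx Xy na1 na2.
have [h Hh Ex] := crdS hc hs n0 Xx; have [h' Hh' Ey] := crdS hc hs n0 Xy.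
have [tx _ _] := cmap_tile hc n0 (crdF hs n0 Xx) Hh.
have [ty _ _] := cmap_tile hc n0 (crdF hs n0 Xy) Hh'.
have rows : (tile r n (crd n.+1 x)).2 = (tile r n (crd n.+1 y)).2.
  by apply: contrapT => ne; apply: na2; left.
rewrite Ex Ey tx ty in rows *.
have /negP c1 : ~ (2 * at_ n <= `|((crd n.+1 x).1.1 - (crd n.+1 y).1.1)%R| + gap r n)%N.
  by move=> hh; apply: na2; right.
have /negP c2 : ~ (2 * at_ n.-1 <= `|((crd n x).1.1 - (crd n y).1.1)%R| + gap r n.-1)%N.
  by move=> hh; apply: na1; right.
suff h1 : h.1 = h'.1 by case: h h' h1 rows {Hh Ex tx Hh' Ey ty c1} => [a b] [a' b'] /= -> ->.
have [s1 _] := D_Sset hc n0 (s_in_D hc n0 Hh); have [s2 _] := D_Sset hc n0 (s_in_D hc n0 Hh').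
have b0 : (bsize r n <= (2 * n - 1) * at_ n.-1)%N by rewrite /bsize; apply: leq_mul => //; clear; lia.
have b1 : (2 * bsize r n + 2 * at_ n.-1 <= gap r n)%N.
  by rewrite /gap; move: b0; move: (at_ n.-1) (bsize r n) => a b; clear -n0; nia.
have Fx : (crd n.+1 x).1.1 = (crd n x).1.1 + ((s n h).1.1 + 2 * h.1 * (at_ n)%:Z) by rewrite Ex.
have Fy : (crd n.+1 y).1.1 = (crd n y).1.1 + ((s n h').1.1 + 2 * h'.1 * (at_ n)%:Z) by rewrite Ey.
move: c1 c2; rewrite Fx Fy; clear -s1 s2 b1.
move: ((crd n x).1.1) ((crd n y).1.1) ((s n h).1.1) ((s n h').1.1) h.1 h'.1 (at_ n) (at_ n.-1) (gap r n)
  (gap r n.-1) (bsize r n) s1 s2 b1 => u v a b i j q q' k k' bb s1 s2 b1 c1 c2.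
nia.
Qed.

Lemma eventually_tiles x y (K : nat) : (0 < K)%N -> (forall n, (K <= n)%N -> Xn n x /\ Xn n y) ->
  (forall n, (K <= n)%N -> ~ apart r n (crd n.+1 x) (crd n.+1 y)) ->
  exists g, y = T g x.
Proof.
move=> K0 KX Kap; have [X1 X2] := KX K.+1 (leqnSn _).
exists (crd K.+1 y * (crd K.+1 x)^-1)%g; apply: same_tiles => // k Kk.
have [Xx Xy] := KX k (ltnW Kk).
apply: apart_tile => //; first exact: leq_trans Kk.
  by case: k Kk Xx Xy => // k Kk _ _; exact: Kap.
by apply: Kap; exact: ltnW.
Qed.

Lemma act_free g g' x : T g x = T g' x -> g = g'.
Proof.
have [n0 n00 H] := Fset_mul_large hc hs g; have [n1 n10 H1] := Fset_mul_large hc hs g'.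
have [m m0 Xx] := Xn_cover hs x; move=> E.
pose N := maxn (maxn n0 n1) m.
have XN : Xn N x by apply: (Xn_mono hc hs m0) Xx; exact: leq_maxr.
have XN1 : Xn N.+1 x.
  by apply: (Xn_mono hc hs m0) Xx; rewrite (leq_trans (leq_maxr (maxn n0 n1) m)).
have F1 : Fset r N.+1 (g * crd N.+1 x)%g.
  by apply: H XN; rewrite (leq_trans (leq_maxl n0 n1))// leq_maxl.
have F2 : Fset r N.+1 (g' * crd N.+1 x)%g.
  by apply: H1 XN; rewrite (leq_trans (leq_maxr n0 n1))// leq_maxl.
have [_ c1 _] := act_crd hc hs hT (ltn0Sn N) XN1 F1.
have [_ c2 _] := act_crd hc hs hT (ltn0Sn N) XN1 F2.
by apply: (mulIg (crd N.+1 x)); rewrite -c1 -c2 E.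
Qed.

Definition apartX n : set (X * X) := [set p | apart r n (crd n.+1 p.1) (crd n.+1 p.2)].

Definition sametile n : set (X * X) :=
  [set p | tile r n (crd n.+1 p.1) = tile r n (crd n.+1 p.2)].

Lemma measurable_tile n h : measurable [set f : G | tile r n f = h].
Proof.
have -> : [set f : G | tile r n f = h] = rtrans (box (at_ n)) (phi R r n (- h.1, - h.2))^-1%g.
  apply/seteqP; split => f /=.
    by move=> tf; apply/rtransP; rewrite invgK; apply/box_tile; rewrite tile_mul_phi tf /= !subrr.
  move=> /rtransP; rewrite invgK => /box_tile; rewrite tile_mul_phi => -[h1 h2].
  by move: h1 h2; case: h => a b /= h1 h2; rewrite /tile (subr0_eq h1) (subr0_eq h2).
apply: measurable_rtrans; exact: measurable_box.
Qed.

Lemma measurable_crd1 n (E : set G) : (0 < n)%N -> measurable E ->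
  measurable [set p : X * X | E (crd n p.1)].
Proof.
move=> n0 mE; have mc := measurable_crd hc hs n0.
exact: (measurable_preimageT (measurableT_comp mc (@measurable_fst _ _ X X)) mE).
Qed.

Lemma measurable_crd2 n (E : set G) : (0 < n)%N -> measurable E ->
  measurable [set p : X * X | E (crd n p.2)].
Proof.
move=> n0 mE; have mc := measurable_crd hc hs n0.
exact: (measurable_preimageT (measurableT_comp mc (@measurable_snd _ _ X X)) mE).
Qed.

Lemma measurable_sametile n : measurable (sametile n).
Proof.
rewrite (_ : sametile n = \bigcup_(h : int * int)
   ([set p : X * X | tile r n (crd n.+1 p.1) = h] `&` [set p | tile r n (crd n.+1 p.2) = h])).
  apply: countable_bigcupT_measurable => [|h]; first exact: countableP.
  by apply: measurableI; [apply: (measurable_crd1 (E := [set f | tile r n f = h]))|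
    apply: (measurable_crd2 (E := [set f | tile r n f = h]))] => //; exact: measurable_tile.
apply/seteqP; split => p; first by move=> E; exists (tile r n (crd n.+1 p.2)).
by move=> [h _ [/= h1 h2]]; rewrite /sametile /= h1 h2.
Qed.

Lemma measurable_apartX n : measurable (apartX n).
Proof.
pose Q (a b : int * int) : Prop := a.2 <> b.2.
rewrite (_ : apartX n = (\bigcup_(h : (int * int) * (int * int))
   ([set p : X * X | tile r n (crd n.+1 p.1) = h.1] `&` [set p | tile r n (crd n.+1 p.2) = h.2] `&`
    [set _ | h.1.2 <> h.2.2])) `|`
  (\bigcup_(h : int * int) ([set p : X * X | (crd n.+1 p.1).1.1 = h.1] `&`
     [set p | (crd n.+1 p.2).1.1 = h.2] `&` [set _ | (2 * at_ n <= `|(h.1 - h.2)%R| + gap r n)%N]))).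
  have mset (Z : Prop) : measurable [set _ : X * X | Z].
    have [z|nz] := pselect Z.
      by rewrite (_ : mkset _ = setT)//; apply/seteqP; split.
    by rewrite (_ : mkset _ = set0)//; apply/seteqP; split.
  apply: measurableU; (apply: countable_bigcupT_measurable => [|h]; first exact: countableP).
    apply: measurableI => //; apply: measurableI.
      by apply: (measurable_crd1 (E := [set f | tile r n f = h.1])) => //; exact: measurable_tile.
    by apply: (measurable_crd2 (E := [set f | tile r n f = h.2])) => //; exact: measurable_tile.
  apply: measurableI => //; apply: measurableI.
    by apply: (measurable_crd1 (E := [set f | f.1.1 = h.1])) => //; exact: (measurable_first (fun u => u = h.1)).
  by apply: (measurable_crd2 (E := [set f | f.1.1 = h.2])) => //; exact: (measurable_first (fun u => u = h.2)).
apply/seteqP; split => p.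
  case=> h; [left|right].
    by exists (tile r n (crd n.+1 p.1), tile r n (crd n.+1 p.2)).
  by exists ((crd n.+1 p.1).1.1, (crd n.+1 p.2).1.1).
case=> -[h _ [[/= <- <-] hh]]; [by left|by right].
Qed.

End Pairs.

Section SquareMap.
Context {R : realType} {d : measure_display} {X : measurableType d}.
Variables (mu : probability X R) (S : X -> X) (nu : probability (X * X)%type R).

Lemma iter_square t (p : X * X) : iter t (square_map S) p = (iter t S p.1, iter t S p.2).
Proof. by elim: t => [|t IH]; [case: p|rewrite iterS IH]. Qed.

Hypothesis jn : self_joining mu S nu.

Lemma square_preserving : measurable_fun setT S -> measure_preserving nu (square_map S).
Proof.
move=> mS; split; last by have [] := jn.
apply: measurable_fun_pair.
  exact: measurableT_comp mS (@measurable_fst _ _ X X).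
exact: measurableT_comp mS (@measurable_snd _ _ X X).
Qed.

Lemma joining_fst (A : set X) : measurable A ->
  measurable [set p : X * X | A p.1] /\ nu [set p | A p.1] = mu A.
Proof.
move=> mA; have [_ h _] := jn.
have E : [set p : X * X | A p.1] = A `*` setT by apply/seteqP; split => [p|p []].
by rewrite E h//; split => //; exact: measurableX.
Qed.

Lemma joining_snd (A : set X) : measurable A ->
  measurable [set p : X * X | A p.2] /\ nu [set p | A p.2] = mu A.
Proof.
move=> mA; have [_ _ h] := jn.
have E : [set p : X * X | A p.2] = setT `*` A by apply/seteqP; split => [p|p []].
by rewrite E h//; split => //; exact: measurableX.
Qed.

End SquareMap.

Section Cross.
Variables (R : realType) (r : nat -> nat) (xi : nat -> set (set (zrz2 R))).
Variables (D : nat -> {fset zrz2 R}) (s : nat -> int * int -> zrz2 R).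
Hypothesis hc : cf_choices r xi D s.
Local Notation G := (zrz2 R).
Local Notation at_ := (atilde r).
Context {d : measure_display} {X : measurableType d} {mu : probability X R}.
Variable iota : nat -> G * (nat -> G) -> X.
Hypothesis hs : cf_space r s mu iota.
Variable T : G -> X -> X.
Hypothesis hT : cf_action r s iota T.
Local Notation cyl := (@cyl R r s d X iota).
Local Notation crd := (@crd R r s d X iota).
Local Notation Xn := (@Xn R r s d X iota).
Local Notation lev := (@lev R r s).
Local Notation S := (T ((1, 0), false)).
Local Notation SS := (square_map S).
Local Notation dens := (@dens R r).
Local Notation bad := (@bad R r D s d X iota T).
Local Notation edge := (@edge R r s d X iota).
Local Notation apartX := (@apartX R r s d X iota).
Implicit Types (f g w : G) (n m : nat) (h : int * int) (A B : set G) (x y : X).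

Definition inX n : set X := [set x | Xn n.+1 x /\ inner r 2 n (crd n.+1 x)].

Lemma measurable_inX n : measurable (inX n).
Proof.
rewrite (_ : inX n = Xn n.+1 `&` crd n.+1 @^-1` [set f : G | inner r 2 n f]).
  apply: measurableI; first exact: (measurable_Xn hc hs (ltn0Sn n)).
  exact: (measurable_preimageT (measurable_crd hc hs (ltn0Sn n)) (measurable_inner _ _ _)).
by apply/seteqP; split.
Qed.

Lemma inner_le n f : inner r 2 n f -> inner r 1 n f.
Proof. by move=> [h1 h2]; split => //; move: h1; move: (wlen r n) => w; clear; lia. Qed.

(** The reserve of two windows in [inX] allows going back to the start of a window from any of its
    times, with one window still ahead. *)
Lemma win_back n x (t : nat) : inX n (iter t S x) -> (t < 2 * at_ n * wlen r n)%N ->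
  Xn n.+1 x /\ inner r 1 n (crd n.+1 x).
Proof.
rewrite (iter_act hc hs hT) => -[Xy iny] tL.
have ix : inner r 1 n ((shift R t%:Z)^-1 * crd n.+1 (T (shift R t%:Z) x))%g.
  by apply: (@inner_back _ _ _ _ t) tL; rewrite mulgA mulgV mul1g.
have [X1 c1 _] := act_crd hc hs hT (ltn0Sn n) Xy (inner_Fset0 ix).
by rewrite (actK hc hs hT) in X1 c1; rewrite c1.
Qed.

(* The pairs that separate when the scale drops from [n] to [n - 1]. *)
Definition cross n (B : set X) : set (X * X) :=
  [set p | [/\ inX n p.1, inX n p.2, apartX n p, B p.1 &
    [/\ Xn n p.1, Xn n p.2 & ~ apartX n.-1 p]]].

Lemma measurable_cross n (B : set X) : measurable B -> (0 < n)%N -> measurable (cross n B).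
Proof.
move=> mB n0.
have m1 (A : set X) : measurable A -> measurable [set p : X * X | A p.1].
  by move=> mA; exact: (measurable_preimageT (@measurable_fst _ _ X X) mA).
have m2 (A : set X) : measurable A -> measurable [set p : X * X | A p.2].
  by move=> mA; exact: (measurable_preimageT (@measurable_snd _ _ X X) mA).
have mI := measurable_inX n; have mX := measurable_Xn hc hs n0.
have := measurableI _ _ (measurableI _ _ (measurableI _ _ (m1 _ mI) (m2 _ mI))
   (measurableI _ _ (measurable_apartX hc hs n) (m1 _ mB)))
  (measurableI _ _ (measurableI _ _ (m1 _ mX) (m2 _ mX)) (measurableC (measurable_apartX hc hs n.-1))).
congr measurable; apply/seteqP; split => p.
  by move=> [[[h1 h2] [h3 h4]] [[h5 h6] h7]].
by move=> [h1 h2 h3 h4 [h5 h6 h7]].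
Qed.

(** A single visit makes the first point bad during the whole window. Each visit requires two
    samples that bring the points within a tile width of level [n - 1], which is rare by
    [spread]. *)
Lemma cross_window n A (eps : R) (l : nat) p t0 : (1 < n)%N -> (16 * n <= r n.-1)%N ->
  (0 < l)%N -> (l * l <= n)%N -> (t0 < 2 * at_ n * wlen r n)%N ->
  cross n (bad n A eps) (iter t0 SS p) ->
  bad n A eps p.1 /\ (visits SS (cross n (bad n A eps)) (2 * at_ n * wlen r n) p : R) <=
    (wlen r n)%:R * ((2 * at_ n)%N%:R * (60 / l%:R) + (2 * at_ n)%N%:R / n%:R + (gap r n)%:R).
Proof.
move=> n1 hr l0 ll t0L; have n0 : (0 < n)%N by exact: ltnW.
case: p => x y; rewrite iter_square/= => -[/= I1 I2 ap B _].
have [Xx inx] := win_back I1 t0L; have [Xy iny] := win_back I2 t0L.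
have [X1 c1] := win_crd hc hs hT Xx inx t0L; have [Y1 c2] := win_crd hc hs hT Xy iny t0L.
have apxy : apart r n (crd n.+1 x) (crd n.+1 y).
  move: ap; rewrite /apartX /= c1 c2 /apart !tile_shift2 => -[h|h]; [by left|right].
  by move: h; rewrite !shiftE /=; clear; lia.
split.
  move: B; rewrite /bad /= (dev_sum_shift hc hs hT A n0 Xx inx t0L)//.
  by rewrite -c1; apply: inner_le I1.2.
rewrite /visits (big_mul_iota (fun t => \1_(cross n (bad n A eps)) (iter t SS (x, y)))).
(* Closeness of the coordinates of level [n], which for fixed positions in the tiles depends only on
   the samples [a] and [b]. *)
pose F (t : nat) (a b : G) : R := (`|(red r n (shift R t%:Z * crd n.+1 x)%g).1.1 -
   (red r n (shift R t%:Z * crd n.+1 y)%g).1.1 - a.1.1 + b.1.1| < (2 * at_ n.-1)%N%:Z)%R%:R.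
have F1 t a b : `|F t a b| <= 1 by rewrite /F normr_nat lern1; case: (_ < _).
apply: le_trans (_ : \sum_(t < 2 * at_ n) \sum_(i < wlen r n)
    F t (sample_at r s n (crd n.+1 x) t i) (sample_at r s n (crd n.+1 y) t i) <= _).
  apply: ler_sum => t _; apply: ler_sum => i _.
  rewrite indicE; case: (boolP (_ \in _)); last by rewrite /F ler0n.
  rewrite inE iter_square /= => -[/= _ _ _ _ [Xnx Xny nap]].
  have tL : (2 * at_ n * i + t < 2 * at_ n * wlen r n)%N.
    apply: (@leq_trans (2 * at_ n * i.+1)); first by rewrite mulnS addnC ltn_add2r.
    by rewrite leq_mul2l (ltn_ord i) orbT.
  have [_ ctx] := win_crd hc hs hT Xx inx tL; have [_ cty] := win_crd hc hs hT Xy iny tL.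
  have tE : (2 * at_ n * i + t)%N%:Z = 2 * (at_ n)%:Z * i%:Z + t%:Z by rewrite PoszD !PoszM.
  rewrite ler_nat lt0b.
  have nE : n = n.-1.+1 by rewrite prednK.
  have : ~~ (2 * at_ n.-1 <= `|((crd n (iter (2 * at_ n * i + t) S x)).1.1 -
     (crd n (iter (2 * at_ n * i + t) S y)).1.1)%R| + gap r n.-1)%N.
    by apply/negP => h; apply: nap; right; rewrite /= -nE.
  rewrite (crd_back hc hs n0 Xnx) (crd_back hc hs n0 Xny) ctx cty /back tE !red_shift !tile_shift /sample_at.
  have diff (a b u v : G) : (a * u^-1)%g.1.1 - (b * v^-1)%g.1.1 = a.1.1 - b.1.1 - u.1.1 + v.1.1 :> int.
    by rewrite /=; ring.
  rewrite diff; move: (_ - _ - _ + _) => z; clear; lia.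
apply: le_trans (ler_norm _) _; apply: le_trans (window_pair hc n0 inx iny apxy F1) _.
rewrite ler_wpM2l// !lerD2r.
apply: le_trans (_ : \sum_(t < 2 * at_ n) (60 / l%:R) <= _); last first.
  by rewrite sumr_const card_ord -[X in X <= _]mulr_natl.
apply: ler_sum => t _; rewrite ger0_norm; last first.
  by apply: sumr_ge0 => a _; apply: sumr_ge0 => b _; rewrite !mulr_ge0// ?kappa_ge0// /F ler0n.
exact: (spread hc _ n1 hr l0 ll).
Qed.

End Cross.

(** * Rates of decay and error budgets *)

Section Squares.
Variable R : realType.

Lemma sqrt_ineq (N w v : R) : 1 <= N -> w ^+ 2 = N -> v ^+ 2 = N + 1 -> 0 < w -> 0 < v ->
  (w ^+ 2 * w)^-1 <= 6 / w - 6 / v.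
Proof.
move=> N0 w2 v2 w0 v0.
have e1 : (v - w) * (v + w) = 1.
  by rewrite (_ : _ * _ = v ^+ 2 - w ^+ 2); [rewrite v2 w2; ring|ring].
have v2w : v <= 2 * w by rewrite -(@ler_pXn2r _ 2)// ?nnegrE ?mulr_ge0 ?ltW// exprMn v2 w2; lra.
have -> : 6 / w - 6 / v = 6 * (v - w) / (v * w) by field; rewrite !gt_eqF.
rewrite ler_pdivlMr ?mulr_gt0// mulrC ler_pdivrMr ?mulr_gt0 ?exprn_gt0//.
have h : 1 <= (v - w) * (3 * w) by rewrite -{1}e1 ler_wpM2l//; [nra|lra].
have -> : 6 * (v - w) * (w ^+ 2 * w) = (v - w) * (3 * w) * (2 * w * w) by ring.
apply: le_trans (_ : 1 * (2 * w * w) <= _); last by rewrite ler_wpM2r// !mulr_ge0// ltW.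
by rewrite mul1r ler_wpM2r// ltW.
Qed.

(** A telescoping majorant of [n ^ (-3/2)], in the form that [borel_cantelli] takes. *)
Lemma sqrt_step (n : nat) : (0 < n)%N ->
  (n%:R * Num.sqrt n%:R)^-1 <= 6 / Num.sqrt n%:R - 6 / Num.sqrt n.+1%:R :> R.
Proof.
move=> n0; have N0 : 1 <= n%:R :> R by rewrite ler1n.
have w2 : Num.sqrt n%:R ^+ 2 = n%:R :> R by rewrite sqr_sqrtr.
have v2 : Num.sqrt n.+1%:R ^+ 2 = n%:R + 1 :> R by rewrite sqr_sqrtr// -natr1.
have w0 : 0 < Num.sqrt n%:R :> R by rewrite sqrtr_gt0; lra.
have v0 : 0 < Num.sqrt n.+1%:R :> R by rewrite sqrtr_gt0.
rewrite -{1}w2; exact: (sqrt_ineq N0 w2 v2 w0 v0).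
Qed.

Lemma inv_square_step (n : nat) : (0 < n)%N -> (n%:R ^+ 2)^-1 <= 2 / n%:R - 2 / n.+1%:R :> R.
Proof.
move=> n0; have N0 : 1 <= n%:R :> R by rewrite ler1n.
rewrite -[n.+1%:R]natr1; move: (n%:R : R) N0; clear => N N0.
have -> : 2 / N - 2 / (N + 1) = 2 / (N * (N + 1)) by field; rewrite !gt_eqF//; lra.
have N1 : 0 < N by lra.
have N2 : 0 < N + 1 by lra.
rewrite ler_pdivlMr ?mulr_gt0// mulrC ler_pdivrMr ?exprn_gt0//; nra.
Qed.

Lemma sqrt_ge1 (n : nat) : (0 < n)%N -> 1 <= Num.sqrt n%:R :> R.
Proof. by move=> n0; rewrite -[leLHS]sqrtr1 ler_wsqrtr// ler1n. Qed.

Lemma nat_sqrt (n : nat) : (1 <= n)%N -> exists l : nat, [/\ (0 < l)%N, (l * l <= n)%N &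
  (l%:R : R)^-1 <= 2 / Num.sqrt n%:R].
Proof.
move=> n1; pose w : R := Num.sqrt n%:R; have w2 : w ^+ 2 = n%:R by rewrite sqr_sqrtr.
have w0 : 0 <= w by exact: sqrtr_ge0.
have w1 : 1 <= w by rewrite -sqrtr1 ler_wsqrtr// ler1n.
have /andP[h1 h2] := truncn_itv w0.
have l0 : (0 < Num.truncn w)%N by rewrite truncn_ge_nat.
have L0 : 1 <= (Num.truncn w)%:R :> R by rewrite ler1n.
exists (Num.truncn w); split => //.
  rewrite -(ler_nat R) natrM -w2 expr2; apply: ler_pM => //.
rewrite ler_pdivlMr -/w; last by lra.
rewrite mulrC ler_pdivrMr; last by lra.
by rewrite -natr1 in h2; lra.
Qed.

(** [60 * l] with [l <= 2 / sn] contributes 120, the two terms [L / n] contribute 2, and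
    [2440 = 122 * 20]. *)
Lemma cross_final (sn l e n L c M b : R) : 0 < n -> 0 < sn -> sn ^+ 2 = n -> 1 <= sn ->
  l <= 2 / sn -> 0 < L -> 0 <= b -> b <= 20 / n / e ->
  0 < e -> c <= L * (60 * l) + L / n + L / n -> L * M <= c * b -> 
  M <= 2440 / e * (n * sn)^-1.
Proof.
move=> n0' s0 s2 s1 hl L0 b0 hb e0 hc hM.
have nn : n^-1 <= sn^-1 by rewrite lef_pV2 ?posrE// -s2 expr2 ler_peMr// ltW.
have : c <= L * (122 / sn).
  apply: le_trans hc _; rewrite -!mulrDr ler_wpM2l ?(ltW L0)//.
  by rewrite mulrC in hl; move: (sn^-1) (n^-1) nn hl; clear => *; lra.
move=> hc'; have : L * M <= L * (122 / sn * b).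
  by apply: le_trans hM _; rewrite mulrA ler_wpM2r.
rewrite ler_pM2l// => h; apply: le_trans h _.
have -> : 2440 / e * (n * sn)^-1 = 122 / sn * (20 / n / e) by field; rewrite !gt_eqF.
by rewrite ler_wpM2l// divr_ge0// ltW.
Qed.

(** [V1] counts the visits of the pair to the product set and [V2] those of the second point to its
    cylinder. Both are near their Birkhoff limits, and the window estimate ties [V1] to [D * V2].
    The errors add up to [6 * dl], against a separation of [7 * dl]. *)
Lemma far_final (V1 V2 a b c u D L zz gp dl : R) : 0 < L -> 0 <= D -> D <= 1 -> 0 <= b -> b <= 1 ->
  0 < dl -> `|V1 - D * V2| <= L * (dl + zz) + gp -> `|V1 - a * L| <= dl * L ->
  `|V2 - b * L| <= dl * L -> gp <= L * zz -> `|D - c| <= 1 - u -> 1 - dl <= u -> zz <= dl ->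
  7 * dl <= `|a - c * b| -> False.
Proof.
move=> L0 D0 D1 b0 b1 d0 h h1 h2 hg hD hu hz hd.
have E : (a - c * b) * L = - (V1 - a * L) + ((V1 - D * V2) + (D * (V2 - b * L) + (D - c) * (b * L))) by ring.
have k1 : `|D * (V2 - b * L)| <= dl * L.
  by rewrite normrM (ger0_norm D0) -[leRHS]mul1r ler_pM.
have k2 : `|(D - c) * (b * L)| <= dl * L.
  rewrite normrM (ger0_norm (mulr_ge0 b0 (ltW L0))) ler_pM ?mulr_ge0 ?(ltW L0)//; first by lra.
  by rewrite ler_piMl ?(ltW L0).
have : `|a - c * b| * L <= 6 * dl * L.
  rewrite -{1}(gtr0_norm L0) -normrM E.
  apply: le_trans (ler_normD _ _) _; rewrite normrN.
  have t1 := ler_normD (V1 - D * V2) (D * (V2 - b * L) + (D - c) * (b * L)).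
  have t2 := ler_normD (D * (V2 - b * L)) ((D - c) * (b * L)).
  have hz' : L * zz <= L * dl by rewrite ler_wpM2l// ltW.
  rewrite mulrDr in h; rewrite mulrC in hz'.
  lra.
rewrite ler_pM2r//; lra.
Qed.

End Squares.

(** * Separation of pairs under an ergodic joining *)

Section Separation.
Variables (R : realType) (r : nat -> nat) (xi : nat -> set (set (zrz2 R))).
Variables (D : nat -> {fset zrz2 R}) (s : nat -> int * int -> zrz2 R).
Hypothesis hc : cf_choices r xi D s.
Local Notation G := (zrz2 R).
Local Notation at_ := (atilde r).
Context {d : measure_display} {X : measurableType d} {mu : probability X R}.
Variable iota : nat -> G * (nat -> G) -> X.
Hypothesis hs : cf_space r s mu iota.
Variable T : G -> X -> X.
Hypothesis hT : cf_action r s iota T.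
Local Notation cyl := (@cyl R r s d X iota).
Local Notation crd := (@crd R r s d X iota).
Local Notation Xn := (@Xn R r s d X iota).
Local Notation lev := (@lev R r s).
Local Notation S := (T ((1, 0), false)).
Local Notation SS := (square_map S).
Local Notation dens := (@dens R r).
Local Notation bad := (@bad R r D s d X iota T).
Local Notation edge := (@edge R r s d X iota).
Local Notation apartX := (@apartX R r s d X iota).
Local Notation inX := (@inX R r s d X iota).
Local Notation cross := (@cross R r s d X iota).
Implicit Types (f g w : G) (n m : nat) (h : int * int) (A B : set G) (x y : X).

Variable nu : probability (X * X)%type R.
Hypothesis jn : self_joining mu S nu.
Hypothesis en : ergodic nu SS.

Let pSS : measure_preserving nu SS.
Proof. exact: square_preserving jn (measurable_act hc hs hT _). Qed.

Variables (m m' : nat) (z z' : int) (p q p' q' : R) (e e' : bool).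
Hypotheses (m0 : (0 < m)%N) (m0' : (0 < m')%N) (pq : p < q) (pq' : p' < q').
Local Notation A0 := (intv z p q e).
Local Notation B0 := (intv z' p' q' e').
Hypotheses (AF : A0 `<=` Fset r m) (BF : B0 `<=` Fset r m').

(** During a window there are no visits unless its first point is bad, and otherwise they take up a
    fraction [O(1 / sqrt n)] of it; [visits_measure_le] multiplies this fraction by the measure of
    the bad set. *)
Lemma cross_le (eps : R) : 0 < eps -> exists N, forall n, (N <= n)%N ->
  measurable (bad n (lev A0 m n) eps) /\
  fine (mu (bad n (lev A0 m n) eps)) <= 20 / n%:R / eps ^+ 2 /\
  fine (nu (cross n (bad n (lev A0 m n) eps))) <=
    2440 / eps ^+ 2 * (n%:R * Num.sqrt n%:R)^-1.
Proof.
move=> e0; have [N [N100 HN]] := growth hc.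
exists (maxn N m).+2 => n hn.
have [Nn mn] : (N <= n.-1)%N /\ (m < n.-1)%N by move: hn; rewrite -!maxnSS geq_max => /andP[]; clear; lia.
have n100 : (100 <= n.-1)%N by exact: leq_trans Nn.
have nE : n = n.-1.+1 by rewrite prednK//; clear -n100; lia.
have [mB Bd] : measurable (bad n (lev A0 m n) eps) /\
  (mu (bad n (lev A0 m n) eps) <= (20 / n%:R / eps ^+ 2)%:E)%E.
  by rewrite nE; apply: (bad_le hc hs hT) => //; exact: HN.
have Bd' := prob_bound mB Bd; split => //; split => //.
have [_ _ r16 _] := growth2 n100 (HN _ Nn).
have hr : (16 * n <= r n.-1)%N.
  have [h3 h2 _ h1] := growth2 n100 (HN _ Nn).
  by rewrite -nE in h1; apply: leq_trans h1; rewrite -mulnn leq_mul2r; apply/orP; right; clear -n100; lia.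
have hg := gap_le n100 (HN _ Nn); rewrite -nE in hg.
have n1 : (1 < n)%N by clear -n100; lia.
have n0 : (0 < n)%N by exact: ltnW.
have [l [l0 ll lR]] := nat_sqrt R n0.
have mC := measurable_cross hc hs mB n0.
pose L := (2 * at_ n * wlen r n)%N.
have a0 := atilde_gt0 r n.
have L0 : 0 < L%:R :> R by rewrite ltr0n /L !muln_gt0 a0.
pose c : R := (wlen r n)%:R * ((2 * at_ n)%N%:R * (60 / l%:R) + (2 * at_ n)%N%:R / n%:R + (gap r n)%:R).
have c0 : 0 <= c by rewrite mulr_ge0// !addr_ge0// ?mulr_ge0// ?invr_ge0//.
have [mB1 B1] := joining_fst jn mB.
have V (x : (X * X)%type) : visits SS (cross n (bad n (lev A0 m n) eps)) L x <=
    c * \1_([set p | bad n (lev A0 m n) eps p.1]) x.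
  have [[t0 [tL Ct]]|nC] := pselect (exists t0, (t0 < L)%N /\
      cross n (bad n (lev A0 m n) eps) (iter t0 SS x)).
    have [b1 b2] := cross_window hc hs hT n1 hr l0 ll tL Ct.
    by rewrite indicE mem_set// mulr1.
  rewrite /visits big1; first by rewrite mulr_ge0// indicE.
  move=> t _; rewrite indicE memNset// => Ct; apply: nC; exists t; split => //.
have := visits_measure_le pSS c0 mC mB1 V.
rewrite B1 (prob_fine nu mC) (prob_fine mu mB) -!EFinM lee_fin => hM.
have N0 : 0 < n%:R :> R by rewrite ltr0n.
have w1 : 1 <= Num.sqrt n%:R :> R by exact: sqrt_ge1.
apply: (cross_final (l := l%:R^-1) (L := L%:R) (c := c) (b := fine (mu (bad n (lev A0 m n) eps)))) => //.
- by apply: lt_le_trans w1.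
- by rewrite sqr_sqrtr.
- exact: prob_ge0.
- by rewrite exprn_gt0.
have g0 : (gap r n)%:R <= (2 * at_ n)%N%:R / n%:R :> R.
  by rewrite ler_pdivlMr// -natrM ler_nat mulnC.
have -> : L%:R = (wlen r n)%:R * (2 * at_ n)%N%:R :> R by rewrite -natrM mulnC.
apply: le_trans (_ : (wlen r n)%:R * ((2 * at_ n)%N%:R * (60 / l%:R) + (2 * at_ n)%N%:R / n%:R +
  (2 * at_ n)%N%:R / n%:R) <= _); first by rewrite ler_wpM2l// lerD2l.
by rewrite !mulrDr !mulrA.
Qed.

(** Once Birkhoff's theorem has become effective for the product set and for the second cylinder, a
    window of an apart pair with a good first point would show the product frequency. *)
Lemma far_ae (dl : R) : 0 < dl -> 7 * dl <=
    `|fine (nu (cyl m A0 `*` cyl m' B0)) - fine (mu (cyl m A0)) * fine (mu (cyl m' B0))| ->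
  {ae nu, forall x : (X * X)%type, exists K, forall n, (K <= n)%N ->
    inX n x.1 -> inX n x.2 -> apartX n x -> bad n (lev A0 m n) dl x.1}.
Proof.
move=> d0 hd.
have mI : measurable A0 by exact: measurable_intv.
have mJ : measurable B0 by exact: measurable_intv.
have mA : measurable (cyl m A0) by exact: (measurable_cyl hc hs).
have mB : measurable (cyl m' B0) by exact: (measurable_cyl hc hs).
have [mB2 B2] := joining_snd jn mB.
have mAB : measurable (cyl m A0 `*` cyl m' B0) by exact: measurableX.
have [N [N101 HN]] := small_eventually hc hs d0.
have := birkhoff pSS en mAB; have := birkhoff pSS en mB2.
apply: filterS2 => x h2 h1.
have [K2 {}h2] := h2 _ d0; have [K1 {}h1] := h1 _ d0.
exists (maxn (maxn N (maxn m m')) (maxn K1 K2)) => n; rewrite !geq_max.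
move=> /andP[/andP[Nn /andP[mn mn']] /andP[k1 k2]] I1 I2 ap; apply: contrapT => nb.
have [r4' r4 nd X1] := HN n Nn.
have n100 : (100 <= n.-1)%N by clear -N101 Nn; lia.
have nE : n = n.-1.+1 by rewrite prednK//; clear -n100; lia.
have hg := gap_le n100 r4'; rewrite -nE in hg.
have a0 := atilde_gt0 r n.
have N0 : 0 < n%:R :> R by rewrite ltr0n nE.
have dp := dev_pair hc hs hT m0 mn m0' mn' mI AF BF d0 I1.1 (inner_le I1.2) I2.1 (inner_le I2.2) ap nb.
set L := (2 * at_ n * wlen r n)%N in dp.
have L0 : 0 < L%:R :> R by rewrite ltr0n /L !muln_gt0 a0.
have nL : (n <= L)%N.
  have [h _] : (n <= at_ n)%N /\ True by split => //; rewrite atildeE ?leq_addl// nE.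
  apply: leq_trans h _; rewrite /L; have := wlen_gt0 r n.
  by move: (at_ n) (wlen r n) => a w w0; clear -w0; nia.
have {}h1 := h1 L (leq_trans k1 nL); have {}h2 := h2 L (leq_trans k2 nL).
have g0 : (wlen r n)%:R * (gap r n)%:R <= L%:R * n%:R^-1 :> R.
  rewrite /L natrM mulrAC mulrC ler_wpM2r//.
  by rewrite ler_pdivlMr// -natrM ler_nat mulnC.
have dn := dens_near hc hs m0 mn mI AF.
have dn1 : dens n (lev A0 m n) <= 1.
  by apply: dens_le1; [rewrite nE|exact: measurable_lev|exact: (lev_sub hc)].
have dn0 := dens_ge0 r n (lev A0 m n).
have /andP[b0 b1] := fine_le1 (mu := mu) mB.
rewrite B2 in h2.
have sumE : \sum_(t < L) (\1_(cyl m A0) (iter t S x.1) - dens n (lev A0 m n)) *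
     \1_(cyl m' B0) (iter t S x.2) = visits SS (cyl m A0 `*` cyl m' B0) L x -
     dens n (lev A0 m n) * visits SS [set p | cyl m' B0 p.2] L x.
  rewrite /visits mulr_sumr -sumrB; apply: eq_bigr => t _.
  rewrite mulrBl iter_square; congr (_ - _ * _); rewrite !indicE.
  rewrite -natrM mulnb; congr (nat_of_bool _)%:R; apply/idP/idP.
    by move=> /andP[]; rewrite !inE => ? ?; split.
  by rewrite inE => -[/= ? ?]; apply/andP; rewrite !inE.
rewrite sumE in dp.
exact: (far_final L0 dn0 dn1 b0 b1 d0 dp h1 h2 g0 dn X1 nd hd).
Qed.

(** The measures of the bad sets tend to 0, so their intersection over all levels from a given one
    on is null. *)
Lemma bad_not_eventually (eps : R) : 0 < eps ->
  {ae mu, forall x, ~ exists K, forall n, (K <= n)%N -> bad n (lev A0 m n) eps x}.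
Proof.
move=> e0; have [N HN] := cross_le e0.
pose F K := \bigcap_k bad (maxn K N + k) (lev A0 m (maxn K N + k)) eps.
have mF K : measurable (F K).
  apply: bigcap_measurable => // k _.
  by have [] := HN (maxn K N + k)%N (leq_trans (leq_maxr _ _) (leq_addr _ _)).
have F0 K : mu (F K) = 0%E.
  apply: prob0_le => // dl d0.
  have dl1 : 0 < dl * eps ^+ 2 / 20 by rewrite divr_gt0// mulr_gt0// exprn_gt0.
  pose n := maxn (maxn K N) (Num.truncn (dl * eps ^+ 2 / 20)^-1).+1.
  have hn : (maxn K N <= n)%N by exact: leq_maxl.
  have [mB [Bd _]] : measurable (bad n (lev A0 m n) eps) /\ _ := HN _ (leq_trans (leq_maxr _ _) hn).
  apply: le_trans (prob_le mu (mF K) mB _) _; first by move=> x /(_ (n - maxn K N)%N Logic.I); rewrite subnKC.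
  apply: le_trans Bd _; rewrite ler_pdivrMr ?exprn_gt0//.
  have n0 : 0 < n%:R :> R by rewrite ltr0n (leq_trans _ (leq_maxr _ _)).
  rewrite ler_pdivrMr// -ler_pdivrMl; last by rewrite mulr_gt0// exprn_gt0.
  apply: le_trans (_ : (dl * eps ^+ 2 / 20)^-1 <= _).
    by rewrite [(dl * _ / 20)^-1]invfM invrK.
  by apply: ltW; apply: lt_le_trans (truncnS_gt _) _; rewrite ler_nat leq_maxr.
apply: negligibleS (negligible_bigcup (mu := mu) (F := F) _); last first.
  by move=> K; exists (F K); split; [exact: mF|exact: F0|].
move=> x /= /contrapT[K HK]; exists K => // k _; apply: HK.
by rewrite (leq_trans (leq_maxl K N))// leq_addr.
Qed.

Lemma separation (dl : R) : 0 < dl -> 7 * dl <=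
    `|fine (nu (cyl m A0 `*` cyl m' B0)) - fine (mu (cyl m A0)) * fine (mu (cyl m' B0))| ->
  {ae nu, forall x : (X * X)%type, exists K, forall n, (K <= n)%N ->
    [/\ Xn n x.1, Xn n x.2 & ~ apartX n x]}.
Proof.
move=> d0 hd; have far := far_ae d0 hd.
have [N] := cross_le d0.
have [c [c0 cE]] : exists c : R, 0 <= c /\ c = 2440 / dl ^+ 2.
  by exists (2440 / dl ^+ 2); split; [exact: (divr_ge0 (ler0n _ _) (sqr_ge0 _))|].
rewrite -cE {cE} => HN.
have [Ng [Ng100 Hg]] := growth hc.
have mB n : (N <= n)%N -> measurable (bad n (lev A0 m n) dl) by move=> /HN[].
pose C n := if (maxn N 1 <= n)%N then cross n (bad n (lev A0 m n) dl) else set0.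
have mC n : measurable (C n).
  rewrite /C; case: ifP => //; rewrite geq_max => /andP[/mB mBn n0].
  exact: (measurable_cross hc hs mBn n0).
have bcC : {ae nu, forall x : (X * X)%type, exists K, forall n, (K <= n)%N -> ~ C n x}.
  apply: (@borel_cantelli _ _ _ nu C (fun n => c * (6 / Num.sqrt n%:R)) (maxn N 1)) => //.
    by move=> n; rewrite mulr_ge0// divr_ge0// sqrtr_ge0.
  move=> n hn; rewrite /C hn; move: hn; rewrite geq_max => /andP[Nn n0].
  have [_ [_ h]] := HN n Nn; apply: le_trans h _.
  by rewrite -mulrBr ler_wpM2l// sqrt_step.
pose E n := if (Ng <= n)%N then edge n else set0.
have E2 n : (Ng <= n)%N -> measurable (edge n) /\ (mu (edge n) <= (6 / n%:R ^+ 2)%:E)%E.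
  by move=> gn; apply: (edge_le hc hs (leq_trans Ng100 gn)); exact: Hg.
have mE n : measurable (E n) by rewrite /E; case: ifP => // /E2[].
have bcE : {ae mu, forall x, exists K, forall n, (K <= n)%N -> ~ E n x}.
  apply: (@borel_cantelli _ _ _ mu E (fun n => 6 * (2 / n%:R)) Ng) => //.
  move=> n gn; have [me he] := E2 n gn; rewrite /E gn; apply: le_trans (prob_bound me he) _.
  by rewrite -mulrBr ler_wpM2l// inv_square_step// (leq_trans _ gn)// (leq_trans _ Ng100).
have lift1 (Q : X -> Prop) : {ae mu, forall x, Q x} -> {ae nu, forall x : (X * X)%type, Q x.1}.
  move=> [Z [mZ Z0 sub]]; have [m1 e1] := joining_fst jn mZ.
  by exists [set x : (X * X)%type | Z x.1]; split => //; [rewrite e1|move=> x /=; exact: (sub x.1)].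
have lift2 (Q : X -> Prop) : {ae mu, forall x, Q x} -> {ae nu, forall x : (X * X)%type, Q x.2}.
  move=> [Z [mZ Z0 sub]]; have [m1 e1] := joining_snd jn mZ.
  by exists [set x : (X * X)%type | Z x.2]; split => //; [rewrite e1|move=> x /=; exact: (sub x.2)].
have nb := lift1 _ (bad_not_eventually d0).
have nE : {ae nu, forall x : (X * X)%type, exists K, forall n, (K <= n)%N -> ~ E n x.1 /\ ~ E n x.2}.
  have := lift1 _ bcE; have := lift2 _ bcE; apply: filterS2 => x [K1 h1] [K2 h2].
  exists (maxn K1 K2) => n; rewrite geq_max => /andP[k1 k2]; split; [exact: h2|exact: h1].
have fb : {ae nu, forall x : (X * X)%type, (exists K, forall n, (K <= n)%N ->
    inX n x.1 -> inX n x.2 -> apartX n x -> bad n (lev A0 m n) dl x.1) /\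
    ~ exists K, forall n, (K <= n)%N -> bad n (lev A0 m n) dl x.1}.
  by have := nb; have := far; apply: filterS2.
have ce : {ae nu, forall x : (X * X)%type, (exists K, forall n, (K <= n)%N -> ~ C n x) /\
   (exists K, forall n, (K <= n)%N -> ~ E n x.1 /\ ~ E n x.2)}.
  by have := nE; have := bcC; apply: filterS2.
have := ce; have := fb; apply: filterS2 => -[x y] /= [[K1 h1] nbx] [[K2 h2] [K3 h3]].
have [k4 k40 Xx] := Xn_cover hs x; have [k5 k50 Xy] := Xn_cover hs y.
have [K [KN Kg k1 k2 k3] [k4K k5K K0]] : exists2 K, [/\ (N <= K)%N, (Ng <= K)%N, (K1 <= K)%N,
    (K2 <= K)%N & (K3 <= K)%N] & [/\ (k4 <= K)%N, (k5 <= K)%N & (0 < K)%N].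
  by exists (N + Ng + K1 + K2 + K3 + k4 + k5 + 1)%N; split; clear; lia.
have inK n : (K <= n)%N -> [/\ Xn n x, Xn n y, inX n x & inX n y].
  move=> Kn.
  have X1 : Xn n x by apply: (Xn_mono hc hs k40) Xx; exact: leq_trans k4K _.
  have X2 : Xn n y by apply: (Xn_mono hc hs k50) Xy; exact: leq_trans k5K _.
  have X1' : Xn n.+1 x by apply: (Xn_mono hc hs k40) Xx; rewrite (leq_trans k4K)// ltnW.
  have X2' : Xn n.+1 y by apply: (Xn_mono hc hs k50) Xy; rewrite (leq_trans k5K)// ltnW.
  have [] := h3 n (leq_trans k3 Kn); rewrite /E (leq_trans Kg Kn) => e1 e2.
  split => //; split => //; apply: contrapT => h; [exact: e1|exact: e2].
(* A pair apart at level [n] has a bad first point; were it not apart at level [n - 1], it would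
   cross, and crossings have stopped by level [K]. *)
have down n : (K < n)%N -> apartX n (x, y) -> apartX n.-1 (x, y).
  move=> Kn ap; apply: contrapT => nap; have [X1 X2 I1 I2] := inK n (ltnW Kn).
  apply: (h2 n (leq_trans k2 (ltnW Kn))).
  rewrite /C geq_max (leq_trans KN (ltnW Kn)) (leq_trans K0 (ltnW Kn)).
  by split => //; apply: h1 => //; exact: leq_trans k1 (ltnW Kn).
have [[K' HK']|always] := pselect (exists K', forall n, (K' <= n)%N -> ~ apartX n (x, y)).
  exists (maxn K K') => n; rewrite geq_max => /andP[/inK[X1 X2 _ _] k']; split => //; exact: HK'.
have downs j n : (K <= n)%N -> apartX (n + j) (x, y) -> apartX n (x, y).
  elim: j => [|j IH] Kn; first by rewrite addn0.
  by rewrite addnS => /down; rewrite ltnS => /(_ (leq_trans Kn (leq_addr _ _))); exact: IH.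
(* Being apart at arbitrarily large levels propagates down to every level from [K] on, and the first
   point is bad at each of them. *)
exfalso; apply: nbx; exists K => n Kn; have [_ _ I1 I2] := inK n Kn.
apply: h1 => //; first exact: leq_trans k1 Kn.
apply: contrapT => nap; apply: always; exists n => M nM; rewrite -(subnKC nM) => /(downs _ _ Kn).
exact: nap.
Qed.

End Separation.

(** * Graphs of the action and constancy of the group element *)

Lemma not_negligible_setT (R : realType) (d : measure_display) (Y : measurableType d)
  (P : probability Y R) : ~ P.-negligible [set: Y].
Proof.
move=> [Z [mZ Z0 sub]]; have := probability_setT P.
rewrite (_ : [set: Y] = Z); first by move=> /esym; rewrite Z0 => -[/eqP]; rewrite oner_eq0.
by apply/seteqP; split.
Qed.

Section Graphs.
Variables (R : realType) (r : nat -> nat) (xi : nat -> set (set (zrz2 R))).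
Variables (D : nat -> {fset zrz2 R}) (s : nat -> int * int -> zrz2 R).
Hypothesis hc : cf_choices r xi D s.
Local Notation G := (zrz2 R).
Local Notation at_ := (atilde r).
Context {d : measure_display} {X : measurableType d} {mu : probability X R}.
Variable iota : nat -> G * (nat -> G) -> X.
Hypothesis hs : cf_space r s mu iota.
Variable T : G -> X -> X.
Hypothesis hT : cf_action r s iota T.
Local Notation cyl := (@cyl R r s d X iota).
Local Notation crd := (@crd R r s d X iota).
Local Notation pt := (@pt R r s d X iota).
Local Notation Xn := (@Xn R r s d X iota).
Local Notation S := (T ((1, 0), false)).
Local Notation SS := (square_map S).
Local Notation apartX := (@apartX R r s d X iota).
Local Notation sametile := (@sametile R r s d X iota).
Implicit Types (f g w : G) (n m : nat) (h : int * int) (A B : set G) (x y : X).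

Definition graphs B : set (X * X) := [set p | exists2 g, B g & p.2 = T g p.1].

Lemma act_tile g n x : (0 < n)%N -> Xn n x -> Fset r n (g * crd n x)%g ->
  tile r n (crd n.+1 (T g x)) = tile r n (crd n.+1 x).
Proof.
move=> n0 Xx Fg; have [X1 c1 t1] := act_crd hc hs hT n0 Xx Fg.
have [_ Ex] := pt_embed hc hs n0 Xx; have [_ Ey] := pt_embed hc hs n0 X1.
have [[_ /(_ 0%N)]] := ptP hs n0 Xx; rewrite addn0 => -[h Hh Eh] _.
rewrite /crd Ex Ey /= t1 -Eh.
have [-> _ _] := cmap_tile hc n0 (crdF hs n0 Xx) Hh.
by have [-> _ _] := cmap_tile hc n0 (crdF hs n0 X1) Hh.
Qed.

Lemma graphsE B : graphs B = \bigcup_K \bigcap_k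
  (([set p : X * X | Xn (K + k).+1 p.1] `&` [set p | Xn (K + k).+1 p.2]) `&`
   (sametile (K + k).+1 `&` [set p | B (crd (K + k).+1 p.2 * (crd (K + k).+1 p.1)^-1)%g])).
Proof.
apply/seteqP; split => [[x y] [g Bg /= ->]|[x y] [K _ H]].
  have [n0 n00 Hg] := Fset_mul_large hc hs g; have [m m0 Xx] := Xn_cover hs x.
  exists (maxn n0 m) => // k _; set n := (maxn n0 m + k)%N.
  have n0n : (n0 <= n)%N by rewrite (leq_trans (leq_maxl n0 m))// leq_addr.
  have mn : (m <= n)%N by rewrite (leq_trans (leq_maxr n0 m))// leq_addr.
  have X1 : Xn n x by exact: (Xn_mono hc hs m0) Xx.
  have X2 : Xn n.+1 x by apply: (Xn_mono hc hs m0) Xx; exact: leqW.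
  have F := Hg n x n0n X1; have [X3 c3 _] := act_crd hc hs hT (ltn0Sn n) X2 F.
  split; split => //=; last by rewrite c3 mulgK.
  by rewrite /sametile /= (act_tile (ltn0Sn n) X2 F).
have [[/= Xx Xy] [_ BK]] := H 0%N Logic.I; rewrite addn0 in Xx Xy BK.
exists (crd K.+1 y * (crd K.+1 x)^-1)%g => //=.
apply: (same_tiles hc hs hT (ltn0Sn K) Xx Xy) => k Kk.
have [_ [+ _]] := H (k.-1 - K)%N Logic.I.
have -> : (K + (k.-1 - K)).+1 = k by move: Kk; clear; lia.
by [].
Qed.

Lemma measurable_graphs B : measurable B -> measurable (graphs B).
Proof.
move=> mB; rewrite graphsE; apply: bigcup_measurable => K _; apply: bigcap_measurable => // k _.
have mX := measurable_Xn hc hs (ltn0Sn (K + k)).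
have mc := measurable_crd hc hs (ltn0Sn (K + k)).
apply: measurableI; apply: measurableI.
- exact: (measurable_preimageT (@measurable_fst _ _ X X) mX).
- exact: (measurable_preimageT (@measurable_snd _ _ X X) mX).
- exact: (measurable_sametile hc hs).
apply: (@measurable_preimageT _ _ _ _ (fun p : X * X => (crd (K + k).+1 p.1, crd (K + k).+1 p.2))
  [set q : G * G | B (q.2 * q.1^-1)%g]); last exact: measurable_divg_set.
apply: measurable_fun_pair.
  exact: measurableT_comp mc (@measurable_fst _ _ X X).
exact: measurableT_comp mc (@measurable_snd _ _ X X).
Qed.

Lemma graphs_invariant B : SS @^-1` graphs B = graphs B.
Proof.
have comm g x : T g (S x) = S (T g x).
  by rewrite !(actM hc hs hT); congr (T _ x); exact/esym/(shiftC 1).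
apply/seteqP; split => -[x y] [g Bg /= E]; exists g => //=; last by rewrite comm E.
rewrite comm in E; rewrite -(actK hc hs hT ((1, 0), false) y) E.
exact: (actK hc hs hT).
Qed.

Variable nu : probability (X * X)%type R.
Hypothesis en : ergodic nu SS.

Definition cell k (c : int * int * bool) : set G :=
  intv c.1.1 (c.1.2%:~R / k.+1%:R) ((c.1.2 + 1)%:~R / k.+1%:R) c.2.

Lemma cellP k g : exists c, cell k c g.
Proof.
pose j : int := Num.floor ((g.1.2 : R) * k.+1%:R).
have k0 : 0 < k.+1%:R :> R by rewrite ltr0n.
have [jl jr] : (j%:~R <= (g.1.2 : R) * k.+1%:R) /\ ((g.1.2 : R) * k.+1%:R < (j + 1)%:~R).
  by have /andP[] := floor_itv ((g.1.2 : R) * k.+1%:R).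
(* Cells are open on the left, so a multiple of the mesh belongs to the preceding cell. *)
have [e|ne] := eqVneq (j%:~R : R) (g.1.2 * k.+1%:R).
  exists ((g.1.1, j - 1), g.2); split => //=; rewrite ltr_pdivrMr// ler_pdivlMr// subrK -e lexx andbT.
  by rewrite ltr_int; lia.
exists ((g.1.1, j), g.2); split => //=; rewrite ltr_pdivrMr// ler_pdivlMr// (ltW jr) andbT.
by rewrite lt_neqAle ne.
Qed.

(** Countably many cells cover [G] and the corresponding unions of graphs are invariant; one of them
    is not null, hence of full measure by ergodicity. *)
Lemma full_cell k : {ae nu, forall p, graphs setT p} ->
  exists c, {ae nu, forall p, graphs (cell k c) p}.
Proof.
move=> full; have mc c : measurable (cell k c) by exact: measurable_intv.
have [[c n0]|all0] := pselect (exists c, nu (graphs (cell k c)) <> 0%E).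
  exists c; have mg := measurable_graphs (mc c).
  have [//|e1] := en mg (graphs_invariant _).
  exists (~` graphs (cell k c)); split => //; first exact: measurableC.
  by rewrite probability_setC// e1 subee.
have z c : nu (graphs (cell k c)) = 0%E by apply: contrapT => h; apply: all0; exists c.
have [F [F1 F2]] := @countable_enum (int * int * bool)%type _ (fun c => graphs (cell k c)) set0.
have neg : nu.-negligible (\bigcup_i F i).
  apply: negligible_bigcup => i; have [->|[c ->]] := F1 i; first exact: negligible_set0.
  by exists (graphs (cell k c)); split; [exact: measurable_graphs|exact: z|].
exfalso; apply: (@not_negligible_setT _ _ _ nu).
apply: negligibleS (negligibleU neg full) => p _.
  have [[g _ E]|ng] := pselect (graphs setT p); last by right.
  have [c gc] := cellP k g; have [i Fi] := F2 c.
  by left; exists i => //; rewrite Fi; exists g.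
Qed.

Lemma same_cells g g' : (forall k, exists c, cell k c g /\ cell k c g') -> g = g'.
Proof.
move=> H; have [c0 [[h1 _ h2] [h1' _ h2']]] := H 0%N.
have e2 : g.1.2 = g'.1.2 :> R.
  apply/eqP; rewrite -subr_eq0 -normr_le0 leNgt; apply/negP => pos.
  set a := `|_| in pos.
  have [c [[_ /andP[l1 l2] _] [_ /andP[l3 l4] _]]] := H (Num.truncn a^-1).
  have k0 : 0 < (Num.truncn a^-1).+1%:R :> R by rewrite ltr0n.
  have big : 1 < a * (Num.truncn a^-1).+1%:R.
    by rewrite -ltr_pdivrMl// mulr1 truncnS_gt.
  rewrite ltr_pdivrMr// ler_pdivlMr// intrD in l1 l2; rewrite ltr_pdivrMr// ler_pdivlMr// intrD in l3 l4.
  have : `|(g.1.2 - g'.1.2 : R) * (Num.truncn a^-1).+1%:R| <= 1.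
    by rewrite mulrBl ler_norml; apply/andP; split; lra.
  by rewrite normrM (gtr0_norm k0) leNgt big.
case: g g' h1 h2 h1' h2' e2 {H} => [[x a] e] [[x' a'] e'] /= -> -> -> -> ->.
by [].
Qed.

(** The cells of full measure at all meshes pin down a single element of [G]; freeness of the action
    ensures that the elements found in the different cells for one pair coincide. *)
Lemma constant_graph : {ae nu, forall p : (X * X)%type, exists g, p.2 = T g p.1} ->
  exists g, {ae nu, forall p : (X * X)%type, p.2 = T g p.1}.
Proof.
move=> full.
have full' : {ae nu, forall p, graphs setT p}.
  by apply: filterS full => p [g E]; exists g.
have /choice[c hcell] := fun k => full_cell k full'.
have all : {ae nu, forall p, forall k, graphs (cell k (c k)) p} by exact: ae_foralln.
have [p0 hp0] : exists p0, forall k, graphs (cell k (c k)) p0.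
  apply: contrapT => no; apply: (@not_negligible_setT _ _ _ nu).
  by apply: negligibleS all => p _ /= hp; apply: no; exists p.
have [g0 _ E0] := hp0 0%N; exists g0; apply: filterS all => p hp.
have [g _ E] := hp 0%N.
suff -> : g0 = g by [].
apply: same_cells => k; exists (c k).
have [g1 c1 E1] := hp0 k; have [g2 c2 E2] := hp k.
split; first by rewrite (act_free hc hs hT (x := p0.1) (g := g0) (g' := g1))// -E0.
by rewrite (act_free hc hs hT (x := p.1) (g := g) (g' := g2))// -E.
Qed.

End Graphs.

(** * Simplicity and the centralizer *)

Section Dichotomy.
Variables (R : realType) (r : nat -> nat) (xi : nat -> set (set (zrz2 R))).
Variables (D : nat -> {fset zrz2 R}) (s : nat -> int * int -> zrz2 R).
Hypothesis hc : cf_choices r xi D s.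
Local Notation G := (zrz2 R).
Local Notation at_ := (atilde r).
Context {d : measure_display} {X : measurableType d} {mu : probability X R}.
Variable iota : nat -> G * (nat -> G) -> X.
Hypothesis hs : cf_space r s mu iota.
Variable T : G -> X -> X.
Hypothesis hT : cf_action r s iota T.
Local Notation cyl := (@cyl R r s d X iota).
Local Notation crd := (@crd R r s d X iota).
Local Notation Xn := (@Xn R r s d X iota).
Local Notation rho := (@rho R r s d X mu iota).
Local Notation S := (T ((1, 0), false)).
Local Notation SS := (square_map S).
Implicit Types (f g w : G) (n m : nat) (h : int * int) (A B : set G) (x y : X).

Let pS := act_preserving hc hs hT ((1, 0), false).

Section Joining.
Variable nu : probability (X * X)%type R.
Hypothesis jn : self_joining mu S nu.

(** One coordinate at a time: with the other set fixed, both sides are finite measures of the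
    remaining one. *)
Lemma product_of_intv :
  (forall m z (p q : R) e m' z' (p' q' : R) e', (0 < m)%N -> (0 < m')%N -> p < q -> p' < q' ->
    intv z p q e `<=` Fset r m -> intv z' p' q' e' `<=` Fset r m' ->
    fine (nu (cyl m (intv z p q e) `*` cyl m' (intv z' p' q' e'))) =
    fine (mu (cyl m (intv z p q e))) * fine (mu (cyl m' (intv z' p' q' e')))) ->
  product_joining mu nu.
Proof.
move=> H.
have mc m z p q e : (0 < m)%N -> measurable (cyl m (intv z p q e)).
  by move=> m0; apply: (measurable_cyl hc hs) => //; exact: measurable_intv.
have step1 (U : set X) m' z' p' q' e' : measurable U -> (0 < m')%N -> p' < q' ->
    intv z' p' q' e' `<=` Fset r m' ->
    nu (U `*` cyl m' (intv z' p' q' e')) = (mu U * mu (cyl m' (intv z' p' q' e')))%E.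
  move=> mU m0' pq' BF; set V := cyl m' _; have mV : measurable V by exact: mc.
  have mTV : measurable ([set: X] `*` V) by exact: measurableX.
  have E (W : set X) : fst @^-1` W `&` ([set: X] `*` V) = W `*` V.
    by apply/seteqP; split => [[x y] [/= Wx [_ Vy]]|[x y] [/= Wx Vy]].
  pose m1 := push_measure (mrestr nu mTV) (@measurable_fst _ _ X X).
  pose m2 := mscale (NngNum (prob_ge0 mu V)) mu.
  have hU : m1 U = m2 U.
    apply: (@measure_eq_cyl_intv R r xi D s hc d X mu iota hs m1 m2 _ _ U mU).
      have : (nu (fst @^-1` [set: X] `&` ([set: X] `*` V)) < +oo)%E.
        by rewrite E (prob_fine nu mTV) ltry.
      by [].
    move=> m z p q e m0 pq AF; have mA := mc m z p q e m0.
    have : nu (fst @^-1` cyl m (intv z p q e) `&` ([set: X] `*` V)) =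
        ((fine (mu V))%:E * mu (cyl m (intv z p q e)))%E.
      rewrite E (prob_fine nu (measurableX mA mV)) H//.
      by rewrite (prob_fine mu mA) -EFinM mulrC.
    by [].
  have : nu (fst @^-1` U `&` ([set: X] `*` V)) = ((fine (mu V))%:E * mu U)%E by exact: hU.
  by rewrite E muleC -(prob_fine mu mV).
have step2 (U V : set X) : measurable U -> measurable V -> nu (U `*` V) = (mu U * mu V)%E.
  move=> mU mV; have mTU : measurable (U `*` [set: X]) by exact: measurableX.
  have E (W : set X) : snd @^-1` W `&` (U `*` [set: X]) = U `*` W.
    by apply/seteqP; split => [[x y] [/= Wx [Vy _]]|[x y] [/= Wx Vy]].
  pose m1 := push_measure (mrestr nu mTU) (@measurable_snd _ _ X X).
  pose m2 := mscale (NngNum (prob_ge0 mu U)) mu.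
  have hV : m1 V = m2 V.
    apply: (@measure_eq_cyl_intv R r xi D s hc d X mu iota hs m1 m2 _ _ V mV).
      have : (nu (snd @^-1` [set: X] `&` (U `*` [set: X])) < +oo)%E.
        by rewrite E (prob_fine nu mTU) ltry.
      by [].
    move=> m z p q e m0 pq AF; have mA := mc m z p q e m0.
    have : nu (snd @^-1` cyl m (intv z p q e) `&` (U `*` [set: X])) =
        ((fine (mu U))%:E * mu (cyl m (intv z p q e)))%E.
      by rewrite E step1// (prob_fine mu mU).
    by [].
  have : nu (snd @^-1` V `&` (U `*` [set: X])) = ((fine (mu U))%:E * mu V)%E by exact: hV.
  by rewrite E -(prob_fine mu mU).
by move=> E mE; apply/esym; apply: (product_measure_unique (m' := nu)).
Qed.

Lemma dichotomy : ergodic nu SS ->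
  product_joining mu nu \/ exists g, {ae nu, forall p : (X * X)%type, p.2 = T g p.1}.
Proof.
move=> en.
have [|no] := pselect (product_joining mu nu); first by left.
right; apply: (constant_graph hc hs hT en); apply: contrapT => far; apply: no.
apply: product_of_intv => m z p q e m' z' p' q' e' m0 m0' pq pq' AF BF.
apply: contrapT => /eqP; rewrite -subr_eq0 -normr_gt0 => pos; apply: far.
have d0 : 0 < `|fine (nu (cyl m (intv z p q e) `*` cyl m' (intv z' p' q' e'))) -
  fine (mu (cyl m (intv z p q e))) * fine (mu (cyl m' (intv z' p' q' e')))| / 7 by rewrite divr_gt0.
have := separation hc hs hT jn en m0 m0' pq AF BF d0.
rewrite mulrC divfK// => /(_ (lexx _)); apply: filterS => x [K HK].
apply: (eventually_tiles hc hs hT (ltn0Sn K)) => n Kn; have [] := HK n (ltnW Kn).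
  by [].
by move=> _ _ nap; exact: nap.
Qed.

Lemma graph_of_ae g : {ae nu, forall p : (X * X)%type, p.2 = T g p.1} -> graph_joining mu (T g) nu.
Proof.
move=> hg A B mA mB; have mT := measurable_act hc hs hT g.
have mI : measurable (A `&` T g @^-1` B).
  by apply: measurableI => //; exact: (measurable_preimageT mT mB).
have [m1 <-] := joining_fst jn mI.
apply: prob_ae_eq => //; first exact: measurableX.
by apply: filterS hg => -[x y] /= ->.
Qed.

End Joining.

Lemma square_simple : two_fold_simple mu S.
Proof.
split; first exact: (act_invertible hc hs hT).
  exact: (S_ergodic hc hs hT).
move=> nu [jn en]; have [|[g hg]] := dichotomy jn en; first by right.
by left; exists (T g); [exact: (act_centralizer hc hs hT)|exact: graph_of_ae].
Qed.

(** Intervals of lengths 1 and 2 give cylinders of measures [rho 1] and [2 * rho 1], positive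
    numbers that cannot both equal their squares. *)
Lemma nontrivial_set : exists2 B : set X, measurable B & mu B <> (mu B * mu B)%E.
Proof.
have F (q : R) : q <= 2 -> intv 0 0 q false `<=` Fset r 1.
  move=> q2 g [/= g1 /andP[g2 g3] _]; have r0 := cf_r_gt0 hc 0.
  have a3 : (3 <= asize r 1)%N by rewrite /asize /= muln1; move: r0; clear; lia.
  have a3R : 3 <= (asize r 1)%:R :> R by rewrite ler_nat.
  split; first by rewrite g1; move: a3; clear; lia.
  by apply/andP; split; lra.
have v (q : R) : 0 < q -> q <= 2 -> measurable (cyl 1 (intv 0 0 q false)) /\
    mu (cyl 1 (intv 0 0 q false)) = (rho 1 * q)%:E.
  move=> q0 q2; have mI : measurable (intv 0 0 q false) by exact: measurable_intv.
  split; first exact: (measurable_cyl hc hs).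
  by rewrite (mu_cyl hc hs (ltn0Sn 0) mI (F q q2)) vol_intv ?subr0// ltW.
have [m1 v1] := v 1 ltr01 (ler1n _ 2); have [m2 v2] := v 2 (ltr0n _ 2) (lexx _).
have rho0 := rho_gt0 hc hs (ltn0Sn 0).
have [e1|] := pselect (mu (cyl 1 (intv 0 0 1 false)) =
   mu (cyl 1 (intv 0 0 1 false)) * mu (cyl 1 (intv 0 0 1 false)))%E; last by exists (cyl 1 (intv 0 0 1 false)).
exists (cyl 1 (intv 0 0 2 false)) => //; move: e1; rewrite v1 v2 -!EFinM => -[e1] [e2].
rewrite !mulr1 in e1; have a1 : rho 1 = 1 by apply: (mulfI (lt0r_neq0 rho0)); rewrite mulr1 -e1.
by move: e2; rewrite a1; lra.
Qed.

Lemma graph_probability (Q : X -> X) : measurable_fun setT Q ->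
  exists nu : probability (X * X)%type R, forall E, nu E = mu ((fun x => (x, Q x)) @^-1` E).
Proof.
move=> mQ; have mf : (fun x => (x, Q x)) \in @mfun _ _ X (X * X)%type.
  by rewrite inE; exact: measurable_fun_pair.
by exists (distribution mu (mfun_Sub mf)).
Qed.

Lemma centralizer_act (Q : X -> X) : centralizer mu S Q ->
  exists g, {ae mu, forall x, Q x = T g x}.
Proof.
move=> [[[mQ pQ] _] comm]; have [nu nuE] := graph_probability mQ.
have mS := pS.1.
have mgr : measurable_fun setT (fun x => (x, Q x)) by exact: measurable_fun_pair.
have mgrE (E : set (X * X)) : measurable E -> measurable ((fun x => (x, Q x)) @^-1` E).
  by move=> mE; exact: (measurable_preimageT mgr mE).
have mSS : measurable_fun setT SS.
  apply: measurable_fun_pair.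
    exact: measurableT_comp mS (@measurable_fst _ _ X X).
  exact: measurableT_comp mS (@measurable_snd _ _ X X).
have inv (E : set (X * X)) : measurable E ->
    {ae mu, forall x, (SS @^-1` E) (x, Q x) <-> E (S x, Q (S x))}.
  by move=> mE; apply: filterS comm => x; rewrite /square_map /= => ->.
have jn : self_joining mu S nu.
  split => [E mE|A mA|A mA]; rewrite !nuE.
  - rewrite -(pS.2 _ (mgrE E mE)); apply: prob_ae_eq.
    + exact: mgrE (measurable_preimageT mSS mE).
    + exact: (measurable_preimageT mS (mgrE E mE)).
    + exact: inv.
  - by congr (mu _); apply/seteqP; split => [x []|x].
  - by rewrite -[RHS]pQ//; congr (mu _); apply/seteqP; split => [x []|x].
(* An invariant set of pairs pulls back along [x -> (x, Q x)] to a set invariant under [S] almost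
   everywhere. *)
have en : ergodic nu SS.
  move=> E mE SE; rewrite !nuE; apply: (invariant_trivial hc hs hT (mgrE E mE)).
  by apply: filterS (inv E mE) => x; rewrite SE.
have [prod|[g [Z [mZ Z0 sub]]]] := dichotomy jn en.
  (* On the product of the preimage of [B] under [Q] with [B], the graph measure is [mu B] and the
     product measure is [mu B * mu B]. *)
  have [B mB nB] := nontrivial_set; exfalso; apply: nB.
  have mQB := measurable_preimageT mQ mB.
  have e1 : (mu \x mu)%E (Q @^-1` B `*` B) = (mu (Q @^-1` B) * mu B)%E by exact: product_measure1E.
  have e2 : nu (Q @^-1` B `*` B) = mu (Q @^-1` B).
    by rewrite nuE; congr (mu _); apply/seteqP; split => [x []|x].
  by have := prod _ (measurableX mQB mB); rewrite e1 e2 pQ.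
exists g, ((fun x => (x, Q x)) @^-1` Z); split; first exact: mgrE.
  by rewrite -nuE.
by move=> x /=; exact: (sub (x, Q x)).
Qed.

End Dichotomy.

Theorem proposition3p9 (R : realType)
    (r : nat -> nat) (xi : nat -> set (set (zrz2 R)))
    (D : nat -> {fset zrz2 R}) (s : nat -> int * int -> zrz2 R)
    (hchoices : cf_choices r xi D s)
    (d : measure_display) (X : measurableType d) (mu : probability X R)
    (iota : nat -> zrz2 R * (nat -> zrz2 R) -> X)
    (hspace : cf_space r s mu iota)
    (T : zrz2 R -> X -> X) (hT : cf_action r s iota T) :
  two_fold_simple mu (T ((1, 0), false)) /\
  (forall g : zrz2 R, centralizer mu (T ((1, 0), false)) (T g)) /\
  (forall Q : X -> X, centralizer mu (T ((1, 0), false)) Q ->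
     exists g : zrz2 R, {ae mu, forall x, Q x = T g x}).
Proof.
split; first exact: (square_simple hchoices hspace hT).
split; first exact: (act_centralizer hchoices hspace hT).
exact: (centralizer_act hchoices hspace hT).
Qed.
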